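(* Let $W$ be a finite irreducible real reflection group acting on $\mathbb R^\ell$ (and, by extension of scalars, on $\mathbb C^\ell$), let $R=\{r_1,\dots,r_\ell\}$ be the set of reflections through the walls of a Weyl chamber $C$, and let $\Lambda=\{\lambda_1,\dots,\lambda_\ell\}$ consist of one nonzero point from each extreme ray of $C$, indexed so that $\lambda_i$ lies on every wall of $C$ except the fixed hyperplane $H_i$ of $r_i$. Then: (i) $(W,R,\Lambda)$ is strongly stratified; (ii) $\rho(\Delta(W,R))$ is homeomorphic to the Coxeter complex of $(W,R)$ via radial projection; (iii) $\Delta(W,R)$ is homotopy Cohen-Macaulay; (iv) $(W,R,\Lambda)$ is locally conical.
   Context: A Weyl chamber is the closure of a connected component of the complement in $\mathbb R^\ell$ of the reflecting hyperplanes of $W$; its walls are the reflecting hyperplanes bounding it; the Coxeter complex is the simplicial decomposition of the unit sphere $\{x\in\mathbb R^\ell:|x|=1\}$ cut out by the reflecting hyperplanes. For $J\subseteq R$, $W_J$ is the subgroup generated by $J$. $\Delta(W,R)=\{gW_J:g\in W,J\subseteq R\}$ ordered by reverse inclusion, a simplicial poset whose vertices are $gW_{R\setminus\{r_i\}}$; the face $gW_{R\setminus J}$ has vertices $gW_{R\setminus\{r_i\}}$ ($r_i\in J$) and type $J$. The map $\rho$ from the geometric realization of $\Delta(W,R)$ to $\mathbb C^\ell$ sends $gW_{R\setminus\{r_i\}}\mapsto g\lambda_i$, extended by real barycentric coordinates over each simplex (so $gW_{R\setminus J}\mapsto g\cdot\mathrm{Hull}\{\lambda_i:r_i\in J\}$).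 $(W,R,\Lambda)$ is well-framed if $\rho$ is an embedding. $\mathscr L_W$ is the set of intersections of (complex) reflecting hyperplanes of $W$. Strongly stratified: well-framed and every $X\in\mathscr L_W$ contains $\rho(\sigma)$ for some face $\sigma$ of dimension $\dim X-1$. $\mathrm{Supp}(\sigma)$ is the complex span of $\rho(\sigma)$. For $U\subseteq R$, $\Delta^U$ is the closed star of the face $W_{R\setminus U}$; $\Pi^U=\{\mathrm{Supp}(\sigma):\sigma\in\Delta^U\}$, with $\hat1=\{0\}$. Locally conical: well-framed and for every nonempty $U\subseteq R$ and $X\in\Pi^U\setminus\{\hat1\}$, the subcomplex $\{\sigma\in\Delta^U:\rho(\sigma)\subseteq X\}$ has a cone point. A simplicial complex $\Sigma$ is homotopy Cohen-Macaulay if for every face $\sigma$ (including empty), $\pi_r(\mathrm{lk}_\Sigma\sigma)=0$ for $r\le\dim\mathrm{lk}_\Sigma\sigma-1$. *)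

(* Defs.v *)
From HB Require Import structures.
From mathcomp Require Import all_boot all_order all_algebra.
From mathcomp Require Import all_fingroup all_solvable all_field all_character.
From mathcomp Require Import complex.
From mathcomp Require Import all_classical all_reals all_analysis.
From Stdlib Require Import Relation_Operators.

Set Implicit Arguments.
Unset Strict Implicit.
Unset Printing Implicit Defensive.

Import Order.TTheory GRing.Theory Num.Theory.
Import numFieldTopology.Exports.

Local Open Scope classical_set_scope.
Local Open Scope ring_scope.
Local Open Scope complex_scope.

(* The usual topology of the complex plane: open sets for the balls of the
   complex modulus, as given by [R[i]^o]. *)
HB.instance Definition _ (R : rcfType) := PseudoPointedMetric.copy R[i] R[i]^o.

Section Topology.

Definition is_embedding (X Y : topologicalType) (f : X -> Y) : Prop :=
  [/\ injective f, continuous f &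
      forall U : set X, open U ->
        exists2 V : set Y, open V & f @` U = V `&` range f].

Definition homeo_on (X Y : topologicalType) (A : set X) (B : set Y)
    (f : X -> Y) : Prop :=
  [/\ set_bij A B f, {within A, continuous f} &
      exists g : Y -> X,
        {within B, continuous g} /\ (forall x, A x -> g (f x) = x)].

Variable R : realType.

Definition unit_cube (r : nat) : set {ptws 'I_r -> R} :=
  [set s | forall i, 0 <= s i <= 1].

Definition unit_cube_boundary (r : nat) : set {ptws 'I_r -> R} :=
  [set s | unit_cube s /\ exists i, s i = 0 \/ s i = 1].

(* pi_r(A, x0) = 0 for every base point x0 of the subspace A of Y: each map of
   pairs from the r-cube and its boundary to (A, x0) is homotopic, relative to
   the boundary, to the constant map.  For r = 0 the boundary is empty and
   this says that A has at most one path component. *)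
Definition pi_trivial (r : nat) (Y : topologicalType) (A : set Y) : Prop :=
  forall (x0 : Y) (f : {ptws 'I_r -> R} -> Y),
    A x0 ->
    {within unit_cube (r := r), continuous f} ->
    (forall s, unit_cube s -> A (f s)) ->
    (forall s, unit_cube_boundary s -> f s = x0) ->
    exists h : {ptws 'I_r -> R} * R -> Y,
      [/\ {within unit_cube (r := r) `*` `[0, 1], continuous h},
          (forall s u, unit_cube s -> 0 <= u <= 1 -> A (h (s, u))),
          (forall s, unit_cube s -> h (s, 0) = f s),
          (forall s, unit_cube s -> h (s, 1) = x0) &
          (forall s u, unit_cube_boundary s -> 0 <= u <= 1 -> h (s, u) = x0)].

End Topology.

Section SimplicialComplex.
Variables (R : realType) (V : finType).
Implicit Types (K : {set {set V}}) (s : {set V}).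

(* The empty simplex is a member of every complex considered here. *)
Definition simplicial_complex K : Prop :=
  finset.set0 \in K /\
  forall s s' : {set V}, s \in K -> s' \subset s -> s' \in K.

Definition dimc K : int := (\max_(s in K) #|s|)%N%:Z - 1.

Definition link K s : {set {set V}} :=
  [set s' in K | [disjoint s' & s] & (s' :|: s)%SET \in K]%SET.

(* Barycentric coordinates, indexed by all of [V], whose support is a simplex. *)
Definition realization K : set {ptws V -> R} :=
  [set t | [/\ forall v, 0 <= t v, \sum_v t v = 1 &
               finset (fun v => t v != 0) \in K]].

Definition homotopy_CM K : Prop :=
  forall s, s \in K ->
  forall r : nat, r%:Z <= dimc (link K s) - 1 ->
    pi_trivial R r (realization (link K s)).

End SimplicialComplex.

Section Linear.
Variables (F : fieldType) (l : nat).

Definition fixv (A : 'M[F]_l) : {vspace 'cV[F]_l} :=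
  fixedSpace (linfun (mulmx A)).

Definition span_of (A : set 'cV[F]_l) (X : {vspace 'cV[F]_l}) : Prop :=
  (forall x, A x -> x \in X) /\
  (forall Y : {vspace 'cV[F]_l}, (forall x, A x -> x \in Y) -> (X <= Y)%VS).

Variables (gT : finGroupType) (G : {group gT}) (rG : mx_representation F G l).

(* Elements fixing a hyperplane pointwise; [G] being finite, the finite order
   required of a reflection is automatic. *)
Definition reflections : {set gT} :=
  [set t in G | (\dim (fixv (rG t))).+1 == l]%SET.

(* The intersection lattice of the reflecting hyperplanes; the empty
   intersection is the whole space. *)
Definition in_lattice (X : {vspace 'cV[F]_l}) : Prop :=
  exists2 A : {set gT}, A \subset reflections &
    X = (\bigcap_(t in A) fixv (rG t))%VS.

(* [G] acts on column vectors on the left, faithfully, as a group generated by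
   reflections.  No invariant inner product is fixed. *)
Definition reflection_group : Prop :=
  mx_faithful rG /\ (<<reflections>>%g = G :> {set gT}).

Definition irreducible_action : Prop :=
  (0 < l)%N /\
  forall U : {vspace 'cV[F]_l},
    (forall g x, g \in G -> x \in U -> rG g *m x \in U) ->
    U = 0%VS \/ U = fullv.

End Linear.

Section Cosets.
Variables (gT : finGroupType) (G : {group gT}) (l : nat) (r : 'I_l -> gT).

(* Subsets of the generating set [r 0, ..., r (l - 1)] are given by their sets
   of indices. *)
Definition parab (J : {set 'I_l}) : {set gT} := <<[set r i | i in J]%SET>>%g.

(* Delta(W,R), ordered by reverse inclusion: a face [s] lies below a face [s']
   when [s' \subset s]. *)
Definition Delta : {set {set gT}} :=
  [set s | [exists J : {set 'I_l}, s \in lcosets (parab J) G]]%SET.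

Definition vertices : {set {set gT}} :=
  [set v | [exists i : 'I_l, v \in lcosets (parab (~: [set i])%SET) G]]%SET.

Definition verts (s : {set gT}) : {set {set gT}} :=
  [set v in vertices | s \subset v]%SET.

Definition fdim (s : {set gT}) : int := #|verts s|%:Z - 1.

(* The closed star of the face W_{R - U}. *)
Definition star (U : {set 'I_l}) : {set {set gT}} :=
  [set s in Delta | [exists s' in Delta,
     (s' \subset s) && (s' \subset parab (~: U)%SET)]]%SET.

Definition face_complex : {set {set {set gT}}} := [set verts s | s in Delta]%SET.

End Cosets.

(* Delta(W,R) is, as a poset, the face poset of a simplicial complex on its
   vertices, and this complex is homotopy Cohen-Macaulay. *)
Definition Delta_homotopy_CM (R : realType) (gT : finGroupType)
    (G : {group gT}) (l : nat) (r : 'I_l -> gT) : Prop :=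
  [/\ {in Delta G r &, forall s s' : {set gT},
         (verts G r s \subset verts G r s') = (s' \subset s)},
      simplicial_complex (face_complex G r) &
      homotopy_CM R (face_complex G r)].

(* Delta(W,R) is a priori only a simplicial poset, so its realization is built
   by gluing one closed simplex per face along the face inclusions. *)
Section Realization.
Variables (R : realType) (gT : finGroupType) (G : {group gT}) (l : nat).
Variable r : 'I_l -> gT.

Definition simplex (s : {set gT}) : set {ptws {set gT} -> R} :=
  [set t | [/\ forall v, 0 <= t v, \sum_v t v = 1 &
               forall v, v \notin verts G r s -> t v = 0]].

Definition face : Type := {s : {set gT} | s \in Delta G r}.
HB.instance Definition _ := Choice.on face.

Definition simplices : Type := {s : face & set_type (simplex (val s))}.
HB.instance Definition _ := Topological.on simplices.

Definition coords (p : simplices) : {set gT} -> R := set_val (projT2 p).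

Definition face_incl (p q : simplices) : Prop :=
  val (projT1 q) \subset val (projT1 p) /\ coords p = coords q.

Definition glue (p q : simplices) : bool :=
  `[< clos_refl_sym_trans _ face_incl p q >].

Lemma glue_refl : reflexive glue.
Proof. by move=> p; apply/asboolP; exact: rst_refl. Qed.

Lemma glue_sym : symmetric glue.
Proof. by move=> p q; apply/asboolP/asboolP; exact: rst_sym. Qed.

Lemma glue_trans : transitive glue.
Proof.
by move=> q p s /asboolP pq /asboolP qs; apply/asboolP; apply: rst_trans pq qs.
Qed.

Definition glue_rel := EquivRel glue glue_refl glue_sym glue_trans.

Definition geom : Type := {eq_quot glue_rel}%qT.
HB.instance Definition _ := Quotient.on geom.
HB.instance Definition _ := Topological.copy geom (quotient_topology geom).

End Realization.

Section Framing.
Variables (R : realType) (gT : finGroupType) (G : {group gT}) (l : nat).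
Variable rG : mx_representation R[i] G l.
Variables (r : 'I_l -> gT) (lam : 'I_l -> 'cV[R[i]]_l).

(* The image [g lambda_i] of the vertex [g W_{R - r_i}]; the default value is
   only reached when [v] is not a vertex. *)
Definition rho_vertex (v : {set gT}) : 'cV[R[i]]_l :=
  if [pick p : gT * 'I_l |
        (p.1 \in G) && (v == (p.1 *: parab r (~: [set p.2])%SET)%g)]
    is Some p then rG p.1 *m lam p.2 else 0.

Definition barycenter (t : {set gT} -> R) : 'cV[R[i]]_l :=
  \sum_v (t v)%:C *: rho_vertex v.

(* Gluing identifies only points with the same barycentric coordinates, so the
   choice of a representative is immaterial. *)
Definition rho (x : geom R G r) : 'cV[R[i]]_l :=
  barycenter (coords (generic_quotient.repr x)).

Definition rho_face (s : {set gT}) : set 'cV[R[i]]_l :=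
  barycenter @` simplex G r s.

Definition well_framed : Prop := is_embedding rho.

Definition strongly_stratified : Prop :=
  well_framed /\
  forall X, in_lattice rG X ->
    exists s : {set gT},
      [/\ s \in Delta G r, rho_face s `<=` [set z | z \in X] &
          fdim G r s = (\dim X)%:Z - 1].

(* Pi^U; Supp(s) is the complex span of [rho_face s]. *)
Definition in_Pi (U : {set 'I_l}) (X : {vspace 'cV[R[i]]_l}) : Prop :=
  exists2 s : {set gT}, s \in star G r U & span_of (rho_face s) X.

Definition star_in (U : {set 'I_l}) (X : {vspace 'cV[R[i]]_l})
    (s : {set gT}) : Prop :=
  s \in star G r U /\ rho_face s `<=` [set z | z \in X].

Definition cone_point (S : {set gT} -> Prop) (v : {set gT}) : Prop :=
  [/\ v \in vertices G r, S v &
      forall s, S s -> exists s', [/\ S s', s' \subset s & s' \subset v]].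

Definition locally_conical : Prop :=
  well_framed /\
  forall (U : {set 'I_l}) (X : {vspace 'cV[R[i]]_l}),
    U != finset.set0 -> in_Pi U X -> X <> 0%VS ->
    exists v, cone_point (star_in U X) v.

End Framing.

Section Real.
Variables (R : realType) (gT : finGroupType) (G : {group gT}) (l : nat).
Variable rG : mx_representation R G l.

Definition complexify (x : 'cV[R]_l) : 'cV[R[i]]_l := map_mx (real_complex R) x.

Definition complex_repr : mx_representation R[i] G l :=
  map_repr (real_complex R) rG.

Definition arrangement_complement : set 'cV[R]_l :=
  [set x | forall t, t \in reflections rG -> x \notin fixv (rG t)].

Definition weyl_chamber (C : set 'cV[R]_l) : Prop :=
  exists2 x, arrangement_complement x &
    C = closure (connected_component arrangement_complement x).

(* The reflecting hyperplane of [t] bounds the chamber [C]: it meets [C] in a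
   set of full dimension in the hyperplane. *)
Definition is_wall (C : set 'cV[R]_l) (t : gT) : Prop :=
  t \in reflections rG /\
  span_of (C `&` [set x | x \in fixv (rG t)]) (fixv (rG t)).

Definition wall_reflections (C : set 'cV[R]_l) (r : 'I_l -> gT) : Prop :=
  injective r /\ forall t, is_wall C t <-> exists i, r i = t.

Definition extreme (C : set 'cV[R]_l) (x : 'cV[R]_l) : Prop :=
  [/\ C x, x != 0 &
      forall y z, C y -> C z -> x = y + z ->
        exists2 c : R, 0 <= c & y = c *: x].

Definition ray_points (C : set 'cV[R]_l) (r : 'I_l -> gT)
    (lam : 'I_l -> 'cV[R]_l) : Prop :=
  [/\ forall i, extreme C (lam i),
      forall x, extreme C x ->
        exists! i, exists2 c : R, 0 < c & x = c *: lam i &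
      forall i j, (lam i \in fixv (rG (r j))) = (j != i)].

Definition sphere : set 'cV[R]_l := [set x | \sum_i x i 0 ^+ 2 = 1].

(* The closed cells (including the empty one) into which the reflecting
   hyperplanes cut the unit sphere: traces on the sphere of the intersections
   of a chamber with reflecting hyperplanes. *)
Definition coxeter_cells : set (set 'cV[R]_l) :=
  [set c | exists C X, [/\ weyl_chamber C, in_lattice rG X &
             c = C `&` [set x | x \in X] `&` sphere]].

Definition radial (z : 'cV[R[i]]_l) : 'cV[R[i]]_l :=
  (sqrtC (\sum_i `|z i 0| ^+ 2))^-1 *: z.

Definition radially_coxeter_complex (r : 'I_l -> gT)
    (lam : 'I_l -> 'cV[R]_l) : Prop :=
  let lamC := complexify \o lam in
  homeo_on (range (rho (R := R) complex_repr (r := r) lamC))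
    (complexify @` sphere) radial /\
  [set radial @` rho_face complex_repr r lamC s | s in [set` Delta G r]] =
  [set complexify @` c | c in coxeter_cells].

End Real.

(* Main.v *)
(* The chamber [C] is the simplicial cone spanned by the [lam i], and it is a fundamental
   domain: an element of [W] that maps a point [x] of [C] into [C] fixes [x] and belongs to
   the parabolic subgroup of the walls through [x].  So the cones over the faces [g W_J] form
   a complete fan in R^l, whose piecewise linear coordinates invert [rho]; this gives the
   embedding and the radial homeomorphism, and a generic point of a lattice element [X] lies
   in the relative interior of a cone spanning [X].  The link of a face is in the same way a
   retract of a punctured space of dimension [m], whose homotopy groups of degree less than
   [m - 1] vanish because a Lipschitz map misses the opposite of some ray close to the base
   point.  For the cone points, let [X] be the span of a face of the star of [W_(R - U)] with
   vertices indexed by [K]: if [U] meets [K], any common index works, and otherwise the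
   connectedness of the Dynkin diagram gives an index in [K] that is adjacent to the
   component of [U] outside [K], and the corresponding vertex is joinable to all others. *)

Require Import Defs.
From mathcomp Require Import all_boot all_order all_algebra.
From mathcomp Require Import all_fingroup all_solvable all_field all_character.
From mathcomp Require Import complex.
From mathcomp Require Import all_classical all_reals all_analysis.
From mathcomp Require Import zify ring lra.
From Stdlib Require Import Relation_Operators.

Set Implicit Arguments.
Unset Strict Implicit.
Unset Printing Implicit Defensive.

Import Order.TTheory GRing.Theory Num.Theory.
Import numFieldNormedType.Exports.

Local Open Scope classical_set_scope.
Local Open Scope ring_scope.

(** * Continuity and homotopy groups *)

Section Generic.

(** The representation carries no inner product, no root lengths and no choice of positive roots. A
    form summed over [W] shows that reflections act by the usual formula. After that, nearly all
    sign information comes from one fact: no reflecting hyperplane cuts a chamber, so each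
    functional [coef i \o act g] has a single sign on all the [lam j]. This dichotomy yields the
    obtuse simple roots, the exchange property and the fundamental domain, without a length function
    on [W]. The realization is a quotient of a disjoint union of simplices, on which an inverse of
    [rho] is awkward to write down. The piecewise linear coordinates are used for injectivity, and
    compactness supplies the topology. The same coordinates, taken with parameters [g] and [J],
    serve both the whole complex and every link. For the homotopy groups, a merely continuous map
    from a low-dimensional cube may fill space, so counting cells proves nothing about it. Hence the
    passage to Lipschitz maps, which must be exact on the boundary of the cube because homotopies
    are relative to it. *)

Lemma ptws_continuous_at (X : topologicalType) (I : Type) (Y : topologicalType)
    (f : X -> {ptws I -> Y}) (x : X) :
  (forall i, {for x, continuous (fun x => f x i)}) -> {for x, continuous f}.
Proof.
move=> cf; apply/cvg_sup => i U [V [[W oW <-] Wfx VU]].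
exact: (filterS VU (cf i _ (open_nbhs_nbhs (conj oW Wfx)))).
Qed.

Lemma ptws_continuous (X : topologicalType) (I : Type) (Y : topologicalType)
    (f : X -> {ptws I -> Y}) :
  (forall i, continuous (fun x => f x i)) -> continuous f.
Proof. by move=> cf x; apply: ptws_continuous_at => i; exact: cf. Qed.

Lemma mx_continuous (X T : topologicalType) m n (f : X -> 'M[T]_(m, n)) :
  (forall i j, continuous (fun x => f x i j)) -> continuous f.
Proof.
move=> cf x U [P Pfx PU]; apply: (@filterS _ _ _ _ _ PU).
near=> y => i j; move: i j; near: y.
apply: filter_forall => i; apply: filter_forall => j.
exact: cf (Pfx i j).
Unshelve. all: by end_near. Qed.

(** The pasting lemma for a finite closed cover. It will glue linear coordinate functions over the
    cones of a fan. *)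
Lemma closed_cover_continuous (X Y : topologicalType) (I : finType)
    (D : I -> set X) (g : I -> X -> Y) (f : X -> Y) :
  (forall x, exists i, D i x) -> (forall i, closed (D i)) ->
  (forall i, continuous (g i)) -> (forall i x, D i x -> f x = g i x) ->
  continuous f.
Proof.
move=> cov cD cg fg; apply/continuous_closedP => F cF.
have -> : f @^-1` F = \bigcup_(i in [set: I]) (D i `&` g i @^-1` F).
  apply/seteqP; split => x /=.
    by have [i Di] := cov x; rewrite (fg _ _ Di) => Fx; exists i.
  by case=> i _ [Di] /=; rewrite -(fg _ _ Di).
apply: closed_bigcup; first exact: finite_finset.
by move=> i _; apply: closedI => //; exact: (continuous_closedP _).1 (cg i) _ cF.
Qed.

Lemma compact_closed_map (X Y : topologicalType) (A : set X) (f : X -> Y) :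
  hausdorff_space Y -> compact A -> {within A, continuous f} ->
  forall F, closed F -> closed (f @` (A `&` F)).
Proof.
move=> hY cA cf F cF; apply: compact_closed => //.
apply: continuous_compact; last exact: compact_closedI.
by apply: continuous_subspaceW cf => x [].
Qed.

Lemma within_comp (X Y Z : topologicalType) (A : set X) (B : set Y)
    (f : X -> Y) (g : Y -> Z) :
  {within A, continuous f} -> {within B, continuous g} ->
  (forall x, A x -> B (f x)) -> {within A, continuous (g \o f)}.
Proof.
move=> /subspace_continuousP cf /subspace_continuousP cg fAB.
apply/subspace_continuousP => x Ax U /(cg _ (fAB _ Ax)) gU.
move: (cf x Ax _ gU); rewrite !nbhs_simpl /within /=; apply: filterS => y h Ay.
by apply: h => //; apply: fAB.
Qed.

(** A cube in [A] is pushed to [B] by [phi], contracted there and brought back by [psi]; the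
    identity [psi (phi y) = y] on [A] preserves the boundary values. Continuity of [psi] is asked
    only within [B], because the intended [psi] divides by a quantity that vanishes outside it. *)
Lemma pi_trivial_retract (R : realType) r (Y Z : topologicalType)
    (A : set Y) (B : set Z) (phi : Y -> Z) (psi : Z -> Y) :
  continuous phi -> {within B, continuous psi} ->
  (forall y, A y -> B (phi y)) -> (forall z, B z -> A (psi z)) ->
  (forall y, A y -> psi (phi y) = y) ->
  pi_trivial R r B -> pi_trivial R r A.
Proof.
move=> cphi cpsi AB BA psiK pB x0 f Ax0 cf fA fx0.
have [||||h [ch hB h0 h1 hbd]] := pB (phi x0) (phi \o f).
- exact: AB.
- exact: (@within_comp _ _ _ _ setT _ _ cf (continuous_subspaceT cphi)).
- by move=> s cs; apply: AB; apply: fA.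
- by move=> s cs /=; rewrite fx0.
exists (psi \o h); split.
- by apply: within_comp ch cpsi _ => -[s u] [cs hu]; apply: hB.
- by move=> s u cs hu; apply: BA; apply: hB.
- by move=> s cs /=; rewrite h0 //= psiK //; apply: fA.
- by move=> s cs /=; rewrite h1 // psiK.
- by move=> s u cs hu /=; rewrite hbd // psiK.
Qed.

End Generic.

Section RealContinuity.
Variables (K : numFieldType) (X : topologicalType).
Implicit Types f g : X -> K^o.

Lemma continuous_addf f g :
  continuous f -> continuous g -> continuous (fun x => f x + g x).
Proof. by move=> cf cg x; apply: cvgD; [exact: cf | exact: cg]. Qed.

Lemma continuous_subf f g :
  continuous f -> continuous g -> continuous (fun x => f x - g x).
Proof. by move=> cf cg x; apply: cvgB; [exact: cf | exact: cg]. Qed.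

Lemma continuous_mulf f g :
  continuous f -> continuous g -> continuous (fun x => f x * g x).
Proof. by move=> cf cg x; apply: cvgM; [exact: cf | exact: cg]. Qed.

Lemma continuous_sumf (I : Type) (s : seq I) (P : pred I) (F : I -> X -> K^o) :
  (forall i, P i -> continuous (F i)) ->
  continuous (fun x => \sum_(i <- s | P i) F i x).
Proof. by move=> cF; apply: continuous_big => //; exact: add_continuous. Qed.

Lemma continuous_cstf (c : K) : continuous ((fun=> c) : X -> K^o).
Proof. by move=> x; exact: cvg_cst. Qed.

Lemma continuous_coordf m n (f : X -> 'M[K]_(m, n)) i j :
  continuous f -> continuous (fun x => f x i j : K^o).
Proof. move=> cf x.
exact: (@continuous_comp X _ K^o f (fun M => M i j) x (cf x) (@coord_continuous K m n i j _)). Qed.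

Lemma continuous_normf f : continuous f -> continuous (fun x => `|f x| : K^o).
Proof. by move=> cf x; apply: cvg_norm; exact: cf. Qed.

Lemma continuous_at_dominated f (D : X -> K^o) x :
  (forall y, `|f x - f y| <= D y) -> D x = 0 -> {for x, continuous D} ->
  {for x, continuous f}.
Proof.
move=> fD D0 cD; apply/cvgrPdist_lt => e e0.
move: cD; rewrite /prop_for /continuous_at D0 => /cvgrPdist_lt /(_ e e0).
apply: filterS => y; rewrite sub0r normrN => h.
by apply: le_lt_trans (fD y) (le_lt_trans (real_ler_norm _) h); exact: ger0_real (le_trans _ (fD y)).
Qed.

End RealContinuity.

(** * Low homotopy groups of a punctured space *)

Section Cube.
Variables (R : realType) (r : nat).
Local Notation X := {ptws 'I_r -> R}.

(** The retraction onto the unit interval. Coordinatewise it extends maps continuous within the cube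
    to the whole space, and on the time parameter it serves as a ramp between the stages of a
    homotopy. *)
Definition clamp01 (x : R) : R := Num.min 1 (Num.max 0 x).
Definition clamp (s : X) : X := fun i => clamp01 (s i).
Definition dist1 (s s' : X) : R := \sum_i `|s i - s' i|.

Lemma ptws_eval_continuous (I : eqType) (i : I) :
  continuous (fun s : {ptws I -> R} => s i).
Proof. exact: (@proj_continuous I (fun=> R) i). Qed.

Lemma clamp01_continuous : continuous clamp01.
Proof.
move=> x; apply: (@continuous_min _ R (cst 1)); first exact: cst_continuous.
by apply: (@continuous_max _ R (cst 0)); first exact: cst_continuous.
Qed.

Lemma clamp01_bounds x : 0 <= clamp01 x <= 1.
Proof. by rewrite /clamp01 le_min ler01 le_max lexx /= ge_min lexx. Qed.

Lemma clamp01_id x : 0 <= x <= 1 -> clamp01 x = x.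
Proof. by case/andP => x0 x1; rewrite /clamp01 (max_idPr _) // (min_idPr _). Qed.

Lemma clamp_continuous : continuous clamp.
Proof.
apply: ptws_continuous => i s.
by apply: (continuous_comp (@ptws_eval_continuous _ i s)); exact: clamp01_continuous.
Qed.

Lemma clamp_cube s : unit_cube (clamp s).
Proof. by move=> i; exact: clamp01_bounds. Qed.

Lemma clamp_id s : unit_cube s -> clamp s = s.
Proof. by move=> cs; apply/funext => i; exact: clamp01_id. Qed.

Lemma cube_compact : compact (unit_cube (R := R) (r := r)).
Proof.
rewrite (_ : unit_cube (r := r) = [set s | forall i, `[0, 1]%classic (s i)]).
  by apply: (@tychonoff _ (fun=> R) (fun=> `[0, 1]%classic)) => i; exact: segment_compact.
by apply/seteqP; split => s cs i; have := cs i; rewrite /= in_itv.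
Qed.

Lemma cube_neq0 : unit_cube (R := R) (r := r) !=set0.
Proof. by exists (clamp (fun=> 0)); exact: clamp_cube. Qed.

Lemma dist1_ge0 s s' : 0 <= dist1 s s'.
Proof. exact: sumr_ge0. Qed.

Lemma dist1C s s' : dist1 s s' = dist1 s' s.
Proof. by apply: eq_bigr => i _; rewrite distrC. Qed.

Lemma dist1_triangle s' s s'' : dist1 s s'' <= dist1 s s' + dist1 s' s''.
Proof. by rewrite /dist1 -big_split; apply: ler_sum => i _ /=; exact: ler_distD. Qed.

Lemma dist1_eq0 s s' : dist1 s s' = 0 -> s = s'.
Proof.
move/eqP; rewrite psumr_eq0 // => /allP d0; apply/funext => i.
by have := d0 i (mem_index_enum i); rewrite /= normr_eq0 subr_eq0 => /eqP.
Qed.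

Lemma dist1_id s : dist1 s s = 0.
Proof. by rewrite /dist1 big1 // => i _; rewrite subrr normr0. Qed.

Lemma dist1_continuous : continuous (fun p : X * X => dist1 p.1 p.2).
Proof.
apply: (@continuous_sumf R _ _ _ _ (fun i (p : X * X) => `|p.1 i - p.2 i|)) => i _.
apply: (@continuous_normf R).
apply: (@continuous_subf R _ (fun p : X * X => p.1 i) (fun p => p.2 i)) => p.
  exact: (continuous_comp (@cvg_fst _ _ _ _ _) (@ptws_eval_continuous _ i _)).
exact: (continuous_comp (@cvg_snd _ _ _ _ _) (@ptws_eval_continuous _ i _)).
Qed.

Lemma dist1_lipschitz_continuous (f : X -> R) L :
  (forall s s', `|f s - f s'| <= L * dist1 s s') -> continuous f.
Proof.
move=> fL s.
apply: (@continuous_at_dominated R X f (fun s' => L * dist1 s s')) => //.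
  by rewrite dist1_id mulr0.
have cd : continuous (fun s' : X => dist1 s s').
  apply: (@continuous_sumf R _ _ _ _ (fun i (s' : X) => `|s i - s' i|)) => i _.
  apply: (@continuous_normf R).
  apply: (@continuous_subf R X (cst (s i)) (fun s' => s' i)).
    exact: continuous_cstf.
  exact: ptws_eval_continuous.
by apply: (@continuous_mulf R X (cst L) _ _ cd); exact: continuous_cstf.
Qed.

(** The pairs with [e <= f s - f s'] form a compact set off the diagonal. On it the distance has a
    positive minimum and the difference a maximum, and [L] is their quotient; all other pairs are
    absorbed by the term [e]. *)
Lemma almost_lipschitz (f : X -> R) (e : R) : continuous f -> 0 < e ->
  exists2 L, 0 < L & forall s s', unit_cube s -> unit_cube s' ->
    f s - f s' <= e + L * dist1 s s'.
Proof.
move=> cf e0.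
have cfst : continuous (fun p : X * X => f p.1).
  by move=> p; exact: (continuous_comp (@cvg_fst _ _ _ _ _) (cf _)).
have csnd : continuous (fun p : X * X => f p.2).
  by move=> p; exact: (continuous_comp (@cvg_snd _ _ _ _ _) (cf _)).
have cdf : continuous (fun p : X * X => f p.1 - f p.2).
  exact: (@continuous_subf R _ _ _ cfst csnd).
pose K : set (X * X) := (unit_cube (r := r) `*` unit_cube (r := r)) `&`
  (fun p => f p.1 - f p.2) @^-1` [set x | e <= x].
have cK : compact K.
  apply: compact_closedI; first exact: compact_setX cube_compact cube_compact.
  exact: (continuous_closedP _).1 cdf _ (@closed_ge _ e).
have [K0|/set0P/negP/negPn/eqP K0] := pselect (K !=set0); last first.
  exists 1 => // s s' cs cs'; apply: (@le_trans _ _ e); last first.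
    by rewrite lerDl mul1r dist1_ge0.
  rewrite leNgt; apply/negP => h.
  suff : K (s, s') by rewrite K0.
  by split => //=; apply: ltW.
have [c] := compact_EVT_min K0 cK (continuous_subspaceT dist1_continuous).
rewrite inE => Kc cmin; have /= ec := Kc.2.
have [d _ dmax] := compact_EVT_max K0 cK (continuous_subspaceT cdf).
have dc0 : 0 < dist1 c.1 c.2.
  rewrite lt_neqAle dist1_ge0 andbT eq_sym; apply/eqP => /dist1_eq0 cc.
  by move: ec; rewrite cc subrr leNgt e0.
have M0 : e <= f d.1 - f d.2 by apply: le_trans ec (dmax c _); rewrite inE.
exists ((f d.1 - f d.2) / dist1 c.1 c.2).
  by rewrite divr_gt0 //; apply: lt_le_trans M0.
move=> s s' cs cs'; have [ess|/ltW ess] := leP e (f s - f s'); last first.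
  apply: (le_trans ess); rewrite lerDl mulr_ge0 ?dist1_ge0 //.
  by rewrite divr_ge0 ?dist1_ge0 // (le_trans (ltW e0)).
have Kss : (s, s') \in K by rewrite inE; split.
apply: (@le_trans _ _ (f d.1 - f d.2)); first exact: (dmax (s, s')).
rewrite -[X in X <= _]add0r lerD ?(ltW e0) // mulrAC ler_pdivlMr //.
by rewrite ler_wpM2l ?(le_trans (ltW e0)) //; exact: (cmin (s, s')).
Qed.

(** [g] is the infimal convolution of [f] with [L * dist1]. It is [L]-Lipschitz by the triangle
    inequality and lies below [f] on the cube; the bound of [almost_lipschitz] says precisely that
    it falls short of [f] by at most [e]. *)
Lemma lipschitz_approx (f : X -> R) (e : R) : continuous f -> 0 < e ->
  exists (g : X -> R) (L : R), [/\ 0 < L,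
    forall s s', `|g s - g s'| <= L * dist1 s s' &
    forall s, unit_cube s -> `|g s - f s| <= e].
Proof.
move=> cf e0; have [L L0 fL] := almost_lipschitz cf e0.
pose S s := [set f s' + L * dist1 s s' | s' in unit_cube (r := r)].
have [c _ cmin] := compact_EVT_min cube_neq0 cube_compact (continuous_subspaceT cf).
have S0 s : S s !=set0.
  by have [s0 cs0] := cube_neq0; exists (f s0 + L * dist1 s s0); exists s0.
have lbS s : lbound (S s) (f c).
  move=> _ [s' cs' <-]; rewrite -[f c]addr0 lerD //.
    by apply: cmin; rewrite inE.
  by rewrite mulr_ge0 ?dist1_ge0 // ltW.
have infS s : has_inf (S s) by split => //; exists (f c).
pose g s := inf (S s).
have gL s s' : g s - g s' <= L * dist1 s s'.
  rewrite lerBlDr -lerBlDl; apply: lb_le_inf => // _ [s'' cs'' <-].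
  rewrite lerBlDr; apply: (@le_trans _ _ (f s'' + L * dist1 s s'')).
    by apply: ge_inf; [exact: (infS s).2 | exists s''].
  by rewrite -addrA lerD2l -mulrDr ler_wpM2l ?(ltW L0) // addrC dist1_triangle.
exists g, L; split => // [s s'|s cs].
  by rewrite ler_norml lerNl opprB gL andbT dist1C gL.
have gf : g s <= f s.
  by apply: ge_inf; [exact: (infS s).2 | exists s => //; rewrite dist1_id mulr0 addr0].
rewrite distrC ger0_norm ?subr_ge0 // lerBlDr -lerBlDl.
apply: lb_le_inf => // _ [s' cs' <-].
by have := fL s s' cs cs'; lra.
Qed.

End Cube.

Section SoftThreshold.
Variable R : realType.
Implicit Types e x y : R.

(** Soft thresholding: values are moved towards 0 by [e], and those in the interval from [-e] to [e]
    become 0. Being 1-Lipschitz, it restores exact boundary values after an approximation within [e]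
    without spoiling the Lipschitz constant. *)
Definition soft e x : R := x - Num.max (- e) (Num.min e x).

Lemma soft_eq0 e x : `|x| <= e -> soft e x = 0.
Proof.
by rewrite ler_norml => /andP[h1 h2]; rewrite /soft (min_idPr h2) (max_idPr h1) subrr.
Qed.

Lemma soft_dist e x : 0 <= e -> `|soft e x - x| <= e.
Proof.
move=> e0; rewrite /soft addrAC subrr sub0r normrN ler_norml le_max lexx /=.
by rewrite ge_max ge_min lexx /= andbT; lra.
Qed.

Lemma soft_lipschitz e x y : 0 <= e -> `|soft e x - soft e y| <= `|x - y|.
Proof.
move=> e0; rewrite /soft.
wlog xy : x y / x <= y.
  move=> h; have [xy|/ltW yx] := leP x y; first exact: h.
  by rewrite distrC [leRHS]distrC; exact: h.
rewrite (distrC x) (ger0_norm (_ : 0 <= y - x)) ?subr_ge0 //.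
rewrite ler_norml; case: (leP e x) => ?; case: (leP e y) => ?;
  case: (leP (- e) e) => ?; case: (leP (- e) x) => ?; case: (leP (- e) y) => ?;
  apply/andP; split; lra.
Qed.

End SoftThreshold.

Section RowNorm.
Variables (R : realType) (m : nat).
Implicit Types x : 'rV[R]_m.

Lemma row_norm_le x (e : R) : 0 <= e -> (forall b, `|x 0 b| <= e) -> `|x| <= e.
Proof.
move=> e0 xe; rewrite /Num.norm /= mx_normrE; apply: bigmax_le => // -[i j] _.
by rewrite ord1.
Qed.

Lemma row_coord_le x b : `|x 0 b| <= `|x|.
Proof.
by rewrite [leRHS]/Num.norm /= mx_normrE; exact: (le_bigmax _ (fun i => `|x i.1 i.2|) (0, b)).
Qed.

Lemma row_norm_attained x : x != 0 -> exists b, `|x 0 b| = `|x|.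
Proof.
move=> x0; have [|[i b]] := mx_norm_neq0 (x := x).
  by rewrite -[mx_norm x]/(`|x|) normr_eq0.
by rewrite ord1 => e; exists b; rewrite -e.
Qed.

End RowNorm.

Section Approximation.
Variables (R : realType) (r m : nat).
Local Notation X := {ptws 'I_r -> R}.

(** Half of the error pays for the approximation of [f - x0], half for the thresholding that makes
    [g] equal to [x0] exactly wherever [f] is. Without this exactness the homotopy from [f] to [g]
    would not be relative to the boundary. *)
Lemma row_lipschitz_approx (f : X -> 'rV[R]_m) (x0 : 'rV[R]_m) (e : R) :
  continuous f -> 0 < e ->
  exists (g : X -> 'rV[R]_m) (L : R), [/\ 0 < L,
    forall s s' b, `|g s 0 b - g s' 0 b| <= L * dist1 s s',
    forall s, unit_cube s -> `|g s - f s| <= e &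
    forall s, unit_cube s -> f s = x0 -> g s = x0].
Proof.
move=> cf e0; pose e2 := e / 2; have e20 : 0 < e2 by rewrite divr_gt0.
have cfb b : continuous (fun s => f s 0 b - x0 0 b).
  apply: (@continuous_subf R X (fun s => f s 0 b) (cst (x0 0 b))).
    exact: continuous_coordf.
  exact: continuous_cstf.
have /choice[G /choice[L GL]] b := lipschitz_approx (cfb b) e20.
exists (fun s => \row_b (x0 0 b + soft e2 (G b s))), (1 + \sum_b L b).
have L0 b : 0 <= L b by have [/ltW] := GL b.
split.
- by rewrite ltr_wpDr // sumr_ge0.
- move=> s s' b; rewrite !mxE opprD addrACA subrr add0r.
  apply: le_trans (soft_lipschitz _ _ (ltW e20)) _.
  have [_ GLb _] := GL b; apply: le_trans (GLb _ _) _.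
  rewrite ler_wpM2r ?dist1_ge0 // (bigD1 b) //= addrCA lerDl.
  by rewrite addr_ge0 // sumr_ge0.
- move=> s cs; apply: row_norm_le; first exact: ltW.
  move=> b; rewrite !mxE; have [_ _ /(_ s cs) Gf] := GL b.
  have := soft_dist (G b s) (ltW e20); move: Gf.
  rewrite !ler_norml => /andP[h1 h2] /andP[h3 h4]; rewrite /e2 in h1 h2 h3 h4 *.
  by apply/andP; split; lra.
- move=> s cs fs; apply/rowP => b; rewrite mxE soft_eq0 ?addr0 //.
  by have [_ _ /(_ s cs)] := GL b; rewrite fs subrr subr0.
Qed.

End Approximation.

Section Avoid.
Variables (R : realType) (r m : nat).
Local Notation X := {ptws 'I_r -> R}.

Lemma natr_dist_lt1 (a b : nat) : `|a%:R - b%:R| < 1 :> R -> a = b.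
Proof.
wlog ab : a b / (a <= b)%N.
  by move=> h; have [/h//|/ltnW/h] := leqP a b; rewrite distrC => h' /h' ->.
rewrite distrC ger0_norm ?subr_ge0 ?ler_nat // => ba; apply/eqP.
rewrite eqn_leq ab /= -ltnS -(ltr_nat R) -natr1; lra.
Qed.

Lemma unit_interval_cell (n : nat) (x : R) : (0 < n)%N -> 0 <= x <= 1 ->
  exists j : 'I_n, (j : nat)%:R <= n%:R * x <= (j : nat)%:R + 1.
Proof.
case: n => // n _ /andP[x0 x1].
have Nx : 0 <= n.+1%:R * x by rewrite mulr_ge0.
have [tN|tN] := ltnP (Num.truncn (n.+1%:R * x)) n.+1.
  by exists (Ordinal tN) => /=; have /andP[-> /ltW] := truncn_itv Nx; rewrite natr1.
exists ord_max => /=; rewrite natr1 ler_piMr // andbT.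
have /andP[h _] := truncn_itv Nx; apply: le_trans h.
by rewrite ler_nat (leq_trans _ tN).
Qed.

(* Pigeonhole: a fine grid around [p] has [M ^ m] points, more than the [(M K) ^ r]
   cells of side [1 / (M K)] of the unit cube, while by the Lipschitz bound two grid
   points whose opposite rays are hit from the same cell coincide. *)
Lemma lipschitz_avoids_ray (g : X -> 'rV[R]_m.+1) (L mu e : R)
    (p : 'rV[R]_m.+1) :
  (r < m)%N -> 0 < L -> 0 < mu -> 0 < e -> p != 0 ->
  (forall s s' b, `|g s 0 b - g s' 0 b| <= L * dist1 s s') ->
  (forall s, unit_cube s -> mu <= `|g s|) ->
  exists q, `|q - p| <= e /\
    forall s c, unit_cube s -> 0 <= c -> g s <> - (c *: q).
Proof.
move=> rm L0 mu0 e0 p0 gL gmu.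
have [a pa] := row_norm_attained p0.
have np0 : 0 < `|p| by rewrite normr_gt0.
pose eta := Num.min e `|p|; have eta0 : 0 < eta by rewrite lt_min e0.
(* A lower bound for every [c] with [g s = - (c *: q)]: the left side has norm at least [mu], and
   the vectors [q] of the grid have norm at most twice that of [p]. *)
pose c0 := mu / (2 * `|p|); have c00 : 0 < c0 by rewrite divr_gt0 // mulr_gt0.
(* [K] depends only on the Lipschitz data and makes $3Lr/(MK) < c_0\eta/M$ for every [M]. So [M] can
   be chosen afterwards, large enough that $M^{r+1} > (MK)^r$. *)
pose K := (Num.truncn (3 * (L * r%:R) / (c0 * eta))).+1.
have KP : 3 * (L * r%:R) < K%:R * (c0 * eta).
  suff : 3 * (L * r%:R) / (c0 * eta) < K%:R.
    have ce : 0 < c0 * eta by exact: mulr_gt0.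
    by rewrite ltr_pdivrMr.
  exact: truncnS_gt.
pose M := (K ^ r).+1.
pose N := (M * K)%N.
have M0 : 0 < M%:R :> R by rewrite ltr0n.
have N0 : 0 < N%:R :> R by rewrite ltr0n muln_gt0.
(* The coordinate [a], in which [p] attains its norm, is the same for all grid points. Comparing it
   in two multiples of grid points bounds the difference of the two scalars. *)
pose q (k : {ffun 'I_m -> 'I_M}) : 'rV[R]_m.+1 :=
  \row_b (p 0 b + oapp (fun j => eta * ((k j : nat)%:R / M%:R)) 0 (unlift a b)).
have qa k : q k 0 a = p 0 a by rewrite mxE unlift_none addr0.
have frac (i : 'I_M) : 0 <= ((i : nat)%:R / M%:R : R) <= 1.
  by rewrite divr_ge0 ?ler0n //= ler_pdivrMr // mul1r ler_nat ltnW.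
have qp k : `|q k - p| <= eta.
  apply: row_norm_le; first exact: ltW.
  move=> b; rewrite !mxE addrAC subrr add0r; case: unliftP => [j _|_] /=.
    have /andP[h1 h2] := frac (k j).
    by rewrite ger0_norm ?mulr_ge0 ?(ltW eta0) // ler_piMr // ltW.
  by rewrite normr0 ltW.
have qn k : `|q k| <= 2 * `|p|.
  rewrite -[q k](subrK p) (le_trans (ler_normD _ _)) //.
  have := qp k; have : eta <= `|p| by rewrite ge_min lexx orbT.
  by lra.
have [//|hit] := pselect (exists q, `|q - p| <= e /\
    forall s c, unit_cube s -> 0 <= c -> g s <> - (c *: q)).
have /choice[S] (k : {ffun 'I_m -> 'I_M}) : exists sc : X * R,
    [/\ unit_cube sc.1, 0 <= sc.2 & g sc.1 = - (sc.2 *: q k)].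
  apply: contrapT => nk; apply: hit; exists (q k); split.
    by apply: le_trans (qp k) _; rewrite ge_min lexx.
  by move=> s c cs c0' gs; apply: nk; exists (s, c).
move=> SP.
have N_gt0 : (0 < N)%N by rewrite muln_gt0.
have /choice[cell cellE] (k : {ffun 'I_m -> 'I_M}) : exists F : {ffun 'I_r -> 'I_N},
    forall i, (F i : nat)%:R <= N%:R * (S k).1 i <= (F i : nat)%:R + 1.
  have [cs _ _] := SP k.
  have /choice[F FP] i := unit_interval_cell N_gt0 (cs i).
  by exists [ffun i => F i] => i; rewrite ffunE.
have cell_inj : injective cell.
  move=> k k' kk'.
  have d1 : dist1 (S k).1 (S k').1 <= r%:R / N%:R.
    rewrite /dist1 (le_trans (ler_sum _ (G := fun=> N%:R^-1) _)) //; last first.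
      by rewrite sumr_const card_ord -[leLHS]mulr_natl.
    move=> i _; have := cellE k i; have := cellE k' i; rewrite kk'.
    move=> /andP[h1 h2] /andP[h3 h4].
    rewrite -(ler_pM2l N0) mulfV ?gt_eqF // -[X in X * _]ger0_norm ?ler0n // -normrM.
    by rewrite mulrBr ler_norml; apply/andP; split; lra.
  have [cs sc0 gs] := SP k; have [cs' sc0' gs'] := SP k'.
  set c := (S k).2 in sc0 gs; set c' := (S k').2 in sc0' gs'.
  pose d := L * (r%:R / N%:R).
  have gd b : `|c' * q k' 0 b - c * q k 0 b| <= d.
    have := gL (S k).1 (S k').1 b; rewrite gs gs' !mxE opprK addrC => h.
    by apply: le_trans h _; rewrite ler_wpM2l // ltW.
  have cc : `|c' - c| * `|p| <= d.
    by rewrite -pa -normrM mulrBl -{1}(qa k') -{1}(qa k).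
  have c0c : c0 <= c.
    have := gmu _ cs; rewrite gs normrN normrZ (ger0_norm sc0) => h.
    rewrite ler_pdivrMr ?mulr_gt0 //; apply: le_trans h _.
    by rewrite ler_wpM2l.
  apply/ffunP => j; apply/val_inj/eqP => /=.
  (* The factor 3 is one [d] for the difference of the two values of [g] and two for replacing [c']
     by [c], since [q k'] has norm at most twice that of [p]. *)
  have key : c * (eta * (`|(k' j : nat)%:R - (k j : nat)%:R| / M%:R)) <= 3 * d.
    have -> : c * (eta * (`|(k' j : nat)%:R - (k j : nat)%:R| / M%:R))
       = `|c * (q k' 0 (lift a j) - q k 0 (lift a j))|.
      rewrite !mxE liftK /= opprD addrACA subrr add0r -mulrBr -mulrBl !normrM.
      by rewrite (ger0_norm sc0) (gtr0_norm eta0) normfV (gtr0_norm M0).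
    have -> : c * (q k' 0 (lift a j) - q k 0 (lift a j)) =
      (c' * q k' 0 (lift a j) - c * q k 0 (lift a j)) - (c' - c) * q k' 0 (lift a j).
      by ring.
    apply: le_trans (ler_normB _ _) _.
    have := gd (lift a j).
    have : `|(c' - c) * q k' 0 (lift a j)| <= 2 * d.
      rewrite normrM (le_trans (ler_wpM2l (normr_ge0 _) (row_coord_le _ _))) //.
      rewrite (le_trans (ler_wpM2l (normr_ge0 _) (qn _))) // mulrCA.
      by rewrite ler_wpM2l.
    by lra.
  have kd : `|(k' j : nat)%:R - (k j : nat)%:R| < 1 :> R.
    have h : c0 * (eta * (`|(k' j : nat)%:R - (k j : nat)%:R| / M%:R)) <= 3 * d.
      apply: le_trans key; rewrite ler_wpM2r // mulr_ge0 ?(ltW eta0) //.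
    have NE : N%:R = M%:R * K%:R :> R by rewrite natrM.
    have K0 : 0 < K%:R :> R by rewrite ltr0n.
    set D : R := `| _ | in h *.
    have ce : 0 < K%:R * (c0 * eta) := mulr_gt0 K0 (mulr_gt0 c00 eta0).
    rewrite -(ltr_pM2l ce) mulr1; apply: le_lt_trans KP.
    have -> : K%:R * (c0 * eta) * D = N%:R * (c0 * (eta * (D / M%:R))).
      by rewrite NE; field; rewrite gt_eqF.
    have -> : 3 * (L * r%:R) = N%:R * (3 * d).
      by rewrite /d; field; rewrite gt_eqF.
    by rewrite ler_pM2l.
  by rewrite (natr_dist_lt1 kd).
have := leq_card _ cell_inj; rewrite !card_ffun !card_ord.
rewrite leqNgt => /negP[]; rewrite expnMn.
apply: (@leq_trans (M ^ r.+1)); last by rewrite leq_pexp2l.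
by rewrite expnSr ltn_pmul2l ?expn_gt0 // ltnSn.
Qed.

End Avoid.

Section Punctured.
Variables (R : realType) (r m : nat).
Local Notation X := {ptws 'I_r -> R}.
Local Notation V := 'rV[R]_m.+1.
Hypothesis rm : (r < m)%N.

Lemma near_neq0 (x y : V) (e : R) : e <= `|x| -> `|y - x| < e -> y != 0.
Proof.
by move=> ex yx; apply: contraTneq yx => ->; rewrite sub0r normrN -leNgt.
Qed.

Lemma convex_near (x y z : V) (e u : R) : 0 <= u <= 1 ->
  `|y - x| < e -> `|z - x| < e -> `|y + u *: (z - y) - x| < e.
Proof.
move=> /andP[u0 u1] yx zx.
have -> : y + u *: (z - y) - x = (1 - u) *: (y - x) + u *: (z - x).
  by apply/rowP => b; rewrite !mxE; ring.
have [->|un0] := eqVneq u 0; first by rewrite subr0 scale1r scale0r addr0.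
apply: le_lt_trans (ler_normD _ _) _; rewrite !normrZ.
rewrite (ger0_norm u0) ger0_norm ?subr_ge0 //.
have h1 : (1 - u) * `|y - x| <= (1 - u) * e by rewrite ler_wpM2l ?subr_ge0 // ltW.
have h2 : u * `|z - x| < u * e by rewrite ltr_pM2l // lt_neqAle eq_sym un0.
by lra.
Qed.

(* A loop is first made Lipschitz, then pushed in the direction [q] that it
   misses, chosen so close to [-x0] that the push can be damped near [x0]. *)
Lemma punctured_pi_trivial : pi_trivial R r [set x : V | x != 0].
Proof.
move=> x0 f x0n cf fn fb.
pose f' := f \o @clamp R r.
have cf' : continuous f'.
  apply/continuous_subspace_setT.
  apply: within_comp (continuous_subspaceT (@clamp_continuous R r)) cf _.
  by move=> s _; exact: clamp_cube.
have f'E s : unit_cube s -> f' s = f s by move=> cs; rewrite /f' /= clamp_id.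
have f'n s : f' s != 0 by apply: fn; exact: clamp_cube.
have cn : continuous (fun s => `|f' s|).
  by move=> s; apply: (continuous_comp (cf' s)); exact: norm_continuous.
have [c _ cmin] := compact_EVT_min (@cube_neq0 R r) (@cube_compact R r) (continuous_subspaceT cn).
pose mu := Num.min `|x0| `|f' c|.
have mu0 : 0 < mu by rewrite lt_min !normr_gt0 x0n f'n.
have mux : mu <= `|x0| by rewrite ge_min lexx.
have muf s : unit_cube s -> mu <= `|f' s|.
  by move=> cs; rewrite ge_min cmin ?orbT // inE.
pose e := mu / 8; have e0 : 0 < e by rewrite divr_gt0.
have [g [L [L0 gL gf gx0]]] := row_lipschitz_approx x0 cf' e0.
have mug s : unit_cube s -> mu / 2 <= `|g s|.
  move=> cs; have := muf s cs; have := gf s cs; rewrite /e => h1 h2.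
  have := ler_normD (f' s - g s) (g s); rewrite subrK distrC; lra.
have [q [qx0 qav]] := lipschitz_avoids_ray rm L0 (divr_gt0 mu0 (ltr0n _ 2)) e0 x0n gL mug.
(* [k] sends [x0] to itself and every [y] at distance at least [mu / 2] from [x0] to [q]. Close to
   [x0] the segment from [y] to [k y] stays in a ball around [x0] that misses 0; farther away it
   ends at [q] and misses 0 because [g] avoids the ray opposite to [q]. *)
pose w (y : V) := clamp01 (2 / mu * `|y - x0|).
pose k (y : V) := x0 + w y *: (q - x0).
(* Three straight-line homotopies, from [f'] to [g], to [k \o g] and to the constant [x0], one for
   each third of the interval. The telescoping sum with clamped ramps makes continuity immediate,
   with no pasting. *)
pose h (su : X * R) : V :=
  f' su.1 + clamp01 (3 * su.2) *: (g su.1 - f' su.1)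
  + clamp01 (3 * su.2 - 1) *: (k (g su.1) - g su.1)
  + clamp01 (3 * su.2 - 2) *: (x0 - k (g su.1)).
have w01 y : 0 <= w y <= 1 by exact: clamp01_bounds.
have kx0 y : `|k y - x0| <= e.
  have /andP[h1 h2] := w01 y.
  rewrite /k addrAC subrr add0r normrZ ger0_norm //.
  by rewrite (le_trans _ qx0) // ler_piMl.
have wx0 : w x0 = 0 by rewrite /w subrr normr0 mulr0 clamp01_id // lexx ler01.
have kx00 : k x0 = x0 by rewrite /k wx0 scale0r addr0.
have c0 (x : R) : x <= 0 -> clamp01 x = 0.
  by move=> x0'; rewrite /clamp01 (max_idPl x0') (min_idPr ler01).
have c1 (x : R) : 1 <= x -> clamp01 x = 1.
  by move=> x1; rewrite /clamp01 (max_idPr (le_trans ler01 x1)) (min_idPl x1).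
have cg : continuous g.
  apply: mx_continuous => i j; rewrite ord1.
  by apply: (@dist1_lipschitz_continuous R r _ L) => s s'; exact: gL.
have ck : continuous k.
  apply: mx_continuous => i j.
  rewrite (_ : (fun y => k y i j) = fun y => x0 i j + w y * (q i j - x0 i j)); last first.
    by apply/funext => y; rewrite !mxE.
  apply: (@continuous_addf R); first exact: continuous_cstf.
  apply: (@continuous_mulf R); last exact: continuous_cstf.
  have cw : continuous (fun y : V => 2 / mu * `|y - x0|).
    apply: (@continuous_mulf R); first exact: continuous_cstf.
    have csub : continuous (fun y : V => y - x0).
      apply: mx_continuous => i' j'.
      rewrite (_ : (fun y : V => (y - x0) i' j') = fun y => y i' j' - x0 i' j').
        apply: (@continuous_subf R); last exact: continuous_cstf.
        exact: coord_continuous.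
      by apply/funext => y; rewrite !mxE.
    by move=> y; exact: (continuous_comp (csub y) (@norm_continuous _ V _)).
  by move=> y; exact: (continuous_comp (cw y) (@clamp01_continuous R _)).
have cramp (a : R) : continuous (fun su : X * R => clamp01 (3 * su.2 - a)).
  have cl : continuous (fun su : X * R => 3 * su.2 - a).
    apply: (@continuous_subf R); last exact: continuous_cstf.
    by apply: (@continuous_mulf R) => [|[s' u']]; [exact: continuous_cstf | exact: cvg_snd].
  by move=> su; exact: (continuous_comp (cl su) (@clamp01_continuous R _)).
have cco (F : X -> V) i j : continuous F -> continuous (fun su : X * R => F su.1 i j).
  move=> cF [s u]; apply: (@continuous_comp _ X R fst (fun s => F s i j)).
    exact: cvg_fst.
  exact: continuous_coordf.
have ckg : continuous (k \o g) by move=> s; exact: (continuous_comp (cg s) (ck _)).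
exists h; split.
- apply: continuous_subspaceT; apply: mx_continuous => i j.
  rewrite (_ : (fun su => h su i j) = fun su : X * R => f' su.1 i j
    + clamp01 (3 * su.2 - 0) * (g su.1 i j - f' su.1 i j)
    + clamp01 (3 * su.2 - 1) * ((k \o g) su.1 i j - g su.1 i j)
    + clamp01 (3 * su.2 - 2) * (x0 i j - (k \o g) su.1 i j)); last first.
    by apply/funext => su; rewrite !mxE subr0.
  apply: (@continuous_addf R); [apply: (@continuous_addf R);
    [apply: (@continuous_addf R); first exact: cco|]|];
    apply: (@continuous_mulf R); try exact: cramp;
    apply: (@continuous_subf R); try exact: cco; exact: continuous_cstf.
- move=> s u cs /andP[u0 u1] /=; rewrite /h /=.
  have [u3|u3] := leP (3 * u) 1.
    rewrite (c0 (3 * u - 1)) ?(c0 (3 * u - 2)); [|lra|lra].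
    rewrite !scale0r !addr0; apply: (near_neq0 (muf s cs)).
    apply: convex_near; first exact: clamp01_bounds.
      by rewrite subrr normr0.
    by rewrite (le_lt_trans (gf s cs)) // /e; lra.
  rewrite (c1 (3 * u)); last lra.
  rewrite scale1r subrKC.
  have [u3'|u3'] := leP (3 * u) 2; last first.
    rewrite (c1 (3 * u - 1)); last lra.
    rewrite scale1r subrKC; apply: (near_neq0 mux).
    apply: convex_near; first exact: clamp01_bounds.
      by rewrite (le_lt_trans (kx0 _)) // /e; lra.
    by rewrite subrr normr0.
  rewrite (c0 (3 * u - 2)) ?scale0r ?addr0; last lra.
  set y := g s; set v := clamp01 _.
  have v01 : 0 <= v <= 1 by exact: clamp01_bounds.
  have [yx|yx] := ltP `|y - x0| (mu / 2).
    have yx' : `|y - x0| < mu by lra.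
    apply: (near_neq0 mux); apply: convex_near => //.
    by rewrite (le_lt_trans (kx0 _)) // /e; lra.
  have kq : k y = q.
    rewrite /k /w c1 ?scale1r ?subrKC //.
    by rewrite mulrC -ler_pdivrMr ?divr_gt0 // div1r invf_div.
  rewrite kq; apply/eqP => yq0.
  (* A zero on the segment means [(1 - v) *: y + v *: q = 0]. For [v = 1] this makes [q] zero, too
     far from [x0]; otherwise it puts [g s] on the ray opposite to [q]. *)
  have [v1|v1] := eqVneq v 1.
    move: yq0; rewrite v1 scale1r subrKC => q0.
    by move: qx0; rewrite q0 sub0r normrN /e; lra.
  have v1' : 0 < 1 - v by rewrite subr_gt0 lt_neqAle v1; case/andP: v01.
  apply: (qav s (v / (1 - v)) cs).
    by rewrite divr_ge0 ?(ltW v1') //; case/andP: v01.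
  apply: (scalerI (a := 1 - v)); first by rewrite gt_eqF.
  rewrite scalerN scalerA mulrCA mulfV ?mulr1 ?gt_eqF // -/y.
  by apply/rowP => b; move/rowP: yq0 => /(_ b); rewrite !mxE; lra.
- move=> s cs; rewrite /h /= mulr0 !c0; [|lra|lra|lra].
  by rewrite !scale0r !addr0 f'E.
- move=> s cs; rewrite /h /= mulr1 !c1; [|lra|lra|lra].
  by rewrite !scale1r !subrKC.
- move=> s u [cs bs] u01; rewrite /h /=.
  have fs : f' s = x0 by rewrite f'E // fb.
  by rewrite fs (gx0 s cs fs) kx00 subrr !scaler0 !addr0.
Qed.

End Punctured.

(** * Reflections and chambers *)

(** A vector space over an infinite field is not a finite union of proper subspaces. If [x] is
    generic for [s] but lies in [Y], take [y] in [X] outside [Y]: no [y + k x] lies in [Y], and a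
    member of [s] not containing [X] contains at most one of them, so one of [size s + 1] values of
    [k] survives. *)
Lemma generic_vector (F : numFieldType) (vT : vectType F) (X : {vspace vT})
    (s : seq {vspace vT}) :
  exists2 x, x \in X & forall Y, Y \in s -> x \in Y -> (X <= Y)%VS.
Proof.
elim: s => [|Y s [x xX xs]]; first by exists 0; rewrite ?mem0v.
have [XY|nXY] := boolP (X <= Y)%VS.
  by exists x => // Z; rewrite inE => /predU1P[-> //|]; exact: xs.
have [xY|xY] := boolP (x \in Y); last first.
  exists x => // Z; rewrite inE => /predU1P[-> xY'|]; last exact: xs.
  by rewrite xY' in xY.
have [y yX yY] : exists2 y, y \in X & y \notin Y.
  by move/subvPn: nXY => [y yX yY]; exists y.
apply: contrapT => nz.
have /choice[f fP] (k : 'I_(size s).+1) : exists i : 'I_(size s),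
    ~~ (X <= nth fullv s i)%VS /\ y + (k : nat)%:R *: x \in nth fullv s i.
  apply: contrapT => nk; apply: nz; exists (y + (k : nat)%:R *: x).
    by rewrite memvD // memvZ.
  move=> Z; rewrite inE => /predU1P[->|Zs].
    by rewrite rpredDr ?memvZ // (negbTE yY).
  move=> yZ; apply: contrapT => /negP XZ; apply: nk.
  have Zi : (index Z s < size s)%N by rewrite index_mem.
  by exists (Ordinal Zi); rewrite /= nth_index.
have /injectivePn[k [k' kk' fk]] : ~~ injectiveb f.
  by apply/injectiveP => /leq_card; rewrite !card_ord ltnn.
have [XZ yk] := fP k; have [_ yk'] := fP k'.
move/negP: XZ; apply; apply: xs; first by rewrite mem_nth.
rewrite -fk in yk'; have := memvB yk yk'.
rewrite opprD addrACA subrr add0r -scalerBl => h.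
have kn0 : (k : nat)%:R - (k' : nat)%:R != 0 :> F.
  by rewrite subr_eq0 eqr_nat.
by have := memvZ ((k : nat)%:R - (k' : nat)%:R)^-1 h; rewrite scalerA mulVf // scale1r.
Qed.

Lemma fixvP (F : fieldType) l (A : 'M[F]_l) x : reflect (A *m x = x) (x \in fixv A).
Proof. by apply: (iffP fixedSpaceP); rewrite lfunE. Qed.

(** * Invariant form, roots and coroots *)

Section InvariantForm.
Variables (R : realType) (l : nat) (gT : finGroupType) (W : {group gT}).
Variable rW : mx_representation R W l.
Local Notation V := 'cV[R]_l.
Implicit Types (x y v : V) (g h t : gT).

Definition act g x : V := rW g *m x.

Lemma actE g x : act g x = rW g *m x. Proof. by []. Qed.

Lemma act1 x : act 1%g x = x.
Proof. by rewrite /act repr_mx1 mul1mx. Qed.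

Lemma actM g h x : g \in W -> h \in W -> act (g * h)%g x = act g (act h x).
Proof. by move=> gW hW; rewrite /act repr_mxM // mulmxA. Qed.

Lemma actK g x : g \in W -> act g^-1%g (act g x) = x.
Proof. by move=> gW; rewrite -actM ?groupV // mulVg act1. Qed.

Lemma actKV g x : g \in W -> act g (act g^-1%g x) = x.
Proof. by move=> gW; rewrite -actM ?groupV // mulgV act1. Qed.

Lemma act_inj g : g \in W -> injective (act g).
Proof. by move=> gW x y xy; rewrite -(actK x gW) xy actK. Qed.

Lemma actD g x y : act g (x + y) = act g x + act g y.
Proof. exact: mulmxDr. Qed.
Lemma actB g x y : act g (x - y) = act g x - act g y.
Proof. exact: mulmxBr. Qed.
Lemma actZ g c x : act g (c *: x) = c *: act g x.
Proof. by rewrite /act -scalemxAr. Qed.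
Lemma act_sum (I : Type) (s : seq I) (P : pred I) g (F : I -> V) :
  act g (\sum_(i <- s | P i) F i) = \sum_(i <- s | P i) act g (F i).
Proof. exact: mulmx_sumr. Qed.

Let actDE g x y i : act g (x + y) i 0 = act g x i 0 + act g y i 0.
Proof. by rewrite actD; move: (act g x) (act g y) => a b; rewrite mxE. Qed.
Let actZE g c x i : act g (c *: x) i 0 = c * act g x i 0.
Proof. by rewrite actZ; move: (act g x) => a; rewrite mxE. Qed.

(** The standard inner product summed over the group, hence invariant under it. *)
Definition form x y : R := \sum_(g in W) \sum_i act g x i 0 * act g y i 0.

Lemma formC x y : form x y = form y x.
Proof. by apply: eq_bigr => g _; apply: eq_bigr => i _; rewrite mulrC. Qed.

Lemma formDr x y z : form x (y + z) = form x y + form x z.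
Proof.
rewrite /form -big_split; apply: eq_bigr => g _ /=.
by rewrite -big_split; apply: eq_bigr => i _; rewrite actDE mulrDr.
Qed.

Lemma formZr x c y : form x (c *: y) = c * form x y.
Proof.
rewrite /form mulr_sumr; apply: eq_bigr => g _; rewrite mulr_sumr.
by apply: eq_bigr => i _; rewrite actZE mulrCA.
Qed.

Lemma formDl x y z : form (x + y) z = form x z + form y z.
Proof. by rewrite formC formDr !(formC z). Qed.

Lemma formZl x c y : form (c *: x) y = c * form x y.
Proof. by rewrite formC formZr formC. Qed.

Lemma formNr x y : form x (- y) = - form x y.
Proof. by rewrite -scaleN1r formZr mulN1r. Qed.

Lemma formNl x y : form (- x) y = - form x y.
Proof. by rewrite formC formNr formC. Qed.

Lemma form_sumr (I : Type) (s : seq I) (P : pred I) x (F : I -> V) :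
  form x (\sum_(i <- s | P i) F i) = \sum_(i <- s | P i) form x (F i).
Proof.
apply: (big_morph (form x)); first exact: formDr.
by rewrite -(scale0r x) formZr mul0r.
Qed.

Lemma form_act h x y : h \in W -> form (act h x) (act h y) = form x y.
Proof.
move=> hW; rewrite /form [RHS](reindex_inj (mulIg h)) /=.
apply: eq_big => [g|g gW]; first by rewrite groupMr.
by apply: eq_bigr => i _; rewrite !actM.
Qed.

Lemma form_ge0 x : 0 <= form x x.
Proof. by apply: sumr_ge0 => g _; apply: sumr_ge0 => i _; rewrite -expr2 sqr_ge0. Qed.

Lemma form_eq0 x : form x x = 0 -> x = 0.
Proof.
move/eqP; rewrite psumr_eq0 => [/allP f0|g _]; last first.
  by apply: sumr_ge0 => i _; rewrite -expr2 sqr_ge0.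
have := f0 1%g (mem_index_enum _); rewrite group1 /= act1 psumr_eq0 => [/allP x0|i _].
  apply/colP => i; have := x0 i (mem_index_enum _).
  by rewrite mxE -expr2 expf_eq0 => /eqP.
by rewrite -expr2 sqr_ge0.
Qed.

Lemma form_gt0 x : x != 0 -> 0 < form x x.
Proof.
by move=> x0; rewrite lt_neqAle form_ge0 andbT eq_sym; apply: contra_neq x0 => /form_eq0.
Qed.

Definition reflects t v :=
  v != 0 /\ forall x, act t x = x - (2 * form v x / form v v) *: v.

(** For [y] not fixed by [t], invariance makes [v = y - act t y] orthogonal to the fixed hyperplane.
    Then [act t v] is orthogonal to it too, so it is a multiple of [v] of the same length; it is not
    [v] itself, which is not fixed, so it is [- v]. *)
Lemma reflection_reflects t : t \in reflections rW -> exists v, reflects t v.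
Proof.
rewrite inE => /andP[tW /eqP dimF]; set F := fixv (rW t) in dimF.
have [y yF] : exists y, y \notin F.
  apply: contrapT => nF; have : (fullv <= F)%VS.
    by apply/subvP => y _; apply: contrapT => /negP yF; apply: nF; exists y.
  by move/dimvS; rewrite dimvf /dim /= muln1 -[X in (X <= _)%N]dimF ltnn.
pose v := y - act t y.
have v0 : v != 0.
  rewrite subr_eq0; apply: contraNneq yF => yt; apply/fixvP; exact/esym.
have Ft x : x \in F -> act t x = x by move/fixvP.
have Fv x : x \in F -> form x v = 0.
  by move=> xF; rewrite formDr formNr -{2}(Ft x xF) form_act // subrr.
have vv := form_gt0 v0.
have vF : v \notin F by apply: contraL vv => /Fv ->; rewrite ltxx.
have Fvfull : (F + <[v]>)%VS = fullv.
  apply/eqP; rewrite eqEdim subvf dimvf /dim /= muln1 -[X in (X <= _)%N]dimF dimv_disjoint_sum.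
    by rewrite dim_vline v0 addn1.
  apply/eqP; rewrite -subv0; apply/subvP => x; rewrite memv_cap => /andP[xF /vlineP[k xk]].
  have [k0|k0] := eqVneq k 0; first by rewrite xk k0 scale0r mem0v.
  move: xF; rewrite xk => /(memvZ k^-1); rewrite scalerA mulVf // scale1r => vF'.
  by rewrite vF' in vF.
have dec x : exists2 f, f \in F & x = f + (form v x / form v v) *: v.
  have : x \in (F + <[v]>)%VS by rewrite Fvfull memvf.
  case/memv_addP => f fF [_ /vlineP[k ->] ->]; exists f => //.
  by rewrite formDr (formC v f) Fv // add0r formZr mulfK // gt_eqF.
have tv : act t v = - v.
  have [f fF tvE] := dec (act t v); set k := _ / _ in tvE.
  have f0 : f = 0.
    apply: form_eq0; have : form f (act t v) = 0 by rewrite -{1}(Ft f fF) form_act // Fv.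
    by rewrite tvE formDr formZr Fv // mulr0 addr0.
  rewrite f0 add0r in tvE.
  have : form (act t v) (act t v) = form v v by rewrite form_act.
  rewrite tvE formZl formZr mulrA -[RHS]mul1r => /(mulIf (lt0r_neq0 vv)) /eqP.
  rewrite -expr2 sqrf_eq1 => /orP[] /eqP k1; last by rewrite k1 scaleN1r.
  by move: vF => /negP[]; apply/fixvP; rewrite -[RHS]scale1r -k1 -tvE.
exists v; split=> // x; have [f fF ->] := dec x; set k := _ / _.
rewrite actD actZ tv Ft // formDr (formC v f) Fv // add0r formZr mulrA mulfK ?gt_eqF //.
by rewrite -addrA -scalerBl scalerN; congr (_ + _); rewrite -scaleNr; congr (_ *: _); ring.
Qed.

Lemma reflects_reflection t v : t \in W -> reflects t v -> t \in reflections rW.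
Proof.
move=> tW [v0 tv]; rewrite inE tW /=; set F := fixv (rW t).
have vv := form_gt0 v0.
have vF : v \notin F.
  apply/fixvP; rewrite -/(act t v) tv mulfK ?gt_eqF // => /eqP.
  by rewrite -subr_eq0 addrAC subrr sub0r oppr_eq0 scaler_eq0 pnatr_eq0 (negbTE v0).
have Fvfull : (F + <[v]>)%VS = fullv.
  apply/eqP; rewrite eqEsubv subvf; apply/subvP => x _.
  rewrite -(subrK ((form v x / form v v) *: v) x); apply: memv_add; last first.
    by apply: memvZ; apply: memv_line.
  apply/fixvP; rewrite -/(act t _) tv formDr formNr formZr mulfVK ?gt_eqF // subrr.
  by rewrite mulr0 mul0r scale0r subr0.
have : \dim (F + <[v]>)%VS = l by rewrite Fvfull dimvf /dim /= muln1.
rewrite dimv_disjoint_sum; first by rewrite dim_vline v0 addn1 => ->.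
apply/eqP; rewrite -subv0; apply/subvP => x; rewrite memv_cap => /andP[xF /vlineP[k xk]].
have [k0|k0] := eqVneq k 0; first by rewrite xk k0 scale0r mem0v.
move: xF; rewrite xk => /(memvZ k^-1); rewrite scalerA mulVf // scale1r => vF'.
by rewrite vF' in vF.
Qed.

(** An arbitrary normal vector of the hyperplane, normalized neither in length nor in sign. The
    default 0 is not reached when [t] is a reflection. *)
Definition rootv t : V := xget 0 [set v | reflects t v].

Lemma rootv_reflects t : t \in reflections rW -> reflects t (rootv t).
Proof. by move/reflection_reflects => h; exact: (@xgetPex _ 0 [set v | reflects t v]). Qed.

Definition pairing v x : R := 2 * form v x / form v v.
Definition coroot t x : R := pairing (rootv t) x.

Lemma corootE t x : coroot t x = 2 * form (rootv t) x / form (rootv t) (rootv t).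
Proof. by []. Qed.

Lemma pairingD v x y : pairing v (x + y) = pairing v x + pairing v y.
Proof. by rewrite /pairing formDr mulrDr mulrDl. Qed.
Lemma pairingZ v c x : pairing v (c *: x) = c * pairing v x.
Proof. by rewrite /pairing formZr; ring. Qed.
Lemma pairing_sum (I : Type) (s : seq I) (P : pred I) v (F : I -> V) :
  pairing v (\sum_(i <- s | P i) F i) = \sum_(i <- s | P i) pairing v (F i).
Proof. by rewrite /pairing form_sumr mulr_sumr mulr_suml. Qed.

Lemma pairing_continuous v : continuous (pairing v).
Proof.
apply: (@continuous_mulf R); last exact: continuous_cstf.
apply: (@continuous_mulf R); first exact: continuous_cstf.
apply: (@continuous_sumf R _ _ _ _ (fun g x => \sum_i act g v i 0 * act g x i 0)) => g _.
apply: (@continuous_sumf R _ _ _ _ (fun i x => act g v i 0 * act g x i 0)) => i _.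
apply: (@continuous_mulf R); first exact: continuous_cstf.
rewrite (_ : (fun x => act g x i 0) = fun x => \sum_j rW g i j * x j 0); last first.
  by apply/funext => x; rewrite mxE.
apply: (@continuous_sumf R _ _ _ _ (fun j (x : V) => rW g i j * x j 0)) => j _.
apply: (@continuous_mulf R); first exact: continuous_cstf.
exact: coord_continuous.
Qed.

Section Reflection.
Variable t : gT.
Hypothesis tR : t \in reflections rW.

Lemma reflection_in : t \in W.
Proof. by move: tR; rewrite inE => /andP[]. Qed.

Lemma act_reflection x : act t x = x - coroot t x *: rootv t.
Proof. by have [_ ->] := rootv_reflects tR. Qed.

Lemma rootv_neq0 : rootv t != 0.
Proof. by have [] := rootv_reflects tR. Qed.

Lemma coroot_root : coroot t (rootv t) = 2.
Proof. by rewrite /coroot /pairing mulfK // gt_eqF // form_gt0 // rootv_neq0. Qed.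

Lemma coroot_eq0 x : (coroot t x == 0) = (x \in fixv (rW t)).
Proof.
apply/eqP/fixvP; rewrite -/(act t x) act_reflection; first by move=> ->; rewrite scale0r subr0.
move/eqP; rewrite -subr_eq0 addrAC subrr sub0r oppr_eq0 scaler_eq0.
by rewrite (negbTE rootv_neq0) orbF => /eqP.
Qed.

Lemma reflectionK x : act t (act t x) = x.
Proof.
rewrite !act_reflection /coroot pairingD -scaleN1r !pairingZ -!/(coroot t _) coroot_root.
by apply/colP => i; rewrite !mxE; ring.
Qed.

Lemma reflects_coroot v : reflects t v ->
  exists2 k, k != 0 & forall x, coroot t x = k * pairing v x.
Proof.
move=> [v0 tv]; have vv := form_gt0 v0.
have e : v - coroot t v *: rootv t = v - 2 *: v.
  by rewrite -act_reflection tv mulfK // gt_eqF.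
have {}e : coroot t v *: rootv t = 2 *: v by apply: oppr_inj; apply: (addrI v).
have k0 : coroot t v != 0.
  apply: contra_neq v0 => k0; move: e; rewrite k0 scale0r => /esym/eqP.
  by rewrite scaler_eq0 pnatr_eq0 => /eqP.
have rv : rootv t = (2 / coroot t v) *: v by rewrite mulrC -scalerA -e scalerA mulVf // scale1r.
exists (coroot t v / 2); first by rewrite mulf_neq0 // invr_neq0 // pnatr_eq0.
move=> x; rewrite {1}/coroot rv /pairing !formZl !formZr.
by field; rewrite k0 gt_eqF.
Qed.

End Reflection.

Lemma reflects_conj t g : t \in reflections rW -> g \in W ->
  reflects (t ^ g)%g (act g^-1%g (rootv t)).
Proof.
move=> tR gW; have tW := reflection_in tR; split.
  apply: contraNneq (rootv_neq0 tR) => e.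
  by rewrite -(actKV (rootv t) gW) e /act mulmx0.
move=> x; rewrite conjgE actM ?groupM ?groupV // actM // (act_reflection tR).
rewrite actB actZ actK //.
congr (_ - _ *: _); rewrite /coroot /pairing.
have -> : form (act g^-1%g (rootv t)) x = form (rootv t) (act g x).
  by rewrite -{1}(actK x gW) form_act ?groupV.
by rewrite form_act ?groupV.
Qed.

Lemma reflectionJ t g : t \in reflections rW -> g \in W -> (t ^ g)%g \in reflections rW.
Proof.
move=> tR gW; apply: reflects_reflection (reflects_conj tR gW).
by rewrite groupJ // reflection_in.
Qed.

(** The roots of [t] and of its conjugate are chosen independently, so the two functionals agree
    only up to a nonzero factor of unknown sign. *)
Lemma coroot_conj t g : t \in reflections rW -> g \in W ->
  exists2 k, k != 0 & forall x, coroot (t ^ g)%g x = k * coroot t (act g x).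
Proof.
move=> tR gW; have [k k0 kE] := reflects_coroot (reflectionJ tR gW) (reflects_conj tR gW).
exists k => // x; rewrite kE; congr (_ * _); rewrite /coroot /pairing.
by rewrite -{1}(actK x gW) !form_act ?groupV.
Qed.

(** The component [u] of the second root orthogonal to the first lies on the hyperplane of [t],
    hence on that of [t']. It is then orthogonal to both roots and so to itself; the roots are
    therefore proportional. *)
Lemma reflection_inj t t' : mx_faithful rW ->
  t \in reflections rW -> t' \in reflections rW ->
  (forall x, coroot t x = 0 -> coroot t' x = 0) -> t = t'.
Proof.
move=> fW tR tR' h; have vv := form_gt0 (rootv_neq0 tR).
pose c := form (rootv t) (rootv t') / form (rootv t) (rootv t).
pose u := rootv t' - c *: rootv t.
have ut : form (rootv t) u = 0 by rewrite formDr formNr formZr mulfVK ?subrr // gt_eqF.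
have ut' : form (rootv t') u = 0.
  have /h : coroot t u = 0 by rewrite /coroot /pairing ut mulr0 mul0r.
  rewrite /coroot /pairing => /eqP; rewrite !mulf_eq0 pnatr_eq0 invr_eq0 /=.
  by rewrite (gt_eqF (form_gt0 (rootv_neq0 tR'))) orbF => /eqP.
have u0 : u = 0 by apply: form_eq0; rewrite formDl formNl formZl ut ut' mulr0 subr0.
have rE : rootv t' = c *: rootv t by apply/eqP; rewrite -subr_eq0 -/u u0.
have c0 : c != 0 by apply: contraNneq (rootv_neq0 tR') => c0; rewrite rE c0 scale0r.
have e x : act t x = act t' x.
  rewrite !act_reflection // rE; congr (_ - _); rewrite scalerA; congr (_ *: _).
  by rewrite /coroot /pairing rE !formZl formZr; field; rewrite c0 gt_eqF.
apply: (mx_faithful_inj fW); rewrite ?reflection_in //.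
apply/matrixP => i j; have /colP/(_ i) := e (delta_mx j 0).
by rewrite /act -!colE !mxE.
Qed.

End InvariantForm.

(** * Chambers described by signs of coroots *)

Section Chambers.
Variables (R : realType) (l : nat) (gT : finGroupType) (W : {group gT}).
Variable rW : mx_representation R W l.
Local Notation V := 'cV[R]_l.
Local Notation coroot := (coroot rW).

Lemma corootD t x y : coroot t (x + y) = coroot t x + coroot t y.
Proof. exact: pairingD. Qed.
Lemma corootZ t c x : coroot t (c *: x) = c * coroot t x.
Proof. exact: pairingZ. Qed.
Lemma coroot_sum (I : Type) (s : seq I) (P : pred I) t (F : I -> V) :
  coroot t (\sum_(i <- s | P i) F i) = \sum_(i <- s | P i) coroot t (F i).
Proof. exact: pairing_sum. Qed.
Lemma coroot_continuous t : continuous (coroot t).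
Proof. exact: pairing_continuous. Qed.

(** Sides are compared through a product of two values, because roots carry no preferred sign. *)
Definition chamber_of (x : V) : set V :=
  [set y | forall t, t \in reflections rW -> 0 <= coroot t x * coroot t y].

Lemma complementP x : arrangement_complement rW x <->
  forall t, t \in reflections rW -> coroot t x != 0.
Proof.
split=> h t tR; first by rewrite coroot_eq0 //; exact: h.
by rewrite -coroot_eq0 //; exact: h.
Qed.

Let open_cell (x : V) : set V :=
  [set y | forall t, t \in reflections rW -> 0 < coroot t x * coroot t y].

Lemma segment_continuous (x y : V) : continuous (fun u : R => x + u *: (y - x)).
Proof.
apply: mx_continuous => i j.
rewrite (_ : (fun u => _) = fun u : R => x i j + u * (y i j - x i j)); last first.
  by apply/funext => u; rewrite !mxE.
apply: (@continuous_addf R); first exact: continuous_cstf.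
by apply: (@continuous_mulf R) => [u|]; [exact: cvg_id | exact: continuous_cstf].
Qed.

Lemma open_cell_connected x : open_cell x x -> connected (open_cell x).
Proof.
move=> xx; pose seg y := (fun u : R => x + u *: (y - x)) @` `[0, 1].
rewrite (_ : open_cell x = \bigcup_(y in open_cell x) seg y).
  apply: bigcup_connected.
    by exists x => y _; exists 0; rewrite ?scale0r ?addr0 // /= in_itv /= lexx ler01.
  move=> y _; apply: connected_continuous_connected.
    exact: segment_connected.
  exact: (continuous_subspaceT (@segment_continuous x y)).
apply/seteqP; split => [y xy|_ [y xy [u u01 <-]] t tR].
  by exists y => //; exists 1; rewrite ?scale1r ?subrKC // /= in_itv /= lexx ler01.
move: u01; rewrite /= in_itv /= => /andP[u0 u1].
have -> : x + u *: (y - x) = (1 - u) *: x + u *: y.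
  by apply/colP => i; rewrite !mxE; ring.
have -> : coroot t x * coroot t ((1 - u) *: x + u *: y) =
    (1 - u) * (coroot t x * coroot t x) + u * (coroot t x * coroot t y) by rewrite corootD !corootZ; ring.
have [->|un] := eqVneq u 1; first by rewrite subrr mul0r add0r mul1r xy.
have u1' : 0 < 1 - u by rewrite subr_gt0 lt_neqAle un.
apply: ltr_wpDr; last exact: mulr_gt0 u1' (xx t tR).
by apply: mulr_ge0 => //; exact: ltW (xy t tR).
Qed.

(** The component is the open cell of [x]: that cell is star-shaped around [x], and a connected set
    on which some coroot changes sign would meet its hyperplane. Every point of the closed cell is a
    limit of points of the open one along the segment towards [x]. *)
Lemma component_closureE x : arrangement_complement rW x ->
  closure (connected_component (arrangement_complement rW) x) = chamber_of x.
Proof.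
move=> xc; have al0 := (complementP x).1 xc.
have xx : open_cell x x by move=> t /al0 a0; rewrite -expr2 exprn_even_gt0.
have comp : connected_component (arrangement_complement rW) x = open_cell x.
  apply/seteqP; split; last first.
    apply: connected_component_max => //; last exact: open_cell_connected.
    by move=> y xy; apply/complementP => t /xy; apply: contraTneq => ->; rewrite mulr0 ltxx.
  move=> y [A [Ax Ac Acon] Ay] t tR; rewrite ltNge; apply/negP => neg.
  pose f z := coroot t x * coroot t z.
  have cf : continuous f.
    apply: (@continuous_mulf R); first exact: continuous_cstf.
    exact: coroot_continuous.
  have /connected_intervalP iv : connected (f @` A).
    by apply: connected_continuous_connected => //; exact: continuous_subspaceT.
  have [z Az fz0] : (f @` A) 0.
    apply: (iv (f y) (f x)); [by exists y|by exists x|].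
    by rewrite neg ltW // xx.
  have := al0 _ tR; have := (complementP z).1 (Ac _ Az) _ tR.
  by move/eqP: fz0; rewrite mulf_eq0 => /orP[] /eqP ->; rewrite eqxx.
rewrite comp; apply/seteqP; split => [y yc t tR|y xy].
  pose D := (fun z => coroot t x * coroot t z) @^-1` [set u | 0 <= u].
  have cD : closed D.
    have cf : continuous (fun z => coroot t x * coroot t z).
      apply: (@continuous_mulf R); first exact: continuous_cstf.
      exact: coroot_continuous.
    exact: (continuous_closedP _).1 cf _ (@closed_ge _ 0).
  suff : D y by [].
  apply: cD; apply: closure_subset yc => z xz.
  by rewrite /D /= ltW // xz.
move=> B; rewrite -[y]addr0 -(scale0r (x - y)) => /(@segment_continuous y x).
rewrite !nbhs_simpl /= => /nbhs_ballP[e /= e0 eB].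
pose u := Num.min (e / 2) 1.
have u0 : 0 < u by rewrite lt_min ltr01 andbT; lra.
exists (y + u *: (x - y)); split; last first.
  apply: eB; rewrite /ball /= sub0r normrN gtr0_norm //.
  by rewrite gt_min; apply/orP; left; lra.
move=> t tR.
have -> : y + u *: (x - y) = (1 - u) *: y + u *: x.
  by apply/colP => i; rewrite !mxE; ring.
have -> : coroot t x * coroot t ((1 - u) *: y + u *: x) =
    (1 - u) * (coroot t x * coroot t y) + u * (coroot t x * coroot t x) by rewrite corootD !corootZ; ring.
rewrite ltr_wpDl //.
  by rewrite mulr_ge0 ?xy // subr_ge0 ge_min lexx orbT.
by rewrite mulr_gt0 // xx.
Qed.

Lemma weyl_chamberE C : weyl_chamber rW C <->
  exists2 x, arrangement_complement rW x & C = chamber_of x.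
Proof. by split=> -[x xc ->]; exists x => //; rewrite component_closureE. Qed.

End Chambers.

Local Open Scope complex_scope.

(** * Complexification *)

Lemma set_type_compact (T : topologicalType) (A : set T) :
  compact A -> compact [set: A].
Proof.
move=> cA F FF _.
have FA : (set_val @ F) A.
  by apply: (@filterS _ F _ setT) => [x _|]; [exact: set_valP | exact: filterT].
have [x [Ax clx]] := cA (set_val @ F) _ FA.
exists (exist _ x (mem_set Ax)); split=> // B U FB [V [[W oW <-] Wx VU]].
have [||y [[b Bb <-] Wb]] := clx (set_val @` B) W.
- exact: (filterS (@preimage_image _ _ set_val B) FB).
- exact: open_nbhs_nbhs.
by exists b; split => //; apply: VU.
Qed.

Section Complexification.
Variable R : realType.

Lemma real_complex_continuous : continuous (real_complex R : R -> R[i]).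
Proof.
move=> x; apply/(@cvgrPdist_lt _ R[i]^o) => e e0.
have /complex_realP[e' eE] : e \is Num.real by rewrite gtr0_real.
have e'0 : 0 < e' by rewrite -ltcR -eE.
have := (@cvgrPdist_lt R R^o R (nbhs x) (nbhs_filter x) id x).1 (@cvg_id _ _) e' e'0.
apply: filterS => y h.
by rewrite -rmorphB /= normc_def /= expr0n /= addr0 sqrtr_sqr eE ltcR.
Qed.

Lemma Re_continuous : continuous (@complex.Re R : R[i] -> R).
Proof.
move=> z; have FF : Filter (nbhs (z : R[i])) := nbhs_filter z.
apply/(@cvgrPdist_lt R R^o R[i] (nbhs z) FF) => e e0.
have e0' : 0 < e%:C :> R[i] by rewrite ltcR.
have := (@cvgrPdist_lt _ R[i]^o _ (nbhs (z : R[i]^o)) FF id z).1 (@cvg_id _ _) _ e0'.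
apply: filterS => w; rewrite normc_def ltcR; apply: le_lt_trans.
have -> : complex.Re (z - w) = complex.Re z - complex.Re w.
  by move: (z : R[i]) (w : R[i]) => [a b] [c d].
by rewrite -sqrtr_sqr ler_wsqrtr // lerDl sqr_ge0.
Qed.

Variable l : nat.
Local Notation V := 'cV[R]_l.
Local Notation VC := 'cV[R[i]]_l.

Definition realpart (z : VC) : V := map_mx (@complex.Re R) z.

Lemma complexifyK : cancel (@complexify R l) realpart.
Proof. by move=> x; apply/matrixP => i j; rewrite !mxE. Qed.

Lemma complexify_continuous : continuous (@complexify R l).
Proof.
apply: mx_continuous => i j.
rewrite (_ : (fun x => complexify x i j) = fun x : V => real_complex R (x i j)); last first.
  by apply/funext => x; rewrite mxE.
move=> x; apply: (@continuous_comp V R R[i] (fun x => x i j) (real_complex R)).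
  exact: coord_continuous.
exact: real_complex_continuous.
Qed.

Lemma realpart_continuous : continuous realpart.
Proof.
apply: mx_continuous => i j.
rewrite (_ : (fun x => realpart x i j) = fun x : VC => complex.Re (x i j)); last first.
  by apply/funext => x; rewrite mxE.
move=> z; apply: (@continuous_comp VC R[i] R (fun x => x i j) (@complex.Re R)).
  exact: (@coord_continuous R[i] l 1 i j z).
exact: Re_continuous.
Qed.

Lemma lift_continuous (f : V -> V) (z : VC) : {for realpart z, continuous f} ->
  {for z, continuous (fun z => complexify (f (realpart z)))}.
Proof.
move=> cf; have h := continuous_comp (@realpart_continuous z) cf.
exact: (continuous_comp h (@complexify_continuous _)).
Qed.

Lemma complexifyZ (c : R) (x : V) : complexify (c *: x) = c%:C *: complexify x.
Proof. exact: map_mxZ. Qed.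

Lemma complexify_sum (I : Type) (s : seq I) (P : pred I) (F : I -> V) :
  complexify (\sum_(i <- s | P i) F i) = \sum_(i <- s | P i) complexify (F i).
Proof. exact: (raddf_sum (map_mx (real_complex R))). Qed.

Definition impart (z : VC) : V := map_mx (@complex.Im R) z.

Lemma complex_parts (z : VC) :
  z = complexify (realpart z) + 'i%C *: complexify (impart z).
Proof. by apply/matrixP => i j; rewrite !mxE {1}[z i j]complexE. Qed.

Lemma realpart_impartZ (k : R[i]) (x : V) :
  realpart (k *: complexify x) = complex.Re k *: x /\
  impart (k *: complexify x) = complex.Im k *: x.
Proof.
case: k => a b; split; apply/matrixP => i j; rewrite !mxE /= mulr0.
  by rewrite subr0.
by rewrite add0r.
Qed.

Lemma realpart_sum (I : Type) (s : seq I) (P : pred I) (F : I -> VC) :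
  realpart (\sum_(i <- s | P i) F i) = \sum_(i <- s | P i) realpart (F i).
Proof.
apply: (big_morph realpart); last by apply/matrixP => i j; rewrite !mxE.
by move=> x y; apply/matrixP => i j; rewrite !mxE; case: (x i j); case: (y i j).
Qed.

Lemma impart_sum (I : Type) (s : seq I) (P : pred I) (F : I -> VC) :
  impart (\sum_(i <- s | P i) F i) = \sum_(i <- s | P i) impart (F i).
Proof.
apply: (big_morph impart); last by apply/matrixP => i j; rewrite !mxE.
by move=> x y; apply/matrixP => i j; rewrite !mxE; case: (x i j); case: (y i j).
Qed.

Lemma impart_complexify (x : V) : impart (complexify x) = 0.
Proof. by apply/matrixP => i j; rewrite !mxE. Qed.

(** A real basis of [U] becomes a complex basis of [X]; freeness and generation are both tested on
    real and imaginary parts. *)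
Lemma dim_complexified (U : {vspace V}) (X : {vspace VC}) :
  (forall z, z \in X <-> realpart z \in U /\ impart z \in U) -> \dim X = \dim U.
Proof.
move=> XU; pose n := \dim U; pose b : n.-tuple V := vbasis U.
pose B : n.-tuple VC := [tuple of map (@complexify R l) b].
have Bi (i : 'I_n) : B`_i = complexify b`_i by rewrite (nth_map 0) // size_tuple.
have fb : free b by exact: basis_free (vbasisP U).
have fB : free B.
  apply/freeP => k k0 i.
  have re : \sum_i complex.Re (k i) *: b`_i = 0.
    transitivity (realpart (\sum_i k i *: B`_i)); last first.
      by rewrite k0; apply/matrixP => ? ?; rewrite !mxE.
    by rewrite realpart_sum; apply: eq_bigr => j _; rewrite Bi (realpart_impartZ _ _).1.
  have im : \sum_i complex.Im (k i) *: b`_i = 0.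
    transitivity (impart (\sum_i k i *: B`_i)); last first.
      by rewrite k0; apply/matrixP => ? ?; rewrite !mxE.
    by rewrite impart_sum; apply: eq_bigr => j _; rewrite Bi (realpart_impartZ _ _).2.
  have /freeP f := fb; have := f _ re i; have := f _ im i.
  by case: (k i) => /= c d -> ->.
have UB x : x \in U -> complexify x \in <<B>>%VS.
  move=> xU; rewrite (coord_vbasis xU) complexify_sum memv_suml // => i _.
  by rewrite complexifyZ memvZ // -Bi memv_span // mem_nth // size_tuple.
suff -> : X = <<B>>%VS by move/eqP: fB; rewrite size_tuple.
apply/vspaceP => z; apply/idP/idP => [/XU[re im]|].
  by rewrite [z]complex_parts memvD ?memvZ // UB.
suff : (<<B>> <= X)%VS by move/subvP; apply.
apply/span_subvP => _ /mapP[x xb ->]; apply/XU.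
by rewrite complexifyK impart_complexify mem0v vbasis_mem.
Qed.

Lemma fixv_complexify (A : 'M[R]_l) (z : VC) :
  z \in fixv (map_mx (real_complex R) A) <-> realpart z \in fixv A /\ impart z \in fixv A.
Proof.
have e : map_mx (real_complex R) A *m z =
    complexify (A *m realpart z) + 'i%C *: complexify (A *m impart z).
  by rewrite {1}[z]complex_parts mulmxDr -scalemxAr /complexify !map_mxM.
have parts (x y : V) : realpart (complexify x + 'i%C *: complexify y) = x /\
    impart (complexify x + 'i%C *: complexify y) = y.
  split; apply/matrixP => i j; rewrite !mxE /=; simpc => //.
split=> [/fixvP|[/fixvP re /fixvP im]].
  by rewrite e => h; split; apply/fixvP; rewrite -{2}h ?(parts _ _).1 ?(parts _ _).2.
by apply/fixvP; rewrite e re im -complex_parts.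
Qed.

(** The norm that defines [sphere]. It need not be invariant under [W]; radial projection uses only
    its continuity, positivity and homogeneity. *)
Definition euclid (x : V) : R := Num.sqrt (\sum_i x i 0 ^+ 2).

Lemma euclid_gt0 (x : V) : x != 0 -> 0 < euclid x.
Proof.
move=> x0; rewrite sqrtr_gt0 lt_neqAle sumr_ge0 ?andbT => [|i _]; last exact: sqr_ge0.
rewrite eq_sym; apply: contra_neq x0 => /eqP.
rewrite psumr_eq0 => [/allP h|i _]; last exact: sqr_ge0.
apply/colP => i; have := h i (mem_index_enum _).
by rewrite mxE /= sqrf_eq0 => /eqP.
Qed.

Lemma euclidZ (c : R) (x : V) : 0 <= c -> euclid (c *: x) = c * euclid x.
Proof.
move=> c0; rewrite /euclid.
under eq_bigr do rewrite mxE exprMn.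
by rewrite -mulr_sumr sqrtrM ?sqr_ge0 // sqrtr_sqr ger0_norm.
Qed.

Lemma sphereP (x : V) : sphere x <-> euclid x = 1.
Proof.
rewrite /sphere /euclid /=; split=> [->|e]; first by rewrite sqrtr1.
rewrite -(sqr_sqrtr (a := \sum_i _)) ?e ?expr1n // sumr_ge0 // => i _.
exact: sqr_ge0.
Qed.

Lemma sphere_normalize (x : V) : x != 0 -> sphere ((euclid x)^-1 *: x).
Proof.
move=> x0; have e0 := euclid_gt0 x0.
by apply/sphereP; rewrite euclidZ ?invr_ge0 ?ltW // mulVf // gt_eqF.
Qed.

Lemma euclid_continuous : continuous euclid.
Proof.
have c : continuous (fun x : V => \sum_i x i 0 ^+ 2).
  apply: (@continuous_sumf R _ _ _ _ (fun i (x : V) => x i 0 ^+ 2)) => i _.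
  by apply: (@continuous_mulf R); exact: coord_continuous.
by move=> x; exact: (continuous_comp (c x) (@sqrt_continuous R _)).
Qed.

Lemma radial_complexify (x : V) : radial (complexify x) = complexify ((euclid x)^-1 *: x).
Proof.
rewrite /radial complexifyZ; congr (_ *: _).
have -> : \sum_i `|complexify x i 0| ^+ 2 = ((euclid x) ^+ 2)%:C.
  rewrite sqr_sqrtr; last by apply: sumr_ge0 => i _; exact: sqr_ge0.
  rewrite rmorph_sum; apply: eq_bigr => i _ /=.
  by rewrite mxE normc_def /= expr0n /= addr0 sqrtr_sqr -rmorphXn /= real_normK // num_real.
rewrite rmorphXn /= sqrCK; first by rewrite fmorphV.
by rewrite lecR sqrtr_ge0.
Qed.

End Complexification.

(** * The Coxeter group of a chamber *)

Section SimpleReflections.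
Variables (R : realType) (l : nat) (gT : finGroupType) (W : {group gT}).
Variable rW : mx_representation R W l.
Local Notation V := 'cV[R]_l.
Local Notation act := (act rW).
Local Notation coroot := (coroot rW).
Variables (C : set V) (r : 'I_l -> gT) (lam : 'I_l -> V).
Hypothesis faithfulW : mx_faithful rW.
Hypothesis genW : (<<reflections rW>>%g = W :> {set gT}).
Hypothesis chamberC : weyl_chamber rW C.
Hypothesis rR : forall i, r i \in reflections rW.
Hypothesis lamC : forall i, C (lam i).
Hypothesis lamH : forall i j, (lam i \in fixv (rW (r j))) = (j != i).
Implicit Types (x y z : V) (g h : gT) (i j : 'I_l) (I J K : {set 'I_l}).

(** The basis dual to the [lam i]. Dividing by the value at [lam i] cancels the arbitrary length and
    sign of the root, and makes the functional nonnegative on [C]. *)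
Definition coef i x : R := coroot (r i) x / coroot (r i) (lam i).

Lemma coroot_lam_neq0 i : coroot (r i) (lam i) != 0.
Proof. by rewrite coroot_eq0 // lamH eqxx. Qed.

Lemma coefD i x y : coef i (x + y) = coef i x + coef i y.
Proof. by rewrite /coef corootD mulrDl. Qed.
Lemma coefZ i c x : coef i (c *: x) = c * coef i x.
Proof. by rewrite /coef corootZ mulrA. Qed.
Lemma coefN i x : coef i (- x) = - coef i x.
Proof. by rewrite -scaleN1r coefZ mulN1r. Qed.
Lemma coef_sum (I : Type) (s : seq I) (P : pred I) i (F : I -> V) :
  coef i (\sum_(k <- s | P k) F k) = \sum_(k <- s | P k) coef i (F k).
Proof. by rewrite /coef coroot_sum mulr_suml. Qed.

Lemma coef_lam i j : coef i (lam j) = (i == j)%:R.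
Proof.
rewrite /coef; have [->|ij] := eqVneq i j; first by rewrite divff // coroot_lam_neq0.
by apply/eqP; rewrite mulf_eq0 coroot_eq0 // lamH ij.
Qed.

Lemma coef_continuous i : continuous (coef i).
Proof.
apply: (@continuous_mulf R); last exact: continuous_cstf.
exact: coroot_continuous.
Qed.

Lemma coef_eq0 i x : (coef i x == 0) = (act (r i) x == x).
Proof.
rewrite mulf_eq0 invr_eq0 (negbTE (coroot_lam_neq0 i)) orbF coroot_eq0 //.
exact/fixvP/eqP.
Qed.

(** By [coef_lam] the matrix of the functionals is a left inverse of the matrix with columns
    [lam i]. Both are square, so it is also a right inverse. *)
Lemma lam_expansion x : x = \sum_i coef i x *: lam i.
Proof.
pose L : 'M[R]_l := \matrix_(k, i) lam i k 0.
pose A : 'M[R]_l := \matrix_(i, k) coef i (delta_mx k 0).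
have dec y : y = \sum_k y k 0 *: delta_mx k 0.
  rewrite {1}[y]matrix_sum_delta; apply: eq_bigr => k _.
  by rewrite big_ord1.
have Ac y i : (A *m y) i 0 = coef i y.
  rewrite {2}[y]dec coef_sum mxE; apply: eq_bigr => k _.
  by rewrite coefZ mxE mulrC.
have AL : A *m L = 1%:M.
  apply/matrixP => i j; rewrite [RHS]mxE -coef_lam -Ac !mxE.
  by apply: eq_bigr => k _; rewrite !mxE.
rewrite -[LHS]mul1mx -(mulmx1C AL) -mulmxA; apply/colP => k.
rewrite mxE summxE; apply: eq_bigr => i _.
by rewrite Ac !mxE mulrC.
Qed.

Lemma coef_inj x y : (forall i, coef i x = coef i y) -> x = y.
Proof.
move=> xy; rewrite (lam_expansion x) (lam_expansion y).
by apply: eq_bigr => i _; rewrite xy.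
Qed.

Lemma chamber_side t : t \in reflections rW ->
  exists2 e, e != 0 & forall y, C y -> 0 <= e * coroot t y.
Proof.
move=> tR; have [x0 /complementP xc CE] := (weyl_chamberE _ _).1 chamberC.
by exists (coroot t x0) => [|y]; [exact: xc | rewrite CE => /(_ t tR)].
Qed.

(** Each wall has [C] on the same side as [lam i], which gives the inequalities. Conversely [C] is
    cut out by linear inequalities that all the [lam i] satisfy, so it contains their nonnegative
    combinations. *)
Lemma chamberP x : C x <-> forall i, 0 <= coef i x.
Proof.
split=> [Cx i|x0].
  have [e e0 eC] := chamber_side (rR i).
  have h1 := eC _ Cx; have h2 := eC _ (lamC i); have ln := coroot_lam_neq0 i.
  have h2' : 0 < e * coroot (r i) (lam i) by rewrite lt_neqAle h2 eq_sym mulf_neq0.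
  have -> : coef i x = (e * coroot (r i) x) / (e * coroot (r i) (lam i)).
    by rewrite /coef; field; rewrite e0 ln.
  by rewrite divr_ge0.
have [x1 xc CE] := (weyl_chamberE _ _).1 chamberC.
rewrite CE => t tR; rewrite [x]lam_expansion coroot_sum mulr_sumr sumr_ge0 // => i _.
by rewrite corootZ mulrCA mulr_ge0 // -/(coef i x) //; have := lamC i; rewrite CE; apply.
Qed.

(** A coroot has one sign on all the [lam i]. If it vanished on a combination with positive
    coefficients, it would vanish on each [lam i], hence everywhere, although it is 2 on its own
    root. *)
Lemma interior_coroot_neq0 x t : (forall i, 0 < coef i x) -> t \in reflections rW ->
  coroot t x != 0.
Proof.
move=> x0 tR; have [e e0 eC] := chamber_side tR; apply/eqP => ax.
have E : \sum_i coef i x * (e * coroot t (lam i)) = e * coroot t x.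
  rewrite [in RHS](lam_expansion x) coroot_sum mulr_sumr.
  by apply: eq_bigr => i _; rewrite corootZ mulrCA.
move: E; rewrite ax mulr0.
move/eqP; rewrite psumr_eq0 => [/allP h|i _]; last first.
  by rewrite mulr_ge0 ?(ltW (x0 i)) // eC.
have a0 i : coroot t (lam i) = 0.
  have := h i (mem_index_enum _); rewrite /= mulf_eq0 (gt_eqF (x0 i)) mulf_eq0 (negbTE e0) /=.
  by move/eqP.
have := coroot_root tR; rewrite [rootv _ _]lam_expansion coroot_sum big1 => [|i _].
  by move/esym/eqP; rewrite pnatr_eq0.
by rewrite corootZ a0 mulr0.
Qed.

Lemma r_in i : r i \in W. Proof. exact: reflection_in (rR i). Qed.

Lemma coroot_side g t : t \in reflections rW -> g \in W ->
  (forall j, 0 <= coroot t (act g (lam j))) \/ (forall j, coroot t (act g (lam j)) <= 0).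
Proof.
move=> tR gW; have [k k0 kE] := coroot_conj tR gW.
have [e e0 eC] := chamber_side (reflectionJ tR gW).
have ek : e * k != 0 by rewrite mulf_neq0.
have h j : 0 <= (e * k) * coroot t (act g (lam j)) by rewrite -mulrA -kE eC.
case: (ltgtP 0 (e * k)) ek => // ek _; [left|right] => j.
  by rewrite -(pmulr_rge0 _ ek).
by rewrite -(nmulr_rge0 _ ek).
Qed.

(** The dichotomy of positive and negative roots: the values on the [lam j] are the coordinates of
    [coef i \o act g] in the basis of simple functionals [coef j]. They share a sign because the
    hyperplane of the conjugate reflection does not cut [C]. *)
Lemma coef_side g i : g \in W ->
  (forall j, 0 <= coef i (act g (lam j))) \/ (forall j, coef i (act g (lam j)) <= 0).
Proof.
move=> gW; have ln := coroot_lam_neq0 i.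
have [h|h] := coroot_side (rR i) gW; case: (ltgtP 0 (coroot (r i) (lam i))) ln => // ln _;
  have ln' : (coroot (r i) (lam i))^-1 < 0 \/ 0 < (coroot (r i) (lam i))^-1
    by rewrite ?invr_gt0 ?invr_lt0; tauto.
- by left => j; rewrite /coef mulr_ge0 // invr_ge0 ltW.
- by right => j; rewrite /coef mulr_ge0_le0 // invr_le0 ltW.
- by right => j; rewrite /coef mulr_le0_ge0 // invr_ge0 ltW.
- by left => j; rewrite /coef mulr_le0 // invr_le0 ltW.
Qed.

(** The simple root rescaled so that [coef i] is its coroot. The numbers [coef i (svec j)] then play
    the role of the Cartan matrix. *)
Definition svec i : V := coroot (r i) (lam i) *: rootv rW (r i).

Lemma act_r i x : act (r i) x = x - coef i x *: svec i.
Proof.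
by rewrite act_reflection // /coef /svec scalerA mulfVK // coroot_lam_neq0.
Qed.

Lemma coef_svec i : coef i (svec i) = 2.
Proof. by rewrite /svec coefZ /coef coroot_root // mulrCA divff ?mulr1 // coroot_lam_neq0. Qed.

Lemma coef_act_r i j x : coef i (act (r j) x) = coef i x - coef j x * coef i (svec j).
Proof. by rewrite act_r coefD coefN coefZ. Qed.

Lemma coef_act_r_id i x : coef i (act (r i) x) = - coef i x.
Proof. by rewrite coef_act_r coef_svec; ring. Qed.

Lemma act_r_lam i j : i != j -> act (r i) (lam j) = lam j.
Proof. by move=> ij; apply/eqP; rewrite -coef_eq0 coef_lam (negbTE ij). Qed.

Lemma r_invol i : (r i * r i)%g = 1%g.
Proof.
have rW2 : (r i * r i)%g \in W by rewrite groupM // r_in.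
apply: (mx_faithful_inj faithfulW) => //.
apply/matrixP => a b; have e : act (r i * r i)%g (delta_mx b 0) = act 1%g (delta_mx b 0).
  by rewrite actM ?r_in // act1 reflectionK.
by have /colP/(_ a) := e; rewrite !actE -!colE !mxE.
Qed.

(** Since [r j] fixes [lam i], the functional [coef i \o act (r j)] is 1 at [lam i], hence
    nonnegative on all rays; at [lam j] its value is [- coef i (svec j)]. *)
Lemma svec_le0 i j : i != j -> coef i (svec j) <= 0.
Proof.
move=> ij; have [h|h] := coef_side i (r_in j).
  by have := h j; rewrite coef_act_r !coef_lam (negbTE ij) eqxx sub0r mul1r oppr_ge0.
have := h i; rewrite act_r_lam 1?eq_sym // coef_lam eqxx => /(lt_le_trans ltr01).
by rewrite ltxx.
Qed.

(** * Words and the exchange property *)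

Definition word (s : seq 'I_l) : gT := (\prod_(i <- s) r i)%g.

Lemma word_in s : word s \in W.
Proof. by apply: group_prod => i _; exact: r_in. Qed.

(** Consider the letter [j] whose appending turns [coef i \o act (word s)] from nonnegative to
    nonpositive. As [r j] fixes every [lam m] with [m != j], this functional vanishes on all of
    these, so its kernel is the wall of [r j] and [r j] is the conjugate of [r i] by [word s].
    Multiplying by [r i] on the left then deletes that letter. *)
Lemma exchange s i : (forall j, coef i (act (word s) (lam j)) <= 0) ->
  exists2 s', (size s' < size s)%N & word s' = (r i * word s)%g.
Proof.
elim/last_ind: s => [/(_ i)|s j IH neg].
  by rewrite /word big_nil act1 coef_lam eqxx ler10.
have wE k : word (rcons s k) = (word s * r k)%g by rewrite /word -cats1 big_cat big_seq1.
have [pos|neg'] := coef_side i (word_in s); last first.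
  have [s' ss' s'E] := IH neg'; exists (rcons s' j); first by rewrite !size_rcons.
  by rewrite wE /word -cats1 big_cat big_seq1 -/(word s') s'E mulgA.
exists s; first by rewrite size_rcons.
have b0 m : m != j -> coef i (act (word s) (lam m)) = 0.
  move=> mj; apply/le_anti; rewrite pos andbT; have := neg m.
  by rewrite wE actM ?word_in ?r_in // act_r_lam // eq_sym.
have tE : r j = (r i ^ word s)%g.
  apply: (reflection_inj faithfulW (rR j) (reflectionJ (rR i) (word_in s))) => x ax.
  have [k k0 ->] := coroot_conj (rR i) (word_in s).
  have jx : coef j x = 0 by rewrite /coef ax mul0r.
  suff : coef i (act (word s) x) = 0.
    move/eqP; rewrite mulf_eq0 invr_eq0 (negbTE (coroot_lam_neq0 i)) orbF => /eqP ->.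
    by rewrite mulr0.
  rewrite {1}[x]lam_expansion act_sum coef_sum big1 // => m _.
  rewrite actZ coefZ; have [->|mj] := eqVneq m j; first by rewrite jx mul0r.
  by rewrite b0 // mulr0.
by rewrite wE tE conjgE !mulgA mulgK r_invol mul1g.
Qed.

(** * Parabolic subgroups and the fundamental domain *)

Lemma parab_mem J i : i \in J -> r i \in parab r J.
Proof. by move=> iJ; apply: mem_gen; exact: imset_f. Qed.

Lemma parabS J J' : J \subset J' -> parab r J \subset parab r J'.
Proof. by move=> JJ'; apply: genS; exact: imsetS. Qed.

Lemma parab_sub J : parab r J \subset W.
Proof. by rewrite gen_subG; apply/fintype.subsetP => _ /imsetP[i _ ->]; exact: r_in. Qed.

Lemma parab_in J g : g \in parab r J -> g \in W.
Proof. exact/fintype.subsetP/parab_sub. Qed.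

Lemma parab_ind J (P : gT -> Prop) : P 1%g ->
  (forall i g, i \in J -> g \in W -> P g -> P (r i * g)%g) ->
  forall g, g \in parab r J -> P g.
Proof.
move=> P1 PM g /gen_prodgP[n [c cJ ->]].
have cW (i : 'I_n) : c i \in W.
  by have /imsetP[k _ ->] := cJ i; exact: r_in.
elim: n c cJ cW => [|n IH] c cJ cW; first by rewrite big_ord0.
rewrite big_ord_recl; have /imsetP[k kJ ->] := cJ ord0; apply: PM => //.
  by apply: group_prod => i _.
by apply: (IH (fun k' : 'I_n => c (lift ord0 k'))) => k'.
Qed.

Lemma parab_fix J g x : (forall j, j \in J -> coef j x = 0) -> g \in parab r J ->
  act g x = x.
Proof.
move=> Jx; move: g; apply: (@parab_ind J (fun g => act g x = x)) => [|i h iJ hW hx]; first exact: act1.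
by rewrite actM ?r_in // hx; apply/eqP; rewrite -coef_eq0 Jx.
Qed.

(** A point in the relative interior of the face of [C] spanned by the [lam i] with [i] in [J]. *)
Definition weight J : V := \sum_(i in J) lam i.

Lemma coef_weight i J : coef i (weight J) = (i \in J)%:R.
Proof.
rewrite /weight coef_sum; under eq_bigr do rewrite coef_lam.
have [iJ|iJ] := boolP (i \in J).
  by rewrite (bigD1 i) //= eqxx big1 ?addr0 // => j /andP[_ /negbTE]; rewrite eq_sym => ->.
by rewrite big1 // => j jJ; case: eqVneq iJ => // ->; rewrite jJ.
Qed.

(** Choose [g] in the finite parabolic subgroup maximizing [form p (act g x)], where [p] is the sum
    of all the [lam i]. Since [p] has positive product with every [svec j], a negative [coef j]
    would let [r j] increase the value. *)
Lemma parab_dominant J x : exists2 g, g \in parab r J &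
  forall j, j \in J -> 0 <= coef j (act g x).
Proof.
pose p := weight [set: 'I_l]%SET.
have p1 i : coef i p = 1 by rewrite coef_weight inE.
have pv i : 0 < form rW p (svec i).
  have w0 := form_gt0 rW (rootv_neq0 (rR i)).
  have ln := coroot_lam_neq0 i.
  have e : form rW p (svec i) = coroot (r i) (lam i) ^+ 2 * coef i p *
      (form rW (rootv rW (r i)) (rootv rW (r i)) / 2).
    rewrite /svec formZr formC /coef !corootE.
    have A0 : form rW (rootv rW (r i)) (lam i) != 0.
      by apply: contraNneq ln => e; rewrite !corootE e mulr0 mul0r.
    by field; rewrite A0 gt_eqF.
  by rewrite e p1 mulr1 mulr_gt0 ?divr_gt0 // exprn_even_gt0.
have P1 : 1%g \in parab r J by exact: group1.
case: (@arg_maxP _ R gT 1%g (mem (parab r J)) (fun g => form rW p (act g x)) P1) => g gJ gmax.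
exists g => // j jJ; rewrite leNgt; apply/negP => neg.
have rgJ : (r j * g)%g \in parab r J by rewrite groupM ?parab_mem.
have /= := gmax _ rgJ; rewrite actM ?r_in ?(parab_in gJ) // act_r formDr formNr formZr.
rewrite leNgt => /negP[]; rewrite ltrDl oppr_gt0.
by rewrite nmulr_rlt0.
Qed.

(** Take [x] generic on the hyperplane of a reflection [t] and move it into [C] by a product [g] of
    simple reflections. The image is fixed by a reflection, so it is not interior and lies on some
    wall [i]. By genericity the hyperplane of [t] lies in that of [r i ^ g], and the two reflections
    coincide. *)
Lemma parab_setT : parab r [set: 'I_l]%SET = W.
Proof.
apply/eqP; rewrite finset.eqEsubset parab_sub -{1}genW gen_subG; apply/fintype.subsetP => t tR.
have tW := reflection_in tR.
have [x xt xg] := generic_vector (fixv (rW t)) [seq fixv (rW u) | u in reflections rW].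
have [g gP gC] := parab_dominant [set: 'I_l]%SET x.
have gW := parab_in gP.
have [i gi] : exists i, coef i (act g x) = 0.
  apply: contrapT => ni.
  have pos i : 0 < coef i (act g x).
    by rewrite lt_neqAle gC ?inE // andbT eq_sym; apply/eqP => e; apply: ni; exists i.
  have tgR : (t ^ g^-1)%g \in reflections rW by rewrite reflectionJ ?groupV.
  have := interior_coroot_neq0 pos tgR; rewrite coroot_eq0 // => /fixvP; apply.
  rewrite -/(act _ _) conjgE invgK -!actM ?groupM ?groupV //.
  rewrite mulgA mulgKV actM //; congr (act g _).
  exact/fixvP.
have rg : (r i ^ g)%g \in reflections rW by rewrite reflectionJ.
suff -> : t = (r i ^ g)%g by rewrite groupJ ?parab_mem ?inE.
apply: (reflection_inj faithfulW tR rg) => y /eqP; rewrite coroot_eq0 // => yt.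
suff /subvP sub : (fixv (rW t) <= fixv (rW (r i ^ g)%g))%VS.
  by have := sub _ yt; rewrite -(coroot_eq0 rg) => /eqP.
apply: xg; first exact: (fintype.image_f (fun u => fixv (rW u))).
apply/fixvP; rewrite -/(act _ _) conjgE !actM ?groupM ?groupV ?r_in //.
by have /eqP -> : act (r i) (act g x) == act g x; [rewrite -coef_eq0 gi | rewrite actK].
Qed.

Lemma wordP g : g \in W -> exists s, g = word s.
Proof.
rewrite -parab_setT; move: g; apply: (@parab_ind _ (fun g => exists s, g = word s)); first by exists [::]; rewrite /word big_nil.
by move=> i g _ _ [s ->]; exists (i :: s); rewrite /word big_cons.
Qed.

Definition zeros x : {set 'I_l} := [set i | coef i x == 0]%SET.

Lemma chamber_fundamental g x : g \in W -> C x -> C (act g x) ->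
  act g x = x /\ g \in parab r (zeros x).
Proof.
move=> /wordP[s ->] {g}; have [n] := ubnP (size s).
elim: n s => // n IH [|i s] sn Cx Cgx.
  by rewrite /word big_nil act1; split => //; exact: group1.
have wE : word (i :: s) = (r i * word s)%g by rewrite /word big_cons.
have wW := word_in s; rewrite !ltnS /= in sn.
have [pos|neg] := coef_side i (word_in (i :: s)).
  have [|s' ss' s'E] := @exchange s i.
    move=> j; have := pos j; rewrite wE actM ?r_in // coef_act_r_id oppr_ge0.
    exact.
  rewrite wE -s'E in Cgx *; apply: IH Cx Cgx.
  exact: ltn_trans ss' sn.
have ci : coef i (act (word (i :: s)) x) = 0.
  apply/le_anti; rewrite ((chamberP _).1 Cgx) andbT.
  rewrite {1}[x]lam_expansion act_sum coef_sum -oppr_ge0 -sumrN sumr_ge0 // => j _.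
  rewrite actZ coefZ oppr_ge0 mulr_ge0_le0 //; exact: (chamberP _).1 Cx j.
have e : act (word (i :: s)) x = act (word s) x.
  have /eqP : act (r i) (act (word (i :: s)) x) == act (word (i :: s)) x.
    by rewrite -coef_eq0 ci.
  by rewrite wE -actM ?groupM ?r_in // mulgA r_invol mul1g => ->.
rewrite e in Cgx ci *; have [gx wz] := IH s sn Cx Cgx.
split=> //; rewrite wE groupM // parab_mem // inE -gx ci //.
Qed.

Lemma zeros_weight J : zeros (weight J) = (~: J)%SET.
Proof.
by apply/finset.setP => i; rewrite !inE coef_weight pnatr_eq0 eqb0.
Qed.

Lemma weight_chamber J : C (weight J).
Proof. by apply/chamberP => i; rewrite coef_weight ler0n. Qed.

Lemma parab_lam J g i : g \in parab r J -> i \notin J -> act g (lam i) = lam i.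
Proof.
move=> gJ iJ; apply: parab_fix gJ => j jJ; rewrite coef_lam.
by case: eqVneq iJ => // <-; rewrite jJ.
Qed.

(** An element fixing these [lam i] fixes [weight K], a point of [C] lying on exactly the walls
    outside [K]. *)
Lemma parab_memC K g : g \in W -> (forall i, i \in K -> act g (lam i) = lam i) ->
  g \in parab r (~: K)%SET.
Proof.
move=> gW gK; have gw : act g (weight K) = weight K.
  by rewrite /weight act_sum; apply: eq_bigr => i /gK.
have [|_] := chamber_fundamental gW (weight_chamber K).
  by rewrite gw; exact: weight_chamber.
by rewrite zeros_weight.
Qed.

Lemma parab1P g i : g \in W ->
  (g \in parab r (~: [set i])%SET) = (act g (lam i) == lam i).
Proof.
move=> gW; apply/idP/eqP => [gi|gi].
  by apply: parab_lam gi _; rewrite !inE eqxx.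
by apply: parab_memC => // j; rewrite inE => /eqP ->.
Qed.

Lemma parab_subset J K : (parab r J \subset parab r K) = (J \subset K).
Proof.
apply/idP/idP => [JK|]; last exact: parabS.
apply/fintype.subsetP => i iJ; apply: contraT => iK.
have /parab_lam/(_ iK)/eqP : r i \in parab r K.
  by apply: (fintype.subsetP JK); exact: parab_mem.
by rewrite -coef_eq0 coef_lam eqxx oner_eq0.
Qed.

Lemma coset_subset g h J K : g \in W -> h \in W ->
  (h *: parab r K \subset g *: parab r J)%g =
  ((g^-1 * h)%g \in parab r J) && (K \subset J).
Proof.
move=> gW hW; apply/idP/andP => [sub|[gh KJ]].
  have gh : (g^-1 * h)%g \in parab r J.
    by rewrite -mem_lcoset; apply: (fintype.subsetP sub); exact: lcoset_refl.
  split=> //; rewrite -parab_subset; apply/fintype.subsetP => k kK.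
  rewrite -(groupMl _ gh) -mulgA -mem_lcoset; apply: (fintype.subsetP sub).
  by rewrite mem_lcoset mulKg.
apply/fintype.subsetP => k; rewrite !mem_lcoset => hk.
have -> : (g^-1 * k = (g^-1 * h) * (h^-1 * k))%g by rewrite -mulgA mulKVg.
by rewrite groupMl // (fintype.subsetP (parabS KJ)).
Qed.

(** * Cosets as simplices *)

Definition vertex g i : {set gT} := (g *: parab r (~: [set i])%SET)%g.

(** A vertex amounts to its index [i] together with the point [act g (lam i)]; comparisons of cosets
    are reduced to equalities of such points. *)
Lemma coset_sub_vertex g h K i : g \in W -> h \in W ->
  (h *: parab r K \subset vertex g i)%g =
  (act g (lam i) == act h (lam i)) && (i \notin K).
Proof.
move=> gW hW; rewrite coset_subset // parab1P ?groupM ?groupV // actM ?groupV //.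
congr (_ && _); last by rewrite finset.subsetC finset.sub1set inE.
by apply/eqP/eqP => e; [rewrite -{1}e actKV | rewrite -e actK].
Qed.

Lemma vertex_eq g h i j : g \in W -> h \in W -> vertex g i = vertex h j ->
  i = j /\ act g (lam i) = act h (lam i).
Proof.
move=> gW hW e; have := fintype.subxx (vertex h j); rewrite -{2}e coset_sub_vertex //.
by rewrite !inE negbK => /andP[/eqP -> /eqP ->].
Qed.

Lemma eq_vertex g h i : g \in W -> h \in W -> act g (lam i) = act h (lam i) ->
  vertex g i = vertex h i.
Proof.
move=> gW hW e; apply/eqP; rewrite finset.eqEsubset !coset_sub_vertex // e eqxx.
by rewrite !inE eqxx.
Qed.

Lemma vertex_inj g : g \in W -> injective (vertex g).
Proof. by move=> gW i j /(vertex_eq gW gW)[]. Qed.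

Lemma DeltaP (s : {set gT}) : reflect
  (exists g J, g \in W /\ s = (g *: parab r J)%g) (s \in Delta W r).
Proof.
rewrite inE; apply: (iffP existsP) => [[J /lcosetsP[g gW ->]]|[g [J [gW ->]]]].
  by exists g, J.
by exists J; apply/lcosetsP; exists g.
Qed.

Lemma coset_Delta g J : g \in W -> (g *: parab r J)%g \in Delta W r.
Proof. by move=> gW; apply/DeltaP; exists g, J. Qed.

Lemma verticesP (v : {set gT}) : reflect
  (exists g i, g \in W /\ v = vertex g i) (v \in vertices W r).
Proof.
rewrite inE; apply: (iffP existsP) => [[i /lcosetsP[g gW ->]]|[g [i [gW ->]]]].
  by exists g, i.
by exists i; apply/lcosetsP; exists g.
Qed.

Lemma verts_coset g J : g \in W ->
  verts W r (g *: parab r J)%g = [set vertex g i | i in (~: J)%SET]%SET.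
Proof.
move=> gW; apply/finset.setP => v; rewrite inE; apply/andP/imsetP.
  case=> /verticesP[h [i [hW ->]]]; rewrite coset_sub_vertex // => /andP[/eqP e iJ].
  by exists i; rewrite ?inE //; exact: eq_vertex.
case=> i; rewrite inE => iJ ->; split; first by apply/verticesP; exists g, i.
by rewrite coset_sub_vertex // eqxx.
Qed.

Lemma card_verts_coset g J : g \in W -> #|verts W r (g *: parab r J)%g| = #|(~: J)%SET|.
Proof. by move=> gW; rewrite verts_coset // card_imset //; exact: vertex_inj. Qed.

(** If the vertices of $gW_J$ are among those of $hW_K$, then [g] and [h] agree on every [lam i]
    with [i] outside [J]. So $g^{-1}h$ stabilizes these points and lies in $W_J$. *)
Lemma verts_subset : {in Delta W r &, forall s s' : {set gT},
  (verts W r s \subset verts W r s') = (s' \subset s)}.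
Proof.
move=> _ _ /DeltaP[g [J [gW ->]]] /DeltaP[h [K [hW ->]]].
apply/idP/idP => [sub|s's]; last first.
  apply/fintype.subsetP => v; rewrite !inE => /andP[-> /=]; exact: fintype.subset_trans.
have gh i : i \notin J -> act g (lam i) = act h (lam i) /\ i \notin K.
  move=> iJ; have : vertex g i \in verts W r (h *: parab r K)%g.
    by apply: (fintype.subsetP sub); rewrite verts_coset // imset_f // inE.
  by rewrite inE coset_sub_vertex // => /andP[_ /andP[/eqP ->]].
rewrite coset_subset //; apply/andP; split.
  rewrite -(finset.setCK J); apply: parab_memC; first by rewrite groupM ?groupV.
  by move=> i; rewrite inE => /gh[e _]; rewrite actM ?groupV // -e actK.
by apply/fintype.subsetP => i iK; apply: contraT => /gh[_]; rewrite iK.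
Qed.

Lemma face_complexP (f : {set {set gT}}) : reflect
  (exists g I, g \in W /\ f = [set vertex g i | i in I]%SET) (f \in face_complex W r).
Proof.
apply: (iffP imsetP) => [[_ /DeltaP[g [J [gW ->]]] ->]|[g [I [gW ->]]]].
  by exists g, (~: J)%SET; rewrite verts_coset.
by exists (g *: parab r (~: I)%SET)%g; rewrite ?coset_Delta // verts_coset // finset.setCK.
Qed.

Lemma face_complex_simplicial : simplicial_complex (face_complex W r).
Proof.
split; first by apply/face_complexP; exists 1%g, finset.set0; rewrite group1 imset0.
move=> _ s' /face_complexP[g [I [gW ->]]] sub; apply/face_complexP.
exists g, [set i in I | vertex g i \in s']%SET; split=> //.
apply/finset.setP => v; apply/idP/imsetP => [vs'|[ i ]].
  have /imsetP[i iI vi] := fintype.subsetP sub _ vs'.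
  by exists i => //; rewrite inE iI -vi.
by rewrite inE => /andP[_ ?] ->.
Qed.

(** * Piecewise linear coordinates of a fan *)

Definition rvert (v : {set gT}) : V :=
  if [pick p : gT * 'I_l |
        (p.1 \in W) && (v == (p.1 *: parab r (~: [set p.2])%SET)%g)]
    is Some p then act p.1 (lam p.2) else 0.

Lemma rvert_vertex g i : g \in W -> rvert (vertex g i) = act g (lam i).
Proof.
move=> gW; rewrite /rvert; case: pickP => [[h j] /= /andP[hW /eqP e]|/(_ (g, i))].
  by have [-> ->] := vertex_eq gW hW e.
by rewrite /= gW eqxx.
Qed.

(** The real counterpart of [barycenter], as [rvert] is of [rho_vertex]: the geometry is done over
    the reals and complexified at the end. *)
Definition bary (t : {set gT} -> R) : V := \sum_v t v *: rvert v.

Lemma bary_support g J (t : {set gT} -> R) : g \in W ->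
  (forall v, v \notin [set vertex g i | i in J]%SET -> t v = 0) ->
  bary t = act g (\sum_(i in J) t (vertex g i) *: lam i).
Proof.
move=> gW tJ; rewrite act_sum /bary.
rewrite (bigID (mem [set vertex g i | i in J]%SET)) /= [X in _ + X]big1 => [|v /tJ ->]; last first.
  by rewrite scale0r.
rewrite addr0 big_imset /=; last by move=> i j _ _; exact: vertex_inj.
by apply: eq_bigr => i _; rewrite rvert_vertex // actZ.
Qed.

(** The fundamental domain relative to a parabolic subgroup, where only the coordinates in [J] are
    constrained. Adding a large multiple [N] of [weight (~: J)], which [parab r J] fixes, brings
    both points into [C] without changing the coordinates in [J]. *)
Lemma dominant_unique J h x : h \in parab r J ->
  (forall j, j \in J -> 0 <= coef j x) -> (forall j, j \in J -> 0 <= coef j (act h x)) ->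
  act h x = x /\ forall j, j \in J -> coef j x != 0 -> act h (lam j) = lam j.
Proof.
move=> hJ x0 hx0; have hW := parab_in hJ.
pose N := \sum_i (`|coef i x| + `|coef i (act h x)|).
pose b := weight (~: J)%SET.
have hb : act h b = b.
  by apply: parab_fix hJ => j jJ; rewrite coef_weight inE jJ.
have NP i : 0 <= coef i x + N /\ 0 <= coef i (act h x) + N.
  have : `|coef i x| + `|coef i (act h x)| <= N.
    by rewrite /N (bigD1 i) //= lerDl sumr_ge0 // => j _; rewrite addr_ge0.
  have := ler_norm (- coef i x); have := ler_norm (- coef i (act h x)); rewrite !normrN.
  have := normr_ge0 (coef i x); have := normr_ge0 (coef i (act h x)); lra.
have CN y : (forall j, j \in J -> 0 <= coef j y) -> (forall i, 0 <= coef i y + N) ->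
    C (y + N *: b).
  move=> y0 yN; apply/chamberP => i; rewrite coefD coefZ coef_weight inE.
  by have [/y0|_] := boolP (i \in J); rewrite /= ?mulr0 ?addr0 // mulr1.
have hN : act h (x + N *: b) = act h x + N *: b by rewrite actD actZ hb.
have [||hx hz] := chamber_fundamental hW (CN x x0 _).
- by move=> i; have [] := NP i.
- by rewrite hN; apply: CN => // i; have [] := NP i.
split; first by apply: (addIr (N *: b)); rewrite -hN hx.
move=> j jJ xj; apply: parab_lam hz _; rewrite inE coefD coefZ coef_weight inE jJ.
by rewrite mulr0 addr0.
Qed.

(* Modulo the vectors fixed by [g W_J g^-1], the cones over the [act w (lam j)], [j] in [J],
   for [w] in [g W_J], form a complete fan; [gcoords g J y] is the family of coordinates of
   [y] with respect to the rays of this fan, indexed by the cosets [vertex w j]. *)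
Definition dominating g J y : gT :=
  odflt g [pick w in (g *: parab r J)%g | [forall j in J, 0 <= coef j (act w^-1%g y)]].

Lemma dominatingP g J y : g \in W ->
  dominating g J y \in (g *: parab r J)%g /\
  forall j, j \in J -> 0 <= coef j (act (dominating g J y)^-1%g y).
Proof.
move=> gW; rewrite /dominating; case: pickP => [w /andP[wg /forall_inP]//|h].
have [u uJ ud] := parab_dominant J (act g^-1%g y).
have uW := parab_in uJ; move/negP: (negbT (h (g * u^-1)%g)); case; apply/andP; split.
  by rewrite mem_lcoset mulKg groupV.
by apply/forall_inP => j jJ; rewrite invMg invgK actM ?groupV // ud.
Qed.

Definition gcoords g J y (v : {set gT}) : R :=
  let w := dominating g J y in
  \sum_(j in J) (v == vertex w j)%:R * coef j (act w^-1%g y).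

Lemma coset_in g J w : g \in W -> w \in (g *: parab r J)%g -> w \in W.
Proof.
by move=> gW; rewrite mem_lcoset => /parab_in gw; rewrite -(mulKVg g w) groupM.
Qed.

(** The coordinates do not depend on the chosen dominating element: two choices differ by an element
    of [parab r J] that fixes each [lam j] with nonzero coefficient, so the nonzero terms sit at the
    same vertices. *)
Lemma gcoordsE g J y w v : g \in W -> w \in (g *: parab r J)%g ->
  (forall j, j \in J -> 0 <= coef j (act w^-1%g y)) ->
  gcoords g J y v = \sum_(j in J) (v == vertex w j)%:R * coef j (act w^-1%g y).
Proof.
move=> gW wg wd; have [w'g w'd] := dominatingP J y gW; rewrite /gcoords.
move: w'g w'd; set w' := dominating g J y => w'g w'd.
have wW := coset_in gW wg; have w'W := coset_in gW w'g.
have hJ : (w'^-1 * w)%g \in parab r J.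
  by rewrite !mem_lcoset in wg w'g; rewrite -(mulKVg g w) mulgA groupM // -(invgK (w'^-1 * g)%g) groupV invMg invgK.
have e : act w'^-1%g y = act (w'^-1 * w)%g (act w^-1%g y).
  by rewrite actM ?groupV // actKV.
have [|e' fixh] := dominant_unique hJ wd; first by move=> j jJ; rewrite -e w'd.
apply: eq_bigr => j jJ; rewrite e e'.
have [->|cj] := eqVneq (coef j (act w^-1%g y)) 0; first by rewrite !mulr0.
congr (_ %:R * _); congr (nat_of_bool (_ == _)); apply: eq_vertex => //.
by rewrite -{1}(fixh j jJ cj) actM ?groupV // actKV.
Qed.

Lemma gcoords_ge0 g J y v : g \in W -> 0 <= gcoords g J y v.
Proof.
move=> gW; have [_ wd] := dominatingP J y gW.
by apply: sumr_ge0 => j jJ; rewrite mulr_ge0 ?ler0n // wd.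
Qed.

Lemma gcoords_sum g J y : g \in W ->
  \sum_v gcoords g J y v = \sum_(j in J) coef j (act (dominating g J y)^-1%g y).
Proof.
move=> gW; rewrite /gcoords exchange_big /=; apply: eq_bigr => j _.
rewrite -mulr_suml (bigD1 (vertex (dominating g J y) j)) //= eqxx.
by rewrite big1 ?addr0 ?mul1r // => v /negbTE ->.
Qed.

Lemma gcoords_support g J y v : g \in W ->
  v \notin [set vertex (dominating g J y) j | j in J]%SET -> gcoords g J y v = 0.
Proof.
move=> gW nv; rewrite /gcoords big1 // => j jJ; case: eqVneq => [e|_]; last by rewrite mul0r.
by move: nv; rewrite e imset_f.
Qed.

(** On families supported on a single cone the coordinates can be recovered from the point. This is
    the source of the injectivity of [rho]. *)
Lemma gcoords_bary g J w (t : {set gT} -> R) : g \in W -> w \in (g *: parab r J)%g ->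
  (forall v, 0 <= t v) ->
  (forall v, v \notin [set vertex w i | i in J]%SET -> t v = 0) ->
  gcoords g J (bary t) = t.
Proof.
move=> gW wg t0 tJ; have wW := coset_in gW wg.
have cE j : j \in J -> coef j (act w^-1%g (bary t)) = t (vertex w j).
  move=> jJ; rewrite (bary_support wW tJ) actK // coef_sum (bigD1 j) //=.
  rewrite coefZ coef_lam eqxx mulr1 big1 ?addr0 // => i /andP[_ ij].
  by rewrite coefZ coef_lam eq_sym (negbTE ij) mulr0.
apply/funext => v; rewrite (@gcoordsE _ _ _ w) //; last by move=> j jJ; rewrite cE.
have [/imsetP[i iJ ->]|nv] := boolP (v \in [set vertex w i | i in J]%SET); last first.
  rewrite tJ // big1 // => j jJ; case: eqVneq => [e|_]; last by rewrite mul0r.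
  by move: nv; rewrite e imset_f.
rewrite (bigD1 i) //= eqxx mul1r cE // big1 ?addr0 // => j /andP[_ ji].
by rewrite (inj_eq (vertex_inj wW)) eq_sym (negbTE ji) mul0r.
Qed.

Lemma bary_coords g y : g \in W -> bary (gcoords g [set: 'I_l]%SET y) = y.
Proof.
move=> gW; have [wg wd] := dominatingP [set: 'I_l]%SET y gW.
have wW := coset_in gW wg.
rewrite (bary_support wW (fun v => @gcoords_support g _ y v gW)).
rewrite -[RHS](actKV rW _ wW); congr (act _ _); rewrite [RHS]lam_expansion.
apply: eq_big => [i|i _]; first by rewrite inE.
congr (_ *: _); rewrite /gcoords (bigD1 i) ?inE //= eqxx mul1r big1 ?addr0 // => j /andP[_ ji].
by rewrite (inj_eq (vertex_inj wW)) eq_sym (negbTE ji) mul0r.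
Qed.

(** The vector [z] is fixed by $gW_Jg^{-1}$, so its coordinates in [J] vanish in every chamber of
    the fan. In a link this allows a point to be replaced by its projection. *)
Lemma gcoords_shift g J y z : g \in W -> (forall j, j \in J -> coef j (act g^-1%g z) = 0) ->
  gcoords g J (y + z) = gcoords g J y.
Proof.
move=> gW z0; have [wg wd] := dominatingP J y gW.
move: wg wd; set w := dominating g J y => wg wd.
have wW := coset_in gW wg.
have wz j : j \in J -> coef j (act w^-1%g (y + z)) = coef j (act w^-1%g y).
  move=> jJ; rewrite actD coefD -[RHS]addr0; congr (_ + _).
  have u : (w^-1 * g)%g \in parab r J by rewrite -groupV invMg invgK -mem_lcoset.
  have -> : act w^-1%g z = act (w^-1 * g)%g (act g^-1%g z) by rewrite actM ?groupV // actKV.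
  by rewrite (parab_fix z0 u) z0.
apply/funext => v; rewrite !(@gcoordsE _ _ _ w) //; last by move=> j jJ; rewrite wz // wd.
by apply: eq_bigr => j jJ; rewrite wz.
Qed.

Lemma act_continuous g : continuous (act g).
Proof.
apply: mx_continuous => i j.
rewrite (_ : (fun x => act g x i j) = fun x : V => \sum_k rW g i k * x k j); last first.
  by apply/funext => x; rewrite mxE.
apply: (@continuous_sumf R _ _ _ _ (fun k (x : V) => rW g i k * x k j)) => k _.
by apply: (@continuous_mulf R); [exact: continuous_cstf | exact: coord_continuous].
Qed.

(** On the closed set where a given [w] is dominating the coordinate is linear, and [gcoordsE] makes
    the pieces agree. The cover is indexed by the whole group type, with empty pieces outside the
    coset. *)
Lemma gcoords_continuous g J v : g \in W -> continuous (fun y => gcoords g J y v).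
Proof.
move=> gW; pose D (w : gT) : set V := [set y | w \in (g *: parab r J)%g /\
  forall j, j \in J -> 0 <= coef j (act w^-1%g y)].
have cc w j : continuous (fun y => coef j (act w^-1%g y)).
  move=> y; exact: (continuous_comp (@act_continuous w^-1%g y) (@coef_continuous j _)).
apply: (@closed_cover_continuous _ _ gT D (fun w y =>
   \sum_(j in J) (v == vertex w j)%:R * coef j (act w^-1%g y))).
- by move=> y; exists (dominating g J y); exact: dominatingP.
- move=> w; have [wg|wg] := boolP (w \in (g *: parab r J)%g); last first.
    rewrite (_ : D w = set0); first exact: closed0.
    by rewrite -subset0 => y [wg']; rewrite wg' in wg.
  rewrite (_ : D w = \bigcap_(j in [set` J])
      (fun y => coef j (act w^-1%g y)) @^-1` [set x | 0 <= x]).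
    by apply: closed_bigI => j _; exact: (continuous_closedP _).1 (cc w j) _ (@closed_ge _ 0).
  by apply/seteqP; split => y => [[_ h] j jJ|h]; [exact: h | split => // j jJ; exact: h].
- move=> w; apply: (@continuous_sumf R _ _ _ _ (fun j y => (v == vertex w j)%:R * coef j (act w^-1%g y))) => j _.
  by apply: (@continuous_mulf R); [exact: continuous_cstf | exact: cc].
- by move=> w y [wg wd]; exact: gcoordsE.
Qed.

(** * The embedding *)

Local Notation lamCx := (fun i => complexify (lam i)).
Local Notation rWC := (complex_repr rW).
Local Notation geomW := (geom R W r).
Local Notation simplicesW := (simplices R W r).

Lemma act_complexify g x : rWC g *m complexify x = complexify (act g x).
Proof. by rewrite /complexify actE map_mxM. Qed.

Lemma rho_vertexE v : rho_vertex rWC r lamCx v = complexify (rvert v).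
Proof.
rewrite /rho_vertex /rvert; case: pickP => [[g i] _ |_]; first exact: act_complexify.
by rewrite /complexify map_mx0.
Qed.

Lemma barycenterE (t : {set gT} -> R) :
  barycenter rWC r lamCx t = complexify (bary t).
Proof.
rewrite /bary complexify_sum; apply: eq_bigr => v _.
by rewrite rho_vertexE complexifyZ.
Qed.

Lemma bary_continuous : continuous (bary : {ptws {set gT} -> R} -> V).
Proof.
apply: mx_continuous => i j.
rewrite (_ : (fun t : {ptws {set gT} -> R} => bary t i j) = fun t => \sum_v t v * rvert v i j); last first.
  by apply/funext => t; rewrite /bary summxE; apply: eq_bigr => v _; rewrite mxE.
apply: (@continuous_sumf R _ _ _ _ (fun v (t : {ptws {set gT} -> R}) => t v * rvert v i j)) => v _.
by apply: (@continuous_mulf R); [exact: ptws_eval_continuous | exact: continuous_cstf].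
Qed.

Lemma glue_coords (p q : simplicesW) : Defs.glue p q -> Defs.coords p = Defs.coords q.
Proof.
move/asboolP; elim => [{}p {}q [_ //]|//|{}p {}q _ -> //|{}p {}q u _ -> _ -> //].
Qed.

Lemma pi_glue (p q : simplicesW) : Defs.glue p q ->
  (\pi_geomW p)%qT = (\pi_geomW q)%qT.
Proof. by move=> pq; apply/eqmodP. Qed.

Lemma coords_repr (p : simplicesW) :
  Defs.coords (generic_quotient.repr (\pi_geomW p)%qT) = Defs.coords p.
Proof. by apply: glue_coords; move: (reprK (\pi_geomW p)%qT) => /eqmodP. Qed.

Definition rho_real (x : geomW) : V := bary (Defs.coords (generic_quotient.repr x)).

Lemma rhoE (x : geomW) : rho rWC lamCx x = complexify (rho_real x).
Proof. exact: barycenterE. Qed.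

Lemma rho_real_pi (p : simplicesW) : rho_real (\pi_geomW p)%qT = bary (Defs.coords p).
Proof. by rewrite /rho_real coords_repr. Qed.

Lemma rho_real_continuous : continuous rho_real.
Proof.
apply/(@quotient_continuous _ {eq_quot (glue_rel R W r)}%qT V rho_real).
have -> : rho_real \o \pi_geomW%qT =
    unstable.sigT_fun (fun (s : face W r) (t : set_type (simplex W r (val s))) => bary (set_val t)).
  by apply/funext => -[s t] /=; rewrite rho_real_pi.
apply: sigT_continuous => s t.
apply: (@continuous_comp _ {ptws {set gT} -> R} V (@set_val _ _) bary).
  exact: initial_continuous.
exact: bary_continuous.
Qed.

Lemma simplex_compact (s : {set gT}) : compact (simplex (R := R) W r s).
Proof.
pose A (v : {set gT}) : set R := if v \in verts W r s then `[0, 1]%classic else [set 0].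
have cA v : compact (A v).
  by rewrite /A; case: ifP => _; [exact: segment_compact | exact: compact_set1].
have csum : continuous (fun t : {ptws {set gT} -> R} => \sum_v t v).
  apply: (@continuous_sumf R _ _ _ _ (fun v (t : {ptws {set gT} -> R}) => t v)) => v _.
  exact: ptws_eval_continuous.
rewrite (_ : simplex W r s = [set t | forall v, A v (t v)] `&`
    (fun t : {ptws {set gT} -> R} => \sum_v t v) @^-1` [set 1]).
  apply: compact_closedI; first exact: (@tychonoff _ (fun=> R) A cA).
  exact: (continuous_closedP _).1 csum _ (@closed_eq _ 1).
apply/seteqP; split => [t [t0 t1 ts]|t [tA t1]].
  split=> // v; rewrite /A; case: ifPn => [vs|/ts -> //].
  rewrite /= in_itv /= t0 -t1 (bigD1 v) //= lerDl sumr_ge0 // => u _; exact: t0.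
split=> // v.
  by have := tA v; rewrite /A; case: ifP => [_|_ -> //]; rewrite /= in_itv /= => /andP[].
by move=> vs; have := tA v; rewrite /A (negbTE vs).
Qed.

Lemma geom_compact : compact [set: geomW].
Proof.
have cs : compact [set: simplicesW].
  apply: sigT_compact; first exact: finite_finset.
  by move=> s; apply: set_type_compact; exact: simplex_compact.
have -> : [set: geomW] = \pi_geomW%qT @` [set: simplicesW].
  by apply/seteqP; split => // x _; exists (generic_quotient.repr x) => //; rewrite reprK.
apply: continuous_compact => //; apply: continuous_subspaceT.
exact: (@pi_continuous _ {eq_quot (glue_rel R W r)}%qT).
Qed.

Lemma simplex_support (s : {set gT}) g J (t : {set gT} -> R) : g \in W ->
  s = (g *: parab r J)%g -> simplex W r s t ->
  forall v, v \notin [set vertex g i | i in (~: J)%SET]%SET -> t v = 0.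
Proof. by move=> gW -> [_ _ ts] v vs; apply: ts; rewrite verts_coset. Qed.

Lemma simplex_gcoords (s : {set gT}) (t : {set gT} -> R) : s \in Delta W r ->
  simplex W r s t -> gcoords 1%g [set: 'I_l]%SET (bary t) = t.
Proof.
move=> /DeltaP[g [J [gW sE]]] st; apply: (@gcoords_bary _ _ g); rewrite ?group1 //.
- by rewrite mem_lcoset invg1 mul1g parab_setT.
- by case: st.
- move=> v vn; apply: (simplex_support gW sE st); apply: contra vn.
  by case/imsetP => i _ ->; rewrite imset_f ?inE.
Qed.

Lemma coords_simplex (p : simplicesW) : simplex W r (val (projT1 p)) (Defs.coords p).
Proof. exact: (set_valP (projT2 p)). Qed.

Definition point_of (s : {set gT}) (t : {ptws {set gT} -> R}) (sD : s \in Delta W r)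
    (st : simplex W r s t) : simplicesW :=
  existT _ (exist _ s sD : face W r) (exist _ t (mem_set st)).

(** A canonical representative of a glued point: it lies in the face whose vertices are exactly the
    support of its coordinates. Points with equal coordinates thereby land in the same face. *)
Lemma support_face (p : simplicesW) : exists2 q : simplicesW, Defs.glue q p &
  verts W r (val (projT1 q)) = [set v | Defs.coords p v != 0]%SET.
Proof.
have := coords_simplex p; have [g [J [gW sE]]] := DeltaP _ (valP (projT1 p)).
set t := Defs.coords p => st; have tJ := simplex_support gW sE st.
pose I := [set i | t (vertex g i) != 0]%SET.
have vI : verts W r (g *: parab r (~: I)%SET)%g = [set v | t v != 0]%SET.
  rewrite verts_coset // finset.setCK; apply/finset.setP => v; rewrite inE.
  apply/imsetP/idP => [[i iI ->]|tv]; first by rewrite inE in iI.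
  have [/imsetP[i iJ vE]|/tJ t0] := boolP (v \in [set vertex g i | i in (~: J)%SET]%SET).
    by exists i => //; rewrite inE -vE.
  by rewrite t0 eqxx in tv.
have st' : simplex W r (g *: parab r (~: I)%SET)%g t.
  have [t0 t1 _] := st; split=> // v; rewrite vI inE negbK => /eqP //.
exists (point_of (coset_Delta _ gW) st') => //.
apply/asboolP; apply: rst_step; split=> //=; rewrite sE coset_subset //.
rewrite mulVg group1 /=; apply/fintype.subsetP => i iJ; rewrite !inE negbK.
apply/eqP; apply: tJ; apply/imsetP => -[j]; rewrite inE => jJ /(vertex_inj gW) ij.
by rewrite -ij iJ in jJ.
Qed.

Lemma rho_real_inj : injective rho_real.
Proof.
elim/quotW => p; elim/quotW => q; rewrite !rho_real_pi => pq.
have cE : Defs.coords p = Defs.coords q.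
  rewrite -(simplex_gcoords (valP (projT1 p)) (coords_simplex p)) pq.
  exact: (simplex_gcoords (valP (projT1 q)) (coords_simplex q)).
have [p' pp' vp] := support_face p; have [q' qq' vq] := support_face q.
apply: pi_glue; apply: Defs.glue_trans (_ : Defs.glue q' q) => //.
apply: Defs.glue_trans (_ : Defs.glue p' q'); first by rewrite Defs.glue_sym.
apply/asboolP; apply: rst_step; split.
  rewrite -(verts_subset (valP (projT1 p')) (valP (projT1 q'))) vp vq cE.
  exact: fintype.subxx.
by rewrite (glue_coords pp') (glue_coords qq').
Qed.

(** The realization is compact, so [rho_real] sends the complement of an open set to a closed set of
    real vectors. Pulling back the complement of that image along [realpart] gives the required open
    set of complex vectors. *)
Lemma rho_embedding : well_framed rWC r lamCx.
Proof.
split.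
- by move=> x y; rewrite !rhoE => /(can_inj (@complexifyK R l)); exact: rho_real_inj.
- have -> : rho rWC lamCx = @complexify R l \o rho_real by apply/funext => x; exact: rhoE.
  move=> x; apply: continuous_comp; first exact: rho_real_continuous.
  exact: complexify_continuous.
move=> U oU; pose F := rho_real @` (~` U).
have cF : closed F.
  rewrite /F -(setTI (~` U)); apply: (@compact_closed_map _ V).
  - exact: norm_hausdorff.
  - exact: geom_compact.
  - exact: continuous_subspaceT rho_real_continuous.
  - by rewrite closedC.
exists (@realpart R l @^-1` (~` F)).
  by apply: (continuousP _).1; [exact: realpart_continuous | rewrite openC].
apply/seteqP; split => [_ [x Ux <-]|z [/= nF [x _ xz]]]; last rewrite -xz in nF *.
  split; last by exists x.
  rewrite /= rhoE complexifyK => -[y nU /rho_real_inj yx].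
  by apply: nU; rewrite yx.
exists x => //; apply: contrapT => nU; apply: nF.
by exists x => //; rewrite rhoE complexifyK.
Qed.

Lemma rho_range (z : 'cV[R[i]]_l) : range (rho rWC (r := r) lamCx) z <->
  exists s t, [/\ s \in Delta W r, simplex (R := R) W r s t & z = complexify (bary t)].
Proof.
split=> [[x _ <-]|[s [t [sD st ->]]]].
  exists (val (projT1 (generic_quotient.repr x))), (Defs.coords (generic_quotient.repr x)).
  split; [exact: valP | exact: coords_simplex | exact: rhoE].
exists (\pi_geomW (point_of sD st))%qT => //.
by rewrite rhoE rho_real_pi.
Qed.

(** * Radial projection *)

Local Notation full := [set: 'I_l]%SET.

Lemma gcoordsZ g J c y v : g \in W -> 0 <= c ->
  gcoords g J (c *: y) v = c * gcoords g J y v.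
Proof.
move=> gW c0; have [wg wd] := dominatingP J y gW.
rewrite (@gcoordsE _ _ _ (dominating g J y)) //; last first.
  by move=> j jJ; rewrite actZ coefZ mulr_ge0 // wd.
by rewrite mulr_sumr; apply: eq_bigr => j _; rewrite actZ coefZ mulrCA.
Qed.

(** The positively homogeneous function that is 1 exactly on the real points of the image of [rho].
    Dividing a vector by its gauge inverts radial projection. *)
Definition gauge y : R := \sum_v gcoords 1%g full y v.

Lemma gauge_continuous : continuous gauge.
Proof.
apply: (@continuous_sumf R _ _ _ _ (fun v y => gcoords 1%g full y v)) => v _.
exact: gcoords_continuous.
Qed.

Lemma gaugeZ c y : 0 <= c -> gauge (c *: y) = c * gauge y.
Proof. by move=> c0; rewrite mulr_sumr; apply: eq_bigr => v _; rewrite gcoordsZ. Qed.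

Lemma gauge_gt0 y : y != 0 -> 0 < gauge y.
Proof.
move=> y0; rewrite lt_neqAle sumr_ge0 ?andbT => [|v _]; last exact: gcoords_ge0.
rewrite eq_sym; apply: contra_neq y0.
have [wg wd] := dominatingP full y (group1 W); rewrite /gauge gcoords_sum //.
have wW := coset_in (group1 W) wg.
move/eqP; rewrite psumr_eq0 => [/allP h|i /wd //].
apply: (act_inj (rW := rW) (groupVr wW)); apply: coef_inj => i.
have := h i (mem_index_enum _); rewrite inE /= => /eqP ->.
by rewrite -(scale0r y) actZ coefZ mul0r.
Qed.

Lemma simplex_gauge (s : {set gT}) (t : {set gT} -> R) : s \in Delta W r ->
  simplex W r s t -> gauge (bary t) = 1.
Proof. by move=> sD st; rewrite /gauge (simplex_gcoords sD st); case: st. Qed.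

Lemma simplex_bary_neq0 (s : {set gT}) (t : {set gT} -> R) : s \in Delta W r ->
  simplex W r s t -> bary t != 0.
Proof.
move=> sD /(simplex_gauge sD) g1; apply/eqP => b0; move: g1.
by rewrite b0 -(scale0r (0 : V)) gaugeZ // mul0r => /esym/eqP; rewrite oner_eq0.
Qed.

Lemma gauge_simplex y : y != 0 -> exists s t,
  [/\ s \in Delta W r, simplex (R := R) W r s t & bary t = (gauge y)^-1 *: y].
Proof.
move=> y0; have g0 := gauge_gt0 y0.
have [wg wd] := dominatingP full y (group1 W).
have wW := coset_in (group1 W) wg; set w := dominating _ _ _ in wg wd wW.
exists (w *: parab r finset.set0)%g, (fun v => (gauge y)^-1 * gcoords 1%g full y v).
split; first exact: coset_Delta.
  split=> [v||v].
  - by rewrite mulr_ge0 ?gcoords_ge0 // invr_ge0 ltW.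
  - by rewrite -mulr_sumr mulVf // gt_eqF.
  - rewrite verts_coset // finset.setC0 => vn.
    by rewrite (gcoords_support (group1 W) vn) mulr0.
transitivity ((gauge y)^-1 *: bary (gcoords 1%g full y)); last by rewrite bary_coords.
by rewrite /bary scaler_sumr; apply: eq_bigr => v _; rewrite scalerA.
Qed.

Lemma sphere_neq0 (y : V) : sphere y -> y != 0.
Proof.
move/sphereP => e1; apply/eqP => y0; move: e1.
by rewrite y0 -(scale0r (0 : V)) euclidZ // mul0r => /esym/eqP; rewrite oner_eq0.
Qed.

Lemma continuous_scale_inv (f : V -> R) x : continuous f -> f x != 0 ->
  {for x, continuous (fun y => (f y)^-1 *: y)}.
Proof.
move=> cf fx; apply: (@continuousZ R V V (fun y => (f y)^-1) id x); last exact: cvg_id.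
exact: (@continuousV R V f x fx (cf x)).
Qed.

Lemma radial_homeo : homeo_on (range (rho rWC (r := r) lamCx))
  (@complexify R l @` sphere (R := R) (l := l)) (@radial R l).
Proof.
have inR (z : 'cV[R[i]]_l) : range (rho rWC (r := r) lamCx) z ->
    exists2 x, z = complexify x & x != 0 /\ gauge x = 1.
  move/rho_range => [s [t [sD st ->]]]; exists (bary t) => //; split.
    exact: simplex_bary_neq0 sD st.
  exact: simplex_gauge sD st.
pose back (z : 'cV[R[i]]_l) := let x := realpart z in complexify ((gauge x)^-1 *: x).
have backK (z : 'cV[R[i]]_l) : range (rho rWC (r := r) lamCx) z -> back (radial z) = z.
  move=> /inR[x -> [x0 gx]]; have e0 := euclid_gt0 x0.
  rewrite radial_complexify /back complexifyK gaugeZ ?invr_ge0 ?ltW //.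
  by rewrite gx mulr1 invrK scalerA divff ?scale1r // gt_eqF.
split.
- split.
  + move=> z /inR[x -> [x0 _]]; rewrite radial_complexify.
    by eexists; last by []; exact: sphere_normalize.
  + move=> z z'; rewrite !inE => /backK zE /backK z'E e.
    by rewrite -zE -z'E e.
  + move=> _ [y sy <-]; have y0 := sphere_neq0 sy; have g0 := gauge_gt0 y0.
    have [s [t [sD st bE]]] := gauge_simplex y0.
    exists (complexify (bary t)); first by apply/rho_range; exists s, t.
    rewrite radial_complexify bE euclidZ ?invr_ge0 ?ltW // ((sphereP _).1 sy).
    by rewrite mulr1 invrK scalerA divff ?scale1r // gt_eqF.
(* On the range [radial] agrees with a formula in the real part alone, whose continuity follows from
   that of the norm away from 0. *)
- apply: (subspace_eq_continuous (f := fun z : 'cV[R[i]]_l =>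
      complexify ((euclid (realpart z))^-1 *: realpart z))).
    move=> z; rewrite inE => /inR[x -> _].
    by rewrite complexifyK /from_subspace /= radial_complexify.
  apply: continuous_in_subspaceT => z; rewrite inE => /inR[x -> [x0 _]].
  apply: (@lift_continuous R l (fun y => (euclid y)^-1 *: y)).
  rewrite complexifyK; apply: continuous_scale_inv; first exact: euclid_continuous.
  by rewrite gt_eqF // euclid_gt0.
- exists back; split; last exact: backK.
  apply: continuous_in_subspaceT => z; rewrite inE => -[y sy <-].
  apply: (@lift_continuous R l (fun y => (gauge y)^-1 *: y)).
  rewrite complexifyK; apply: continuous_scale_inv; first exact: gauge_continuous.
  by rewrite gt_eqF // gauge_gt0 // sphere_neq0.
Qed.

Lemma chamber_of_act g x y : g \in W ->
  chamber_of rW (act g x) (act g y) <-> chamber_of rW x y.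
Proof.
move=> gW; have aux u u' h : h \in W -> chamber_of rW u u' -> chamber_of rW (act h u) (act h u').
  move=> hW uu t tR; have [k k0 kE] := coroot_conj tR hW.
  have := uu _ (reflectionJ tR hW); rewrite !kE mulrACA pmulr_rge0 //.
  by rewrite -expr2 exprn_even_gt0.
split; last exact: aux.
by move/(aux _ _ _ (groupVr gW)); rewrite !actK.
Qed.

Lemma chamber_of_eq x y : arrangement_complement rW x -> arrangement_complement rW y ->
  chamber_of rW x y -> chamber_of rW x = chamber_of rW y.
Proof.
move=> /complementP xc /complementP yc xy; apply/seteqP; split => z h t tR.
  have p : 0 < coroot t x * coroot t y by rewrite lt_neqAle eq_sym mulf_neq0 ?xc ?yc //= xy.
  have x2 : 0 < coroot t x * coroot t x by rewrite -expr2 exprn_even_gt0 //= xc.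
  rewrite -(pmulr_rge0 _ x2) mulrACA mulr_ge0 //; [exact: xy | exact: h].
have x2 : 0 < coroot t y * coroot t y by rewrite -expr2 exprn_even_gt0 //= yc.
by rewrite -(pmulr_rge0 _ x2) mulrACA mulr_ge0 //; [rewrite mulrC; exact: xy | exact: h].
Qed.

(** The group is transitive on chambers: a base point of another chamber can be moved into [C] by
    [parab_dominant], and its chamber moves along with it. *)
Lemma weyl_chamber_translate C' : weyl_chamber rW C' <->
  exists2 g, g \in W & C' = [set x | C (act g^-1%g x)].
Proof.
have [x0 x0c CE] := (weyl_chamberE _ _).1 chamberC; split.
  move=> /weyl_chamberE[x1 x1c ->].
  have [g gP gd] := parab_dominant full x1; have gW := parab_in gP.
  exists g^-1%g; rewrite ?groupV // invgK.
  have Cg : chamber_of rW x0 (act g x1).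
    by rewrite -CE; apply/chamberP => i; rewrite gd ?inE.
  have gc : arrangement_complement rW (act g x1).
    apply/complementP => t tR; have [k k0 kE] := coroot_conj tR gW.
    have := (complementP _ _).1 x1c _ (reflectionJ tR gW).
    by rewrite kE mulf_eq0 negb_or => /andP[].
  by apply/seteqP; split => y; rewrite /= CE (chamber_of_eq x0c gc Cg) chamber_of_act.
move=> [g gW ->]; apply/weyl_chamberE; exists (act g x0).
  apply/complementP => t tR; have [k k0 kE] := coroot_conj tR gW.
  have := (complementP _ _).1 x0c _ (reflectionJ tR gW).
  by rewrite kE mulf_eq0 negb_or => /andP[].
apply/seteqP; split => y; rewrite /= CE.
  by rewrite -{2}(actKV rW y gW) chamber_of_act.
by rewrite -{1}(actKV rW y gW) chamber_of_act // actK.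
Qed.

(** The trace on the sphere of the cone over $gW_J$: a common normal form for projected faces and
    for cells of the Coxeter complex. *)
Definition face_cell g J : set V := [set x |
  [/\ sphere x, forall i, 0 <= coef i (act g^-1%g x) &
      forall i, i \in J -> coef i (act g^-1%g x) = 0]].

Lemma radial_face g J : g \in W ->
  (@radial R l) @` rho_face rWC r lamCx (g *: parab r J)%g = (@complexify R l) @` face_cell g J.
Proof.
move=> gW; have gD := coset_Delta J gW.
apply/seteqP; split => [_ [_ [t st <-] <-]|_ [x [sx xp xJ] <-]].
  have b0 := simplex_bary_neq0 gD st; have e0 := euclid_gt0 b0.
  rewrite barycenterE radial_complexify; eexists; last by [].
  have bE := bary_support gW (simplex_support gW erefl st).
  have cE i : coef i (act g^-1%g (bary t)) = if i \in J then 0 else t (vertex g i).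
    rewrite bE actK // coef_sum; case: ifPn => iJ.
      by rewrite big1 // => j; rewrite inE => jJ; rewrite coefZ coef_lam; case: eqVneq jJ => [<-|_ _]; rewrite ?iJ ?mulr0.
    rewrite (bigD1 i) ?inE //= coefZ coef_lam eqxx mulr1 big1 ?addr0 // => j /andP[_ ji].
    by rewrite coefZ coef_lam eq_sym (negbTE ji) mulr0.
  split; first exact: sphere_normalize.
    move=> i; rewrite actZ coefZ mulr_ge0 ?invr_ge0 ?(ltW e0) // cE.
    by case: ifP => // _; case: st.
  by move=> i iJ; rewrite actZ coefZ cE iJ mulr0.
have x0 := sphere_neq0 sx; have g0 := gauge_gt0 x0.
pose t (v : {set gT}) : R := \sum_(i in (~: J)%SET) (v == vertex g i)%:R * coef i (act g^-1%g x).
have tv i : i \notin J -> t (vertex g i) = coef i (act g^-1%g x).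
  move=> iJ; rewrite /t (bigD1 i) ?inE //= eqxx mul1r big1 ?addr0 // => j /andP[_ ji].
  by rewrite (inj_eq (vertex_inj gW)) eq_sym (negbTE ji) mul0r.
have tn v : v \notin [set vertex g i | i in (~: J)%SET]%SET -> t v = 0.
  move=> nv; rewrite /t big1 // => j jJ; case: eqVneq => [e|_]; last by rewrite mul0r.
  by move: nv; rewrite e imset_f.
have t0 v : 0 <= t v by apply: sumr_ge0 => i _; rewrite mulr_ge0.
have bt : bary t = x.
  rewrite (bary_support gW tn) -[RHS](actKV rW x gW); congr (act g _).
  rewrite [RHS]lam_expansion [in RHS](bigID (mem J)) /= [X in _ = X + _]big1 ?add0r => [|i iJ]; last first.
    by rewrite xJ // scale0r.
  by apply: eq_big => [i|i]; rewrite ?inE // => iJ; rewrite tv.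
have gcE : gauge x = \sum_v t v.
  rewrite -bt; apply: eq_bigr => v _; rewrite (@gcoords_bary _ _ g) ?group1 //.
    by rewrite mem_lcoset invg1 mul1g parab_setT.
  by move=> u un; apply: tn; apply: contra un => /imsetP[i _ ->]; rewrite imset_f ?inE.
exists (complexify ((gauge x)^-1 *: x)).
  exists (fun v => (gauge x)^-1 * t v).
    split=> [v||v].
    - by rewrite mulr_ge0 // invr_ge0 ltW.
    - by rewrite -mulr_sumr -gcE mulVf // gt_eqF.
    - by rewrite verts_coset // => /tn ->; rewrite mulr0.
  rewrite barycenterE; congr complexify.
  transitivity ((gauge x)^-1 *: bary t); last by rewrite bt.
  by rewrite /bary scaler_sumr; apply: eq_bigr => v _; rewrite scalerA.
rewrite radial_complexify euclidZ ?invr_ge0 ?(ltW g0) // ((sphereP _).1 sx).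
by rewrite mulr1 invrK scalerA divff ?scale1r // gt_eqF.
Qed.

(** A lattice element meets the chamber $gC$ in the face spanned by the rays it contains. Indeed, if
    a reflection fixes a point of $gC$, its conjugate by [g] lies in the parabolic subgroup of that
    point's zero coordinates, so it fixes every ray on which the point has a nonzero coordinate. *)
Lemma coxeter_cellsP (c : set V) : coxeter_cells rW c <->
  exists g J, g \in W /\ c = face_cell g J.
Proof.
split=> [[C' [X [/weyl_chamber_translate[g gW ->] [A AR ->] ->]]]|[g [J [gW ->]]]].
  pose Y := (\bigcap_(t in A) fixv (rW t))%VS.
  exists g, [set i | act g (lam i) \notin Y]%SET; split=> //.
  have XP y : y \in Y <-> forall t, t \in A -> act t y = y.
    rewrite /Y; split=> [/subv_bigcapP h t tA|h].
      by apply/fixvP; exact: (h t tA).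
    by apply/subv_bigcapP => t tA; apply/fixvP; exact: h.
  apply/seteqP; split => x.
    move=> [[/= Cx xX] sx]; split=> //; first by apply/chamberP.
    move=> i; rewrite inE => iX; apply: contraNeq iX => ci; apply/XP => t tA.
    have tR := fintype.subsetP AR t tA; have tW := reflection_in tR.
    have tgW : (t ^ g)%g \in W by rewrite groupJ.
    have tg y : act (t ^ g)%g y = act g^-1%g (act t (act g y)).
      by rewrite conjgE actM ?groupM ?groupV // actM.
    have tx : act (t ^ g)%g (act g^-1%g x) = act g^-1%g x.
      by rewrite tg actKV // ((XP x).1 xX).
    have [|_] := chamber_fundamental tgW Cx; first by rewrite tx.
    move/parab_lam => /(_ i); rewrite inE => /(_ ci).
    by rewrite tg => /(congr1 (act g)); rewrite actKV.
  move=> [sx xp xJ]; split=> //; split; first exact/chamberP.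
  apply/XP => t tA.
  rewrite -(actKV rW x gW) [act g^-1%g x]lam_expansion !act_sum; apply: eq_bigr => i _.
  rewrite !actZ; have [iX|iX] := boolP (act g (lam i) \in Y).
    by rewrite ((XP _).1 iX).
  by rewrite xJ ?inE // !scale0r.
exists [set x | C (act g^-1%g x)], (\bigcap_(t in [set (r j ^ g^-1)%g | j in J]%SET) fixv (rW t))%VS.
split.
- by apply/weyl_chamber_translate; exists g.
- eexists; last by [].
  by apply/fintype.subsetP => _ /imsetP[j _ ->]; rewrite reflectionJ ?groupV.
- have fixE j x : (x \in fixv (rW (r j ^ g^-1)%g)) = (coef j (act g^-1%g x) == 0).
    rewrite coef_eq0; have -> : (x \in fixv (rW (r j ^ g^-1)%g)) = (act (r j ^ g^-1)%g x == x).
      by apply/fixvP/eqP.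
    rewrite conjgE invgK actM ?groupM ?groupV ?r_in // actM ?groupV ?r_in //.
    by apply/eqP/eqP => [e|->]; [rewrite -{2}e actK | rewrite actKV].
  apply/seteqP; split => x.
    move=> [sx xp xJ]; split=> //; split; first exact/chamberP.
    apply/subv_bigcapP => _ /imsetP[j jJ ->]; rewrite -memvE fixE.
    by rewrite xJ.
  move=> [[/= Cx /subv_bigcapP xX] sx]; split=> //; first exact/chamberP.
  move=> i iJ; apply/eqP; rewrite -fixE; apply: xX; exact: imset_f.
Qed.

Lemma radial_coxeter : radially_coxeter_complex rW r lam.
Proof.
split; first exact: radial_homeo.
apply/seteqP; split => [_ [s /DeltaP[g [J [gW ->]]] <-]|_ [_ /coxeter_cellsP[g [J [gW ->]]] <-]].
  exists (face_cell g J); first by apply/coxeter_cellsP; exists g, J.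
  exact/esym/radial_face.
exists (g *: parab r J)%g; first exact: coset_Delta.
exact: radial_face.
Qed.

(** * Stratification *)

Lemma fixvCP g (z : 'cV[R[i]]_l) : z \in fixv (rWC g) <-> realpart z \in fixv (rW g) /\ impart z \in fixv (rW g).
Proof. exact: fixv_complexify. Qed.

Lemma reflections_complex : reflections rWC = reflections rW.
Proof.
apply/finset.setP => t; rewrite !inE; congr (_ && (_.+1 == _)).
by apply: dim_complexified => z; exact: fixvCP.
Qed.

Lemma dim_zero_coefs g J (X : {vspace V}) : g \in W ->
  (forall y, y \in X <-> forall j, j \in J -> coef j (act g y) = 0) ->
  \dim X = #|(~: J)%SET|.
Proof.
move=> gW XP; pose n := #|(~: J)%SET|.
pose B : n.-tuple V := [tuple act g^-1%g (lam (enum_val i)) | i < n].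
have Bi (i : 'I_n) : B`_i = act g^-1%g (lam (enum_val i)).
  by rewrite -tnth_nth tnth_mktuple.
have fB : free B.
  apply/freeP => k k0 i; have := congr1 (fun x => coef (enum_val i) (act g x)) k0.
  rewrite act_sum coef_sum (bigD1 i) //= Bi actZ coefZ actKV // coef_lam eqxx mulr1.
  rewrite big1 ?addr0 => [->|j ji]; first by rewrite -(scale0r (0 : V)) actZ coefZ mul0r.
  rewrite Bi actZ coefZ actKV // coef_lam (inj_eq enum_val_inj) eq_sym (negbTE ji).
  by rewrite mulr0.
suff -> : X = <<B>>%VS by move/eqP: fB; rewrite size_tuple.
apply/vspaceP => y; apply/idP/idP => [/XP yX|].
  rewrite -(actK rW y gW) [act g y]lam_expansion act_sum memv_suml // => i _.
  rewrite actZ; have [iJ|iJ] := boolP (i \in J); first by rewrite yX // scale0r mem0v.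
  have iJ' : i \in (~: J)%SET by rewrite inE.
  apply: memvZ; rewrite -(enum_rankK_in iJ' iJ') -Bi.
  by apply: memv_span; rewrite mem_nth // size_tuple.
suff : (<<B>> <= X)%VS by move/subvP; apply.
apply/span_subvP => _ /mapP[i _ ->]; apply/XP => j jJ.
rewrite actKV // coef_lam; case: eqVneq => // ji.
by have := enum_valP i; rewrite inE -ji jJ.
Qed.

Lemma rho_face_sub h K (X : {vspace 'cV[R[i]]_l}) : h \in W ->
  (rho_face rWC r lamCx (h *: parab r (~: K)%SET)%g `<=` [set z | z \in X]) <->
  (forall k, k \in K -> complexify (act h (lam k)) \in X).
Proof.
move=> hW; split=> [sub k kK|hK _ [t st <-]].
  apply: sub; exists (fun v => (v == vertex h k)%:R).
    split=> [v||v]; first exact: ler0n.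
      by rewrite (bigD1 (vertex h k)) //= eqxx big1 ?addr0 // => v /negbTE ->.
    rewrite verts_coset // finset.setCK; case: eqVneq => // -> /negP[].
    exact: imset_f.
  rewrite barycenterE; congr complexify; rewrite /bary (bigD1 (vertex h k)) //= eqxx.
  rewrite scale1r rvert_vertex // big1 ?addr0 // => v /negbTE ->.
  by rewrite scale0r.
rewrite /= barycenterE.
rewrite (@bary_support h K) //; last first.
  by move=> v vn; apply: (simplex_support hW erefl st); rewrite finset.setCK.
rewrite act_sum complexify_sum memv_suml // => k kK.
by rewrite actZ complexifyZ memvZ // hK.
Qed.

Lemma coef_act_fix g j x : g \in W ->
  (x \in fixv (rW (r j ^ g)%g)) = (coef j (act g x) == 0).
Proof.
move=> gW; rewrite coef_eq0.
have -> : (x \in fixv (rW (r j ^ g)%g)) = (act (r j ^ g)%g x == x) by apply/fixvP/eqP.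
rewrite conjgE actM ?groupM ?groupV ?r_in // actM ?r_in //.
by apply/eqP/eqP => [e|->]; [rewrite -{2}e actKV | rewrite actK].
Qed.

(** Move a generic real point [x] of [X] into [C] by [g] and let [J] index the walls through the
    image. By genericity each of these walls contains the image of [X]. Conversely, reflections
    fixing [X] are conjugated by [g] into $W_J$, which fixes every vector with vanishing coordinates
    in [J]. So [X] is defined by these coordinates. *)
Lemma lattice_face X : in_lattice rWC X -> exists s : {set gT},
  [/\ s \in Delta W r, rho_face rWC r lamCx s `<=` [set z | z \in X] &
      fdim W r s = (\dim X)%:Z - 1].
Proof.
move=> [A]; rewrite reflections_complex => AR ->.
pose U := (\bigcap_(t in A) fixv (rW t))%VS.
set Y := (\bigcap_(t in A) _)%VS.
have UP y : y \in U <-> forall t, t \in A -> act t y = y.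
  rewrite /U; split=> [/subv_bigcapP h t tA|h].
    by apply/fixvP; exact: (h t tA).
  by apply/subv_bigcapP => t tA; apply/fixvP; exact: h.
have YP (z : 'cV[R[i]]_l) : z \in Y <-> realpart z \in U /\ impart z \in U.
  rewrite /Y !UP; split=> [/subv_bigcapP h|[h1 h2]].
    by split=> t tA; have /fixvCP[/fixvP ? /fixvP ?] : z \in fixv (rWC t) by exact: (h t tA).
  by apply/subv_bigcapP => t tA; apply/fixvCP; split; apply/fixvP; [exact: h1 | exact: h2].
have [x xU xg] := generic_vector U [seq fixv (rW u) | u in reflections rW].
have [g gP gd] := parab_dominant full x; have gW := parab_in gP.
have Cx : C (act g x) by apply/chamberP => i; rewrite gd ?inE.
pose J := zeros (act g x).
have UJ y : y \in U <-> forall j, j \in J -> coef j (act g y) = 0.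
  split=> [yU j|yJ].
    rewrite inE => xj; apply/eqP; rewrite -coef_act_fix //.
    suff /subvP : (U <= fixv (rW (r j ^ g)%g))%VS by apply.
    apply: xg; last by rewrite coef_act_fix.
    by apply: (fintype.image_f (fun u => fixv (rW u))); exact: reflectionJ.
  apply/UP => t tA; have tW := reflection_in (fintype.subsetP AR t tA).
  have gV := groupVr gW.
  have tgW : (t ^ g^-1)%g \in W by rewrite groupJ.
  have tg u : act (t ^ g^-1)%g (act g u) = act g (act t u).
    by rewrite conjgE invgK actM ?groupM // actM // actK.
  have [|_ tJ] := chamber_fundamental tgW Cx; first by rewrite tg ((UP x).1 xU t tA).
  by rewrite -(actK rW (act t y) gW) -tg (parab_fix yJ tJ) actK.
exists (g^-1 *: parab r J)%g; split.
- by apply: coset_Delta; rewrite groupV.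
- rewrite -[J]finset.setCK rho_face_sub ?groupV // => k; rewrite inE => kJ.
  apply/YP; rewrite complexifyK impart_complexify mem0v; split=> //.
  apply/UJ => j jJ; rewrite actKV // coef_lam; case: eqVneq => // jk.
  by rewrite -jk jJ in kJ.
- rewrite /fdim card_verts_coset ?groupV // (dim_complexified YP).
  by rewrite (dim_zero_coefs gW UJ).
Qed.

Lemma coxeter_strongly_stratified : strongly_stratified rWC r lamCx.
Proof. by split; [exact: rho_embedding | exact: lattice_face]. Qed.

(** * Local conicality *)

Section Conical.
Hypothesis irreducibleW : irreducible_action rW.

(** Without such an edge the span of the [lam i] with [i] in [S] is invariant: [r i] subtracts a
    multiple of [svec i], which lies in the span when [i] is in [S], and acts trivially on the span
    otherwise. *)
Lemma irreducible_edge (S : {set 'I_l}) : S != finset.set0 -> S != full ->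
  exists j k, [/\ j \in S, k \notin S & coef k (svec j) != 0].
Proof.
move=> S0 SF; apply: contrapT => nE.
have E j k : j \in S -> k \notin S -> coef k (svec j) = 0.
  by move=> jS kS; apply: contrapT => /eqP jk; apply: nE; exists j, k.
pose T := (\sum_(i in S) <[lam i]>)%VS.
have TP x : x \in T <-> forall k, k \notin S -> coef k x = 0.
  split=> [/memv_sumP[v vl ->] k kS|h].
    rewrite coef_sum big1 // => i iS; have /vlineP[c ->] := vl i iS.
    by rewrite coefZ coef_lam; case: eqVneq kS => [->|_ _]; rewrite ?iS ?mulr0.
  rewrite [x]lam_expansion (bigID (mem S)) /= [X in _ + X]big1 ?addr0 => [|i iS]; last first.
    by rewrite h // scale0r.
  by apply: memv_sumr => i iS; rewrite memvZ // memv_line.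
have TW g x : g \in W -> x \in T -> rW g *m x \in T.
  rewrite -{1}parab_setT => gP xT; rewrite -/(act g x); move: g gP.
  apply: (@parab_ind _ (fun g => act g x \in T)); first by rewrite act1.
  move=> i g _ gW gT'; rewrite actM ?r_in //; apply/TP => k kS.
  rewrite coef_act_r; have [iS|iS] := boolP (i \in S).
    by rewrite E // mulr0 subr0; exact: (TP _).1 gT' k kS.
  by rewrite !((TP _).1 gT') // mul0r subr0.
have [T0|TF] := irreducibleW.2 T TW.
  have [i iS] := set0Pn _ S0; have : lam i \in T.
    by apply/TP => k kS; rewrite coef_lam; case: eqVneq kS => // ->; rewrite iS.
  rewrite T0 memv0 => /eqP li0; have := coef_lam i i.
  by rewrite li0 -(scale0r (0 : V)) coefZ mul0r eqxx => /esym/eqP; rewrite oner_eq0.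
have [k kS] : exists k, k \notin S.
  apply: contrapT => nk; move/negP: SF; apply; apply/eqP/finset.setP => k.
  by rewrite inE; apply: contrapT => /negP kS; apply: nk; exists k.
have : lam k \in T by rewrite TF memvf.
by move/TP => /(_ k kS)/eqP; rewrite coef_lam eqxx oner_eq0.
Qed.

Lemma coef_act_ge0 g m x : g \in W -> C x ->
  (exists j, 0 < coef m (act g (lam j))) -> 0 <= coef m (act g x).
Proof.
move=> gW Cx [j pj]; have [pos|neg] := coef_side m gW; last by have := neg j; rewrite leNgt pj.
rewrite [x]lam_expansion act_sum coef_sum sumr_ge0 // => i _.
by rewrite actZ coefZ mulr_ge0 //; exact: (chamberP _).1 Cx i.
Qed.

(* The coefficients [coef m (act u (lam j))] are those of the root [coef m \o act u] on
   the simple roots; a root involving [k] is moved by the parabolic subgroup of [~: K]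
   along a path of the Dynkin diagram until it involves some [i] in [U]. *)
Lemma linking_vertex (U K : {set 'I_l}) : U != finset.set0 -> K != finset.set0 ->
  [disjoint U & K]%B -> exists2 k, k \in K & forall m u, u \in W ->
    0 < coef m (act u (lam k)) ->
    exists w i, [/\ w \in parab r (~: K)%SET, i \in U & 0 < coef m (act u (act w (lam i)))].
Proof.
move=> U0 K0 UK.
pose P (j : 'I_l) := forall m u, u \in W -> 0 < coef m (act u (lam j)) ->
    exists w i, [/\ w \in parab r (~: K)%SET, i \in U & 0 < coef m (act u (act w (lam i)))].
pose S := [set j in (~: K)%SET | `[< P j >]]%SET.
have US : U \subset S.
  apply/fintype.subsetP => i iU; rewrite !inE (disjointFr UK iU) /=; apply/asboolP => m u uW pi.
  by exists 1%g, i; split=> //; rewrite act1.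
have S0 : S != finset.set0.
  have [i iU] := set0Pn _ U0; apply/set0Pn; exists i; exact: (fintype.subsetP US).
have SF : S != full.
  have [k kK] := set0Pn _ K0; apply/eqP => /finset.setP/(_ k).
  by rewrite !inE kK.
(* An edge leaves [S] from [j] to [k]. The property [P] passes along it, so [k], not being in [S],
   can only lie in [K]. *)
have [j [k [jS kS jk]]] := irreducible_edge S0 SF.
have jK : j \in (~: K)%SET by move: jS; rewrite inE => /andP[].
have Pj : P j by move: jS; rewrite inE => /andP[_ /asboolP].
have kj : k != j by apply: contraNneq kS => ->.
have Pk : P k.
  move=> m u uW pk; have [pos|neg] := coef_side m uW; last by have := neg k; rewrite leNgt pk.
  have [/Pj|pj] := ltP 0 (coef m (act u (lam j))); first exact.
  have j0 : coef m (act u (lam j)) = 0 by apply/le_anti; rewrite pj pos.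
  have urW : (u * r j)%g \in W by rewrite groupM ?r_in.
  have [|w [i [wK iU pw]]] := Pj m (u * r j)%g urW.
    (* The new value at [lam j] is minus the sum of [coef i (svec j) * coef m (act u (lam i))]. The
       term of [k] is negative, that of [j] is zero by [j0], and the others are at most zero. *)
    rewrite actM ?r_in // act_r coef_lam eqxx scale1r actB coefD coefN j0 sub0r oppr_gt0.
    rewrite [svec j]lam_expansion act_sum coef_sum (bigD1 k) //= actZ coefZ.
    have lt0 : coef k (svec j) * coef m (act u (lam k)) < 0.
      by rewrite nmulr_rlt0 // lt_neqAle jk svec_le0.
    rewrite -[ltRHS]addr0 ltr_leD // sumr_le0 // => i _; rewrite actZ coefZ.
    have [->|ij] := eqVneq i j; first by rewrite j0 mulr0.
    by rewrite mulr_le0_ge0 // svec_le0.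
  exists (r j * w)%g, i; split=> //.
    by rewrite groupM // parab_mem.
  by move: pw; rewrite !actM ?r_in // (parab_in wK).
exists k => //; apply: contraNT kS => kK; rewrite !inE kK; exact/asboolP.
Qed.

Lemma starP (U : {set 'I_l}) (s : {set gT}) : reflect
  (exists h K, h \in parab r (~: U)%SET /\ s = (h *: parab r (~: K)%SET)%g)
  (s \in star W r U).
Proof.
rewrite inE; apply: (iffP andP) => [[/DeltaP[g [J [gW ->]]] /exists_inP[_ /DeltaP[h [M [hW ->]]] /andP[hs hU]]]|].
  have hh : h \in (h *: parab r M)%g by exact: lcoset_refl.
  exists h, (~: J)%SET; rewrite finset.setCK; split; first exact: (fintype.subsetP hU).
  apply/eqP; rewrite eq_sym; apply/eqP/lcoset_eqP; exact: (fintype.subsetP hs).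
move=> [h [K [hU ->]]]; have hW := parab_in hU; split; first exact: coset_Delta.
apply/exists_inP; exists (h *: parab r finset.set0)%g; first exact: coset_Delta.
rewrite coset_subset // mulVg group1 finset.sub0set /=.
apply/fintype.subsetP => k; rewrite mem_lcoset => /(fintype.subsetP (parabS (finset.sub0set _))) hk.
by rewrite -(mulKVg h k); exact: groupM hU (hk _).
Qed.

Lemma coxeter_locally_conical : locally_conical rWC r lamCx.
Proof.
split; first exact: rho_embedding.
move=> U X U0 [s /starP[h [K [hU ->]]] [Xs Xmin]] X0.
have hW := parab_in hU.
have XK := (rho_face_sub K X hW).1 Xs.
have XR x j : complexify x \in X -> j \notin K -> coef j (act h^-1%g x) = 0.
  move=> xX jK; have : (X <= fixv (rWC (r j ^ h^-1)%g))%VS.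
    apply: Xmin; apply/(rho_face_sub _ _ hW) => k kK.
    apply/fixvCP; rewrite complexifyK impart_complexify mem0v; split=> //.
    by rewrite coef_act_fix ?groupV // actK // coef_lam; case: (eqVneq j k) jK => [->|_ _]; rewrite ?kK ?eqxx.
  move/subvP => /(_ _ xX)/fixvCP[]; rewrite complexifyK coef_act_fix ?groupV //.
  by move/eqP.
have K0 : K != finset.set0.
  apply/eqP => K0; apply: X0; apply/eqP; rewrite -subv0; apply: Xmin.
  by apply/(rho_face_sub _ _ hW) => k; rewrite K0 inE.
have star_face g M : g \in parab r (~: U)%SET -> (g *: parab r (~: M)%SET)%g \in star W r U.
  by move=> gU; apply/starP; exists g, M.
(* For each face $gW_{R\setminus M}$ of the subcomplex, [u] is a chamber of the star having both
   this face and the cone vertex $h\lambda_k$ in its closure. *)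
have key : exists2 k, k \in K & forall g (M : {set 'I_l}), g \in parab r (~: U)%SET ->
    (forall m, m \in M -> complexify (act g (lam m)) \in X) ->
    exists2 u, u \in parab r (~: U)%SET & act u (lam k) = act h (lam k) /\
      forall m, m \in M -> act u (lam m) = act g (lam m).
  have [UK|UK] := boolP [disjoint U & K]%B; last first.
    (* An index common to [U] and [K] gives a vertex fixed by the whole parabolic subgroup
       [parab r (~: U)], so [u = g] works. *)
    have /pred0Pn[i /= /andP[iU iK]] : ~~ [disjoint U & K]%B := UK.
    exists i => // g M gU _; exists g => //; split=> //.
    by rewrite !(@parab_lam (~: U)%SET) // inE negbK.
  have [k kK kP] := linking_vertex U0 K0 UK; exists k => // g M gU MX.
  have gW := parab_in gU.
  have kU : k \notin U by rewrite (disjointFl UK kK).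
  (* A relative interior point of the face, translated so that the cone over the face spanning [X]
     becomes that of the [lam k] with [k] in [K]. *)
  pose y := act h^-1%g (act g (weight M)).
  have yK j : j \notin K -> coef j y = 0.
    by apply: XR; rewrite /weight act_sum complexify_sum memv_suml // => m mM; rewrite MX.
  (* [g0] fixes [lam k] and all the [lam i] with [i] in [U], at the price of leaving the coordinates
     at [k] and in [U] uncontrolled. Their signs are obtained from the dichotomy. *)
  have [g0 g0P g0d] := parab_dominant (~: (k |: U))%SET y.
  have g0W := parab_in g0P; have hV := groupVr hW.
  have g0U : g0 \in parab r (~: U)%SET.
    by apply: (fintype.subsetP (parabS _)) g0P; rewrite finset.setCS finset.subsetUr.
  have CM := weight_chamber M.
  have fixU a i : a \in parab r (~: U)%SET -> i \in U -> act a (lam i) = lam i.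
    by move=> aU iU; apply: parab_lam aU _; rewrite inE negbK.
  have hgU : (h^-1 * g)%g \in parab r (~: U)%SET by rewrite groupM ?groupV.
  have yE : y = act (h^-1 * g)%g (weight M) by rewrite actM.
  have Cy : C (act g0 y).
    apply/chamberP => j; have [jJ|] := boolP (j \in (~: (k |: U))%SET); first exact: g0d.
    rewrite !inE negbK => /orP[/eqP ->|jU].
      have g0k : act g0 (lam k) = lam k by apply: parab_lam g0P _; rewrite !inE eqxx.
      (* [y] is fixed by [w], and $\lambda_i$ by $h^{-1}g$. So the coordinate at [k] is the value at
         [weight M] of a functional that is positive at [lam i], hence nonnegative on [C]. *)
      have [|w [i [wK iU wi]]] := kP k g0 g0W; first by rewrite g0k coef_lam eqxx ltr01.
      have wW := parab_in wK.
      have wy : act w y = y by apply: parab_fix wK => j'; rewrite inE; exact: yK.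
      rewrite -wy yE -!actM ?groupM //; apply: coef_act_ge0; rewrite ?groupM //.
      by exists i; rewrite !actM ?groupM // -[act h^-1%g _]actM // fixU.
    rewrite yE -actM ?groupM //; apply: coef_act_ge0; rewrite ?groupM //.
    have e : act (g0 * (h^-1 * g))%g (lam j) = lam j by apply: fixU => //; exact: groupM.
    by exists j; rewrite e coef_lam eqxx ltr01.
  have aW : (g0 * (h^-1 * g))%g \in W by rewrite !groupM.
  (* The product $g_0h^{-1}g$ maps [weight M] into [C], so it fixes each [lam m] with [m] in [M].
     Therefore $u = hg_0^{-1}$ agrees with [g] on [M], and with [h] at [k]. *)
  have [|_] := chamber_fundamental aW CM; first by rewrite actM ?groupM // -yE.
  rewrite zeros_weight => aM.
  exists (h * g0^-1)%g; first by rewrite groupM ?groupV.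
  have g0V := groupVr g0W.
  split.
    rewrite actM //; congr (act h _); apply: (@parab_lam (~: (k |: U))%SET).
      by rewrite groupV.
    by rewrite !inE eqxx.
  move=> m mM; have := parab_lam aM (_ : m \notin _); rewrite inE negbK => /(_ mM) e.
  by rewrite actM // -{1}e !actM ?groupM // actK // actKV.
have [k kK kP] := key.
exists (vertex h k); split.
- by apply/verticesP; exists h, k.
- split; first exact: star_face.
  by apply/(rho_face_sub _ _ hW) => i; rewrite inE => /eqP ->; exact: XK.
move=> _ [/starP[g [M [gU ->]]] gX].
have gW := parab_in gU; have MX := (rho_face_sub M X gW).1 gX.
have [u uU [uk um]] := kP g M gU MX; have uW := parab_in uU.
exists (u *: parab r (~: (k |: M))%SET)%g; split.
- split; first exact: star_face.
  apply/(rho_face_sub _ _ uW) => i; rewrite !inE => /predU1P[->|iM].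
    by rewrite uk; exact: XK.
  by rewrite um //; exact: MX.
- rewrite coset_subset //; apply/andP; split; last by rewrite finset.setCS finset.subsetUr.
  apply: parab_memC; first by rewrite groupM ?groupV.
  by move=> m mM; rewrite actM ?groupV // um // actK.
- by rewrite coset_sub_vertex // uk eqxx !inE eqxx.
Qed.

End Conical.

(** * Homotopy of links *)

(** A chamber [h] of the simplex joining [f] to the given face agrees with [g] on the [lam i] with
    [i] in [I], so it lies in the coset $gW_{R\setminus I}$; disjointness then keeps the indices of
    [f] outside [I]. *)
Lemma linkP g I (f : {set {set gT}}) : g \in W -> reflect
  (exists w (M : {set 'I_l}), [/\ w \in (g *: parab r (~: I)%SET)%g, M \subset (~: I)%SET &
     f = [set vertex w i | i in M]%SET])
  (f \in link (face_complex W r) [set vertex g i | i in I]%SET).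
Proof.
move=> gW; set s := [set vertex g i | i in I]%SET; rewrite inE; apply: (iffP and3P).
  move=> [_ fs /face_complexP[h [I' [hW fsE]]]].
  have sI i : i \in I -> i \in I' /\ act g (lam i) = act h (lam i).
    move=> iI; have : vertex g i \in (f :|: s)%SET by rewrite inE imset_f ?orbT.
    by rewrite fsE => /imsetP[i' iI' /(vertex_eq gW hW)[-> e]].
  exists h, [set i in I' | vertex h i \in f]%SET; split.
  - rewrite mem_lcoset; apply: parab_memC; first by rewrite groupM ?groupV.
    by move=> i /sI[_ e]; rewrite actM ?groupV // -e actK.
  - apply/fintype.subsetP => i; rewrite !inE => /andP[_ hf]; apply/negP => iI.
    have [_ e] := sI i iI; have vs : vertex h i \in s.
      by rewrite -(eq_vertex gW hW e) imset_f.
    by rewrite (disjointFr fs hf) in vs.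
  - apply/finset.setP => v; apply/idP/imsetP => [vf|[ i ]]; last first.
      by rewrite inE => /andP[_ ?] ->.
    have : v \in (f :|: s)%SET by rewrite inE vf.
    by rewrite fsE => /imsetP[i iI' ve]; exists i => //; rewrite inE iI' -ve.
move=> [w [M [wg MI ->]]]; have wW := coset_in gW wg.
have wI i : i \in I -> vertex g i = vertex w i.
  move=> iI; apply: eq_vertex => //.
  have /parab_lam/(_ (_ : i \notin _)) : (g^-1 * w)%g \in parab r (~: I)%SET by rewrite -mem_lcoset.
  rewrite inE iI => /(_ isT) /(congr1 (act g)).
  by rewrite actM ?groupV // actKV.
split.
- by apply/face_complexP; exists w, M.
- apply/pred0P => v /=; apply/negP => /andP[/imsetP[i iM ->] /imsetP[j jI]].
  move/(vertex_eq wW gW) => [ij _]; have := fintype.subsetP MI i iM.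
  by rewrite inE ij jI.
- apply/face_complexP; exists w, (M :|: I)%SET; split=> //.
  rewrite imsetU; congr (_ :|: _)%SET; apply: eq_in_imset => i; exact: wI.
Qed.

Lemma dimc_link g I : g \in W ->
  dimc (link (face_complex W r) [set vertex g i | i in I]%SET) <= #|(~: I)%SET|%:Z - 1.
Proof.
move=> gW; rewrite /dimc lerD2r lez_nat; apply/bigmax_leqP => f /(linkP I f gW).
move=> [w [M [wg MI ->]]]; rewrite card_imset; first exact: subset_leq_card.
exact: vertex_inj (coset_in gW wg).
Qed.

(* The link of the face [g W_(R - I)] is the Coxeter complex of [W_(~: I)], hence a retract
   of the punctured space spanned by the [lam j], [j] outside [I]. *)
Lemma link_pi_trivial g I (n : nat) : g \in W -> (n.+2 <= #|(~: I)%SET|)%N ->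
  pi_trivial R n (realization (R := R)
    (link (face_complex W r) [set vertex g i | i in I]%SET)).
Proof.
move=> gW; set J := (~: I)%SET => nJ.
have [m Jm] : exists m, #|J| = m.+1 by exists #|J|.-1; rewrite prednK // (leq_trans _ nJ).
have nm : (n < m)%N by rewrite Jm in nJ.
have [j0 j0J] : exists j0, j0 \in J by apply/card_gt0P; rewrite Jm.
pose f (i : 'I_m.+1) : 'I_l := nth j0 (enum J) i.
have szJ : size (enum J) = m.+1 by rewrite -cardE.
have fJ (i : 'I_m.+1) : f i \in J by rewrite -mem_enum mem_nth // szJ.
have f_inj : injective f.
  by move=> i i' /eqP; rewrite nth_uniq ?enum_uniq ?szJ // => /eqP/val_inj.
have f_surj j : j \in J -> exists i : 'I_m.+1, f i = j.
  move=> jJ; have ij : (index j (enum J) < m.+1)%N by rewrite -szJ index_mem mem_enum.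
  by exists (Ordinal ij); rewrite /f nth_index // mem_enum.
pose lift (e : 'rV[R]_m.+1) : V := act g (\sum_(i < m.+1) e 0 i *: lam (f i)).
have coef_lift e (i : 'I_m.+1) : coef (f i) (act g^-1%g (lift e)) = e 0 i.
  rewrite actK // coef_sum (bigD1 i) //= coefZ coef_lam eqxx mulr1.
  rewrite big1 ?addr0 // => i' i'i.
  by rewrite coefZ coef_lam (inj_eq f_inj) eq_sym (negbTE i'i) mulr0.
pose total (y : V) : R := \sum_u gcoords g J y u.
(* [phi] projects away the coordinates in [I], and [psi] rescales the fan coordinates to sum 1,
   which requires a nonzero vector. *)
pose phi (t : {ptws {set gT} -> R}) : 'rV[R]_m.+1 :=
  \row_i coef (f i) (act g^-1%g (bary t)).
pose psi (e : 'rV[R]_m.+1) : {ptws {set gT} -> R} :=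
  fun v => (total (lift e))^-1 * gcoords g J (lift e) v.
have lift_continuous : continuous lift.
  apply: mx_continuous => a b.
  rewrite (_ : (fun e => lift e a b) = fun e : 'rV[R]_m.+1 =>
      \sum_(i < m.+1) e 0 i * act g (lam (f i)) a b); last first.
    apply/funext => e; rewrite /lift act_sum summxE; apply: eq_bigr => i _.
    by rewrite actZ; move: (act g _) => x; rewrite mxE.
  apply: (@continuous_sumf R _ _ _ _ (fun (i : 'I_m.+1) (e : 'rV[R]_m.+1) => e 0 i * act g (lam (f i)) a b)) => i _.
  by apply: (@continuous_mulf R); [exact: coord_continuous | exact: continuous_cstf].
have gc_continuous v : continuous (fun e => gcoords g J (lift e) v).
  move=> e; exact: (continuous_comp (lift_continuous e) (@gcoords_continuous g J v gW _)).
have total_continuous : continuous (fun e => total (lift e)).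
  exact: (@continuous_sumf R _ _ _ _ (fun v e => gcoords g J (lift e) v)).
have total_gt0 e : e != 0 -> 0 < total (lift e).
  move=> e0; rewrite lt_neqAle sumr_ge0 ?andbT => [|v _]; last exact: gcoords_ge0.
  rewrite eq_sym; apply: contra_neq e0; rewrite /total gcoords_sum //.
  have [wg wd] := dominatingP J (lift e) gW; set w := dominating _ _ _ in wg wd *.
  have wW := coset_in gW wg.
  move/eqP; rewrite psumr_eq0 => [/allP h|j /wd //].
  have w0 j : j \in J -> coef j (act w^-1%g (lift e)) = 0.
    by move=> jJ; have := h j (mem_index_enum _); rewrite jJ /= => /eqP.
  apply/rowP => i; rewrite -coef_lift mxE.
  have gw : (g^-1 * w)%g \in parab r J by rewrite -mem_lcoset.
  have := parab_fix w0 gw; rewrite actM ?groupV // actKV // => ->.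
  exact: w0.
(* Lifting the projection changes [bary t] only by a vector with zero coordinates in [J], which the
   fan coordinates ignore. *)
have shift t w : w \in (g *: parab r J)%g -> (forall v, 0 <= t v) ->
    (forall v, v \notin [set vertex w i | i in J]%SET -> t v = 0) ->
    gcoords g J (lift (phi t)) = t.
  move=> wg t0 tJ; rewrite -[RHS](gcoords_bary gW wg t0 tJ).
  rewrite -[lift (phi t)](subrK (bary t)) addrC gcoords_shift // => j jJ.
  have [i <-] := f_surj j jJ.
  by rewrite actB coefD coefN coef_lift mxE subrr.
have realP (t : {ptws {set gT} -> R}) : realization (R := R)
    (link (face_complex W r) [set vertex g i | i in I]%SET) t ->
    gcoords g J (lift (phi t)) = t.
  move=> [t0 _ /(linkP I _ gW)[w [M [wg MJ tM]]]]; apply: shift wg t0 _ => v vn.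
  apply/eqP; apply: contraNT vn => tv.
  have : v \in finset (fun v => t v != 0) by rewrite inE.
  rewrite tM => /imsetP[i iM ->]; apply: imset_f; exact: (fintype.subsetP MJ).
apply: (@pi_trivial_retract R n _ _ _ [set x : 'rV[R]_m.+1 | x != 0] phi psi).
- apply: mx_continuous => a i.
  rewrite (_ : (fun t => phi t a i) = fun t : {ptws {set gT} -> R} =>
      coef (f i) (act g^-1%g (bary t))); last by apply/funext => t; rewrite mxE.
  have c1 : continuous (fun t : {ptws {set gT} -> R} => act g^-1%g (bary t)).
    by move=> t; exact: (continuous_comp (@bary_continuous t) (@act_continuous g^-1%g _)).
  by move=> t; exact: (continuous_comp (c1 t) (@coef_continuous (f i) _)).
- apply: continuous_in_subspaceT => e; rewrite inE /= => e0.
  apply: ptws_continuous_at => v.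
  apply: (@continuousM R _ (fun e => (total (lift e))^-1) (fun e => gcoords g J (lift e) v) e).
    by apply: continuousV; [rewrite gt_eqF // total_gt0 | exact: total_continuous].
  exact: gc_continuous.
- move=> t tA; apply/eqP => phi0; have [_ t1 _] := tA; move: t1.
  rewrite -(realP t tA) phi0 big1 => [/esym/eqP|v _]; first by rewrite oner_eq0.
  rewrite (_ : lift 0 = 0 *: lift 0) ?gcoordsZ ?mul0r // scale0r /lift.
  by rewrite big1 ?actE ?mulmx0 // => i _; rewrite mxE scale0r.
- move=> e e0; have tg0 := total_gt0 e e0; split.
  + by move=> v; rewrite mulr_ge0 ?gcoords_ge0 // invr_ge0 ltW.
  + by rewrite /psi -mulr_sumr mulVf // gt_eqF.
  apply/(linkP I _ gW); have [wg wd] := dominatingP J (lift e) gW.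
  set w := dominating _ _ _ in wg wd.
  exists w, [set i in J | psi e (vertex w i) != 0]%SET; split=> //.
    by apply/fintype.subsetP => i; rewrite inE => /andP[].
  apply/finset.setP => v; rewrite inE; apply/idP/imsetP => [ev|[ i ]]; last first.
    by rewrite inE => /andP[_ ?] ->.
  have [/imsetP[i iJ vi]|vn] := boolP (v \in [set vertex w j | j in J]%SET).
    by exists i => //; rewrite inE iJ -vi.
  by move: ev; rewrite /psi (gcoords_support gW vn) mulr0 eqxx.
- move=> t tA; apply/funext => v; rewrite /psi /total (realP t tA).
  by have [_ -> _] := tA; rewrite invr1 mul1r.
- exact: punctured_pi_trivial.
Qed.

Lemma coxeter_homotopy_CM : Delta_homotopy_CM R W r.
Proof.
split; [exact: verts_subset | exact: face_complex_simplicial |].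
move=> _ /face_complexP[g [I [gW ->]]] n nd; apply: link_pi_trivial => //.
have := le_trans nd (lerB (dimc_link I gW) (lexx 1)).
by lia.
Qed.

End SimpleReflections.

Theorem theorem8p1 (R : realType) (l : nat) (gT : finGroupType)
    (W : {group gT}) (rW : mx_representation R W l)
    (C : set 'cV[R]_l) (r : 'I_l -> gT) (lam : 'I_l -> 'cV[R]_l)
    (hrefl : reflection_group rW) (hirr : irreducible_action rW)
    (hC : weyl_chamber rW C) (hr : wall_reflections rW C r)
    (hlam : ray_points rW C r lam) :
  [/\ strongly_stratified (complex_repr rW) r (fun i => complexify (lam i)),
      radially_coxeter_complex rW r lam,
      Delta_homotopy_CM R W r &
      locally_conical (complex_repr rW) r (fun i => complexify (lam i))].

Proof.
have [faithfulW genW] := hrefl; have [_ walls] := hr; have [ext _ lamH] := hlam.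
have rR i : r i \in reflections rW by have [] := (walls (r i)).2 (ex_intro _ i erefl).
have lamC i : C (lam i) by have [] := ext i.
split.
- exact: (coxeter_strongly_stratified faithfulW genW hC rR lamC lamH).
- exact: (radial_coxeter faithfulW genW hC rR lamC lamH).
- exact: (coxeter_homotopy_CM faithfulW genW hC rR lamC lamH).
- exact: (coxeter_locally_conical faithfulW genW hC rR lamC lamH hirr).
Qed.
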